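(* Let $\overline M=M\cup\partial M$ be an oriented smooth manifold of dimension $n\geq 3$ with boundary $\partial M$ and interior $M$, and let $\mathcal G$ be an equivalence class of ALH metrics on $M$ for the relation $\sim_{n-2}$. Assume that for each $x\in\partial M$ there is an open neighborhood $U$ of $x$ in $\overline M$ and a metric $g\in\mathcal G$ that is hyperbolic (i.e. has constant sectional curvature $-1$) on $U$. Let $c=\frac1nc_1+\frac12c_2$ be the cocycle on $\mathcal G$ defined in the context. Then for such an open subset $U$ and any two metrics $g_1,g_2\in\mathcal G$ that are hyperbolic on $U$, one has $$c(g_1,h)|_{U\cap\partial M}=c(g_2,h)|_{U\cap\partial M}\qquad\text{for any }h\in\mathcal G.$$ Hence these quantities fit together to a well-defined section $c(h)\in\Omega^{n-1}(\partial M,\mathcal T\partial M)$ (with $c(h)|_{U\cap\partial M}=c(g,h)|_{U\cap\partial M}$ whenever $g\in\mathcal G$ is hyperbolic on $U$), thus defining a map $c$ from $\mathcal G$ to tractor-valued differential forms. This map is equivariant under diffeomorphisms preserving $\mathcal G$ in the sense that for $\Phi\in\operatorname{Diff}_{\mathcal G}(\overline M)$ and $h\in\mathcal G$, $$c(\Phi^*h)=(\Phi_\infty)^*c(h),$$ where $\Phi_\infty:=\Phi|_{\partial M}\in\operatorname{Conf}(\partial M,[\mathcal G_\infty])$ and the right hand side uses the standard action of conformal isometries on tractor-valued differential forms.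
   Context: All objects are $C^\infty$; abstract index notation is used. Setting. A local defining function for $\partial M$ is a smooth $\rho:U\to[0,\infty)$, $U\subset\overline M$ open, with $U\cap\partial M=\rho^{-1}(0)$ and $d\rho$ nowhere zero on $U\cap\partial M$; $\rho_a$ denotes $d\rho$. A tensor field is $\mathcal O(\rho^k)$, $k>0$, if near boundary points it equals $\rho^k$ times a tensor field that is smooth up to the boundary. A Riemannian metric $g$ on $M$ is conformally compact if near each boundary point $\rho^2g$ extends smoothly to the boundary with non-degenerate boundary values, for some (equivalently any) local defining function; it is ALH (asymptotically locally hyperbolic) if in addition $(\rho^2g)^{-1}(d\rho,d\rho)\equiv1$ along $\partial M$. For conformally compact $g,h$ write $g\sim_{n-2}h$ if $\rho^2g-\rho^2h=\mathcal O(\rho^n)$. All metrics in $\mathcal G$ induce the same conformal structure $[\mathcal G_\infty]$ on $\partial M$ (the class of the metrics induced on $\partial M$ by the boundary values of $\rho^2g$). $\operatorname{Conf}(\partial M,[\mathcal G_\infty])$ denotes its group of conformal isometries. $\operatorname{Diff}_{\mathcal G}(\overline M)$ is the group of diffeomorphisms $\Phi$ of $\overline M$ (as manifold with boundary) with $\Phi^*\mathcal G=\mathcal G$. That a metric on $M$ is hyperbolic on $U$ refers to $U\cap M$. Boundary tractor bundle. $\mathcal E[w]$ is the bundle of densities of weight $w$ (with $\mathcal E[2(n-1)]=\otimes^2\Lambda^{n-1}T\partial M$ on $\partial M$), $\mathcal E_a$ is the cotangent bundle, and $B[w]=B\otimes\mathcal E[w]$. The standard tractor bundle $\mathcal T\partial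 M$ of $(\partial M,[\mathcal G_\infty])$ has rank $n+1$: each metric $\gamma$ in $[\mathcal G_\infty]$ gives an isomorphism $\mathcal T\partial M\cong\mathcal E[1]\oplus\mathcal E_a[1]\oplus\mathcal E[-1]$, written as triples $(\sigma,\mu_a,\nu)$, and for $\widehat\gamma=e^{2f}\gamma$, $\Upsilon=df$, these are related by $\widehat\sigma=\sigma$, $\widehat\mu_a=\mu_a+\Upsilon_a\sigma$, $\widehat\nu=\nu-\mathbf g^{ij}(\Upsilon_i\mu_j+\frac12\Upsilon_i\Upsilon_j\sigma)$, where $\mathbf g$ is the conformal metric of $[\mathcal G_\infty]$. $\mathbf X^A=(0,0,1)\in\Gamma(\mathcal T\partial M[1])$ is the canonical section. Cocycles. Given $g,h\in\mathcal G$ and a local defining function $\rho$: $\mu_{ij}$ and $\mu$ (smooth up to the boundary) are defined by $h_{ij}=g_{ij}+\rho^{n-2}\mu_{ij}$ and $g^{ij}\mu_{ij}=\rho^2\mu$, and $\mu^0_{ij}=\mu_{ij}-\frac1n\rho^2\mu g_{ij}$; $\overline g=\rho^2g$ and $\overline g_\infty$ is the metric it induces on $\partial M$; $\overline\sigma_\infty\in\Gamma(\mathcal E[1])$ is the $1$-density on $\partial M$ corresponding to $\overline g_\infty$ (i.e. $\overline g_\infty=\overline\sigma_\infty^{-2}\mathbf g$); $\operatorname{vol}_{\overline g_\infty}$ is the volume form of $\overline g_\infty$ with $\operatorname{vol}_{\overline g}=d\rho\wedge\operatorname{vol}_{\overline g_\infty}$ along $\partial M$. Then $$c_1(g,h)=\tfrac{n^2-1}{2}\operatorname{vol}_{\overline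 g_\infty}\mu|_{\partial M}\,\overline\sigma_\infty^{-1}\mathbf X^A,\qquad c_2(g,h)=-\overline g^{ij}\overline g^{k\ell}\rho_i\rho_k\mu^0_{j\ell}|_{\partial M}\operatorname{vol}_{\overline g_\infty}\overline\sigma_\infty^{-1}\mathbf X^A ,$$ which are independent of $\rho$ and lie in $\Omega^{n-1}(\partial M,\mathcal T\partial M)$, the space of $\mathcal T\partial M$-valued $(n-1)$-forms on $\partial M$. Being a cocycle means $c(h,g)=-c(g,h)$ and $c(g,k)=c(g,h)+c(h,k)$ for $g,h,k\in\mathcal G$. Action of conformal isometries. A conformal isometry $\phi$ of $(\partial M,[\mathcal G_\infty])$ acts on tractors by pulling back triples: a section with triple $(\sigma,\mu_a,\nu)$ in the splitting of $\gamma$ is pulled back to the section with triple $(\phi^*\sigma,\phi^*\mu_a,\phi^*\nu)$ in the splitting of $\phi^*\gamma$. On tractor-valued differential forms it acts by combining this with the usual pull-back of differential forms: $\phi^*(\omega\otimes s)=\phi^*\omega\otimes\phi^*s$.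
   Formalization: Diffeomorphisms in Diff_G are required to preserve orientation, both for equivariance and for Φ_∞ ∈ Conf; for orientation-reversing Φ the volume form changes sign, so c(Φ*h) = −(Φ_∞)*c(h) and the stated formula fails whenever c(h) ≠ 0 (e.g. reflections of the hyperbolic ball). *)

(* Defs.v *)
From mathcomp Require Import all_boot all_order all_algebra.
From mathcomp Require Import all_classical all_reals all_analysis.

Set Implicit Arguments.
Unset Strict Implicit.
Unset Printing Implicit Defensive.

Import Order.TTheory GRing.Theory Num.Theory.
Import numFieldNormedType.Exports.

Local Open Scope classical_set_scope.
Local Open Scope ring_scope.

(* The dimension of the manifold is n = m + 1, that of its boundary is m.
    The coordinate of index [ord0] is the one normal to the boundary; the
    coordinates of index [lift ord0 j], j : 'I_m, are tangential. *)

Section Calculus.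
Context {R : realType} {m : nat}.
Implicit Types (A O : set 'rV[R]_m.+1) (F : 'rV[R]_m.+1 -> R).

Definition halfspace : set 'rV[R]_m.+1 := [set x | 0 <= x ord0 ord0].

Fixpoint iter_partial (s : seq 'I_m.+1) (F : 'rV[R]_m.+1 -> R^o)
    : 'rV[R]_m.+1 -> R^o :=
  if s is i :: s' then fun x => 'D_(delta_mx ord0 i) (iter_partial s' F) x
  else F.

Definition smooth_open O F : Prop :=
  forall s x, O x -> differentiable (iter_partial s (F : _ -> R^o)) x.

(* Smoothness on an arbitrary subset, by local extension.  It is used with A
   relatively open in the half-space, or in the hyperplane x 0 0 = 0. *)
Definition smooth_on A F : Prop :=
  forall x, A x -> exists O F',
    [/\ open O, O x, smooth_open O F' & forall y, O y -> A y -> F' y = F y].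

(* Partial derivative relative to the half-space: one-sided in the normal
   direction at points of the hyperplane x 0 0 = 0.  A tangential partial
   derivative at such a point only involves values of F on the hyperplane. *)
Definition partial (i : 'I_m.+1) F (x : 'rV[R]_m.+1) : R :=
  let e : 'rV[R]_m.+1 := delta_mx ord0 i in
  lim ((fun t : R => t^-1 * (F (x + t *: e) - F x)) @
       within [set t | halfspace (x + t *: e)] (dnbhs (0 : R))).

End Calculus.

Record chart (R : realType) (T : topologicalType) (m : nat) := Chart {
  cdom : set T;
  cmap : T -> 'rV[R]_m.+1;
  cinv : 'rV[R]_m.+1 -> T
}.

Definition wf_chart (R : realType) (T : topologicalType) (m : nat)
    (c : chart R T m) : Prop :=
  [/\ open (cdom c),
      (exists2 O, open O & cmap c @` cdom c = O `&` halfspace),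
      (forall p, cdom c p -> cinv c (cmap c p) = p),
      {within cdom c, continuous (cmap c)} &
      {within cmap c @` cdom c, continuous (cinv c)}].

Section CoordinateMaps.
Context {R : realType} {T : topologicalType} {m : nat}.
Implicit Types (c d : chart R T m) (phi : T -> T).

Definition smooth_map_on (A : set T) c d phi : Prop :=
  forall i, smooth_on (cmap c @` (A `&` cdom c `&` phi @^-1` cdom d))
                      (fun x => cmap d (phi (cinv c x)) ord0 i).

(* (i, j) entry: the derivative of the i-th coordinate (in d) of phi along the
   j-th coordinate of c. *)
Definition jac phi c d (p : T) : 'M[R]_m.+1 :=
  \matrix_(i, j) partial j (fun x => cmap d (phi (cinv c x)) ord0 i) (cmap c p).

Definition tangential (A : 'M[R]_m.+1) : 'M[R]_m :=
  \matrix_(i, j) A (lift ord0 i) (lift ord0 j).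

Definition bjac phi c d (p : T) : 'M[R]_m := tangential (jac phi c d p).

End CoordinateMaps.

(* An orientation is given by an atlas whose transition maps all have positive
   Jacobian; for n >= 2 such atlases with values in the half-space exist on any
   oriented manifold with boundary. *)
Record oriented_mfd (R : realType) (T : topologicalType) (m : nat) := OrientedMfd {
  atlas : set (chart R T m);
  chart_at : T -> chart R T m;
  chart_at_atlas : forall p, atlas (chart_at p) /\ cdom (chart_at p) p;
  atlas_wf : forall c, atlas c -> wf_chart c;
  atlas_smooth : forall c d, atlas c -> atlas d -> smooth_map_on setT c d id;
  atlas_oriented : forall c d p, atlas c -> atlas d -> cdom c p -> cdom d p ->
    0 < \det (jac id c d p);
  mfd_hausdorff : hausdorff_space T;
  mfd_second_countable : @second_countable T
}.

Section Geometry.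
Context {R : realType} {T : topologicalType} {m : nat} (X : oriented_mfd R T m).
Implicit Types (c d : chart R T m) (p : T) (U V W : set T).

Local Notation dimn := (m.+1).

Definition bdry : set T :=
  [set p | exists c, [/\ atlas X c, cdom c p & cmap c p ord0 ord0 = 0]].

Definition inter : set T := ~` bdry.

(* A covariant 2-tensor field is the family of its component matrices in all
   charts; only the values t c p with c in the atlas and p in cdom c matter. *)

Definition tensor2 := chart R T m -> T -> 'M[R]_m.+1.
Implicit Types (g h t : tensor2).

Definition tensor2_law W t : Prop :=
  forall c d p, atlas X c -> atlas X d -> W p -> cdom c p -> cdom d p ->
    t c p = (jac id c d p)^T *m t d p *m jac id c d p.

Definition smooth_tensor2 W t : Prop :=
  tensor2_law W t /\
  forall c i j, atlas X c ->
    smooth_on (cmap c @` (W `&` cdom c)) (fun x => t c (cinv c x) i j).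

Definition eq_tensor2 W t t' : Prop :=
  forall c p, atlas X c -> W p -> cdom c p -> t c p = t' c p.

Definition riem_mx (k : nat) (A : 'M[R]_k) : Prop :=
  A^T = A /\ forall v : 'rV[R]_k, v != 0 -> 0 < (v *m A *m v^T) ord0 ord0.

Definition is_metric g : Prop :=
  smooth_tensor2 inter g /\
  forall c p, atlas X c -> inter p -> cdom c p -> riem_mx (g c p).

Definition drho (rho : T -> R) c p : 'rV[R]_m.+1 :=
  \row_i partial i (fun x => rho (cinv c x)) (cmap c p).

Definition local_def U (rho : T -> R) : Prop :=
  [/\ open U,
      (forall c, atlas X c ->
         smooth_on (cmap c @` (U `&` cdom c)) (fun x => rho (cinv c x))),
      (forall p, U p -> 0 <= rho p),
      (forall p, U p -> (bdry p <-> rho p = 0)) &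
      (forall c p, atlas X c -> U p -> bdry p -> cdom c p -> drho rho c p != 0)].

Definition bigO U (rho : T -> R) (k : nat) t : Prop :=
  forall p, U p -> bdry p -> exists V s,
    [/\ open V, V p, V `<=` U, smooth_tensor2 V s &
        eq_tensor2 (V `&` inter) t (fun c q => rho q ^+ k *: s c q)].

Definition rescale (rho : T -> R) g : tensor2 := fun c p => rho p ^+ 2 *: g c p.

(* Conformally compact, with gbar the extension of rho^2 g to the boundary, and
   |d rho|^2 = 1 along the boundary. *)
Definition ALH g : Prop :=
  is_metric g /\
  forall U rho, local_def U rho -> exists gbar,
    [/\ smooth_tensor2 U gbar,
        eq_tensor2 (U `&` inter) gbar (rescale rho g),
        (forall c p, atlas X c -> U p -> bdry p -> cdom c p ->
           gbar c p \in unitmx) &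
        (forall c p, atlas X c -> U p -> bdry p -> cdom c p ->
           (drho rho c p *m invmx (gbar c p) *m (drho rho c p)^T) ord0 ord0 = 1)].

(* The relation denoted by ~ with index n - 2. *)
Definition asymp g h : Prop :=
  forall U rho, local_def U rho ->
    bigO U rho dimn (fun c p => rescale rho g c p - rescale rho h c p).

Definition asymp_class (G : set tensor2) : Prop :=
  exists2 g0, ALH g0 & forall g, G g <-> (ALH g /\ asymp g0 g).

Definition dcoord (i : 'I_m.+1) (f : T -> R) c p : R :=
  partial i (fun x => f (cinv c x)) (cmap c p).

Definition christoffel g c (k i j : 'I_m.+1) p : R :=
  2^-1 * \sum_l invmx (g c p) k l *
    (dcoord i (fun q => g c q j l) c p + dcoord j (fun q => g c q i l) c p
     - dcoord l (fun q => g c q i j) c p).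

(* l-th component of R(e_i, e_j) e_k, where
   R(X, Y) Z = D_X D_Y Z - D_Y D_X Z - D_[X, Y] Z. *)
Definition riemann g c (l k i j : 'I_m.+1) p : R :=
  dcoord i (christoffel g c l j k) c p - dcoord j (christoffel g c l i k) c p
  + \sum_q (christoffel g c l i q p * christoffel g c q j k p
            - christoffel g c l j q p * christoffel g c q i k p).

Definition ip (A : 'M[R]_m.+1) (v w : 'rV[R]_m.+1) : R :=
  (v *m A *m w^T) ord0 ord0.

Definition sectional g c p (v w : 'rV[R]_m.+1) : R :=
  let Rvww : 'rV[R]_m.+1 :=
    \row_l \sum_k \sum_i \sum_j
      riemann g c l k i j p * v ord0 i * w ord0 j * w ord0 k in
  ip (g c p) Rvww v /
  (ip (g c p) v v * ip (g c p) w w - ip (g c p) v w ^+ 2).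

Definition hyperbolic_on U g : Prop :=
  forall c p (v w : 'rV[R]_m.+1), atlas X c -> U p -> inter p -> cdom c p ->
    row_free (col_mx v w) -> sectional g c p v w = -1.

(* Value at the boundary point p of the continuous extension of a function
   defined on the interior. *)
Definition bval c (f : T -> R) p : R :=
  lim ((fun x => f (cinv c x)) @
       within [set x : 'rV[R]_m.+1 | 0 < x ord0 ord0] (nbhs (cmap c p))).

Definition bval_mx c (t : T -> 'M[R]_m.+1) p : 'M[R]_m.+1 :=
  \matrix_(i, j) bval c (fun q => t q i j) p.

Definition gbar_bdry (rho : T -> R) g c p : 'M[R]_m.+1 :=
  bval_mx c (rescale rho g c) p.

Definition gbar_infty (rho : T -> R) g c p : 'M[R]_m :=
  tangential (gbar_bdry rho g c p).

Definition btensor2 := chart R T m -> T -> 'M[R]_m.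
Implicit Types (gam : btensor2).

Definition is_bmetric gam : Prop :=
  [/\ forall c d p, atlas X c -> atlas X d -> bdry p -> cdom c p -> cdom d p ->
        gam c p = (bjac id c d p)^T *m gam d p *m bjac id c d p,
      forall c i j, atlas X c ->
        smooth_on (cmap c @` (bdry `&` cdom c)) (fun x => gam c (cinv c x) i j) &
      forall c p, atlas X c -> bdry p -> cdom c p -> riem_mx (gam c p)].

Definition conf_class (G : set tensor2) : set btensor2 :=
  [set gam | is_bmetric gam /\
    forall g U rho c p, G g -> local_def U rho -> atlas X c ->
      U p -> bdry p -> cdom c p ->
      exists2 lam : R, 0 < lam & gam c p = lam *: gbar_infty rho g c p].

(* Sections of E[w] are given in each chart by their component with respect to
    the power w / m of the density associated with the coordinates, so that
    components in c and d are related by |det (bjac id c d)| ^ (- w / m).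
    The 1-density sigma of a metric gam with components A satisfies
    sigma ^ (-2m) = det A, and the conformal metric is sigma ^ 2 A. *)

Definition metric_density (A : 'M[R]_m) : R := \det A `^ (- (2 * m)%:R^-1).

Definition conf_metric (A : 'M[R]_m) : 'M[R]_m := metric_density A ^+ 2 *: A.

(* Component (sigma, mu_a, nu), in a chart and a splitting, of an element of
   the tensor product of the line of m-forms (with basis dx^1 ... dx^m) with
   the standard tractor bundle. *)
Definition triple := (R^o * 'rV[R]_m * R^o)%type.

Definition tractor_form := btensor2 -> chart R T m -> T -> triple.
Implicit Types (s : tractor_form).

(* Pull-back of the components of a tractor-valued m-form along a map with
   Jacobian J: \det J comes from the form part, the powers of |\det J| from the
   weights 1, 1 and -1 of the three slots. *)
Definition pull_triple (J : 'M[R]_m) (t : triple) : triple :=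
  (\det J * `|\det J| `^ (- m%:R^-1) * t.1.1,
   (\det J * `|\det J| `^ (- m%:R^-1)) *: (t.1.2 *m J),
   \det J * `|\det J| `^ (m%:R^-1) * t.2).

Definition change_splitting (A : 'M[R]_m) (ups : 'rV[R]_m) (t : triple)
    : triple :=
  let b := invmx (conf_metric A) in
  (t.1.1,
   t.1.2 + t.1.1 *: ups,
   t.2 - ((ups *m b *m t.1.2^T) ord0 ord0
          + 2^-1 * (ups *m b *m ups^T) ord0 ord0 * t.1.1)).

Definition bsmooth_fun (f : T -> R) : Prop :=
  forall c, atlas X c ->
    smooth_on (cmap c @` (bdry `&` cdom c)) (fun x => f (cinv c x)).

Definition bdiff (f : T -> R) c p : 'rV[R]_m :=
  \row_j dcoord (lift ord0 j) f c p.

Definition is_tractor_form (G : set tensor2) s : Prop :=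
  [/\ forall gam c d p, conf_class G gam -> atlas X c -> atlas X d ->
        bdry p -> cdom c p -> cdom d p ->
        s gam c p = pull_triple (bjac id c d p) (s gam d p),
      forall gam gam' f, conf_class G gam -> conf_class G gam' ->
        bsmooth_fun f ->
        (forall c p, atlas X c -> bdry p -> cdom c p ->
           gam' c p = expR (2 * f p) *: gam c p) ->
        forall c p, atlas X c -> bdry p -> cdom c p ->
          s gam' c p = change_splitting (gam c p) (bdiff f c p) (s gam c p) &
      forall gam c, conf_class G gam -> atlas X c ->
        let A := cmap c @` (bdry `&` cdom c) in
        [/\ smooth_on A (fun x => (s gam c (cinv c x)).1.1),
            (forall j, smooth_on A (fun x => (s gam c (cinv c x)).1.2 ord0 j)) &
            smooth_on A (fun x => (s gam c (cinv c x)).2)]].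

Definition eq_tractor_form (G : set tensor2) W s s' : Prop :=
  forall gam c p, conf_class G gam -> atlas X c -> W p -> bdry p -> cdom c p ->
    s gam c p = s' gam c p.

Definition mu_tensor (rho : T -> R) g h : tensor2 := fun c p =>
  (rho p ^+ (dimn - 2))^-1 *: (h c p - g c p).

Definition mu_trace (rho : T -> R) g h c p : R :=
  (rho p ^+ 2)^-1 * \tr (invmx (g c p) *m mu_tensor rho g h c p).

Definition mu_tracefree (rho : T -> R) g h : tensor2 := fun c p =>
  mu_tensor rho g h c p
  - (dimn%:R^-1 * rho p ^+ 2 * mu_trace rho g h c p) *: g c p.

(* Along the boundary d rho is a positive multiple of dx^0, so the orientation
   of the boundary for which vol = d rho /\ vol_infty is the one of the
   coordinates x^1, ..., x^m of the (oriented) charts. *)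
Definition vol_infty (rho : T -> R) g c p : R :=
  Num.sqrt (\det (gbar_infty rho g c p)).

Definition sigma_infty (rho : T -> R) g c p : R :=
  metric_density (gbar_infty rho g c p).

Definition tractor_X : triple := (0, 0, 1).

(* The weighted section X has the same components in all splittings: the
   argument gam is not used. *)
Definition c1 (rho : T -> R) g h : tractor_form := fun gam c p =>
  ((dimn ^ 2 - 1)%:R / 2 * vol_infty rho g c p * bval c (mu_trace rho g h c) p
   * (sigma_infty rho g c p)^-1) *: tractor_X.

Definition c2 (rho : T -> R) g h : tractor_form := fun gam c p =>
  let ginv := invmx (gbar_bdry rho g c p) in
  let mu0 := bval_mx c (mu_tracefree rho g h c) p in
  let r := drho rho c p in
  (- (\sum_i \sum_j \sum_k \sum_l
        ginv i j * ginv k l * r ord0 i * r ord0 k * mu0 j l)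
   * vol_infty rho g c p * (sigma_infty rho g c p)^-1) *: tractor_X.

Definition cocycle (rho : T -> R) g h : tractor_form := fun gam c p =>
  dimn%:R^-1 *: c1 rho g h gam c p + 2^-1 *: c2 rho g h gam c p.

(* s is the section c(h): it coincides with c(g, h), computed with any local
   defining function, wherever g in G is hyperbolic. *)
Definition is_cocycle_section (G : set tensor2) h s : Prop :=
  is_tractor_form G s /\
  forall U g V rho, open U -> G g -> hyperbolic_on U g -> local_def V rho ->
    eq_tractor_form G (U `&` V) s (cocycle rho g h).

(* The second component is the inverse of the first one. *)
Definition is_diffeo (Phi Psi : T -> T) : Prop :=
  [/\ cancel Phi Psi, cancel Psi Phi, continuous Phi, continuous Psi &
      forall c d, atlas X c -> atlas X d ->
        smooth_map_on setT c d Phi /\ smooth_map_on setT c d Psi].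

Definition orientation_preserving (Phi : T -> T) : Prop :=
  forall c d p, atlas X c -> atlas X d -> cdom c p -> cdom d (Phi p) ->
    0 < \det (jac Phi c d p).

Definition pull_tensor2 (Phi : T -> T) t : tensor2 := fun c p =>
  let d := chart_at X (Phi p) in
  (jac Phi c d p)^T *m t d (Phi p) *m jac Phi c d p.

(* Diffeomorphisms of the oriented manifold, with Phi^* G = G. *)
Definition diff_class (G : set tensor2) (Phi Psi : T -> T) : Prop :=
  [/\ is_diffeo Phi Psi, orientation_preserving Phi,
      (forall h, G h -> G (pull_tensor2 Phi h)) &
      (forall k, G k ->
         exists2 h, G h & eq_tensor2 inter (pull_tensor2 Phi h) k)].

Definition pull_btensor2 (phi : T -> T) gam : btensor2 := fun c p =>
  let d := chart_at X (phi p) in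
  (bjac phi c d p)^T *m gam d (phi p) *m bjac phi c d p.

(* Only the restrictions of phi and psi to the boundary matter. *)
Definition conf_isometry (G : set tensor2) (phi psi : T -> T) : Prop :=
  [/\ (forall p, bdry p -> bdry (phi p) /\ psi (phi p) = p),
      (forall p, bdry p -> bdry (psi p) /\ phi (psi p) = p),
      {within bdry, continuous phi} /\ {within bdry, continuous psi},
      (forall c d, atlas X c -> atlas X d ->
         smooth_map_on bdry c d phi /\ smooth_map_on bdry c d psi) &
      (forall gam, conf_class G gam -> conf_class G (pull_btensor2 phi gam))].

(* Pull-back along the conformal isometry phi with inverse psi: the triple in
   the splitting of gam = phi^* (psi^* gam) is the pull-back of the triple in
   the splitting of psi^* gam. *)
Definition pull_tractor_form (phi psi : T -> T) s : tractor_form :=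
  fun gam c p =>
    let d := chart_at X (phi p) in
    pull_triple (bjac phi c d p) (s (pull_btensor2 psi gam) d (phi p)).

End Geometry.

(* Main.v *)
(** In every splitting the first two slots of c(g, h) vanish, and the third one is a
    universal expression K(A, S, r) in the boundary values A of rho^2 g, S of
    rho^-(n-2) (h - g), and r of d rho: up to a density, it is
    (n tr_A S - S(nu, nu)) / 2, where nu is the unit normal r A^-1.  It is linear in S,
    invariant under changes of rho, and natural under diffeomorphisms.

    Let g1 and g2 be hyperbolic near a boundary point, and write g1 = t^-2 G and
    g2 = t^-2 (G + t^n S) in coordinates with normal coordinate t.  The equation
    "sectional curvature -1" for t^-2 G amounts to P = 0 for t > 0, where P is smooth up
    to t = 0.  The expressions P for g1 and g2 differ by t^n B, where B is smooth up to
    t = 0 as well, so B vanishes on the boundary, where it is algebraic in G and S.  For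
    the plane spanned by nu and a tangential vector w this reads
    n S(w, w) + S(nu, nu) G(w, w) = 0, and the trace over w gives n tr S = S(nu, nu),
    that is c(g1, g2) = 0.  Hence c(g1, h) = c(g2, h) by the cocycle property.

    Pulling a hyperbolic metric back by a diffeomorphism yields a hyperbolic metric, so
    that the equivariance of c(h) reduces to the naturality of K. *)

Require Import Defs.
From mathcomp Require Import all_boot all_order all_algebra.
From mathcomp Require Import all_classical all_reals all_analysis.
From mathcomp Require Import ring lra.

Set Implicit Arguments.
Unset Strict Implicit.
Unset Printing Implicit Defensive.

Import Order.TTheory GRing.Theory Num.Theory.
Import numFieldNormedType.Exports.

Local Open Scope classical_set_scope.
Local Open Scope ring_scope.

(** Smoothness up to the boundary is defined by local extension, so tensors are replaced by smooth
    matrix functions on an open set crossing the hyperplane t = 0. An extension carries no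
    information for t < 0: curvature equations are used for t > 0 only and reach t = 0 by
    continuity.

    The weight n is decisive: on t^n S the operator t d/dt acts as multiplication by n, up to terms
    vanishing at t = 0. Thus neither derivatives of S nor derivatives of G survive in B on the
    boundary. The equation for the plane of nu and w comes out multiplied by -(n - 2)/2, and
    cancelling this factor is where n >= 3 enters.

    A metric has the literal form t^-2 G only when the defining function is the normal coordinate of
    a chart. Every other defining function is compared with this one along normal paths, where only
    the limit of rho / t matters and no smooth quotient has to be constructed.

    Curvature is handled as the vector R(v, w) w rather than by indices. Its naturality is a
    statement on local isometries between open sets of coordinates, where the higher derivatives of
    the map cancel by symmetry of second derivatives. *)

Lemma differentiable_near_eq (R : realType) (V W : normedModType R) (f g : V -> W) x :
  (\forall y \near x, f y = g y) -> differentiable f x -> differentiable g x.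
Proof.
move=> fg /diff_locallyP[cf df].
have e : (g \o shift x = cst (g x) + 'd f x +o_ 0 id).
  apply/eqaddoP => e e0.
  have := df; rewrite eqaddoP => /(_ e e0).
  have : \forall h \near (0 : V), f (h + x) = g (h + x).
    by have := fg; rewrite (near_shift 0 x) subr0.
  apply: filterS2 => h fgh /=.
  by rewrite -!/(_ + _) !fctE /= -fgh (nbhs_singleton fg).
have dE := diff_unique cf e.
by apply/diff_locallyP; rewrite dE.
Qed.

(** * Smooth functions on open sets *)

Lemma near_forall (T : topologicalType) (n : nat) (P : 'I_n -> T -> Prop) (x : T) :
  (forall i, \forall y \near x, P i y) -> \forall y \near x, forall i, P i y.
Proof.
by move=> h; apply: filterS (@filter_forall _ _ (fun i => [set y | P i y]) _ (nbhs_filter x) h) => y.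
Qed.

Section SmoothOpen.
Context {R : realType} {m : nat}.
Local Notation rV := 'rV[R]_m.+1.
Implicit Types (O : set rV) (F G : rV -> R).

Local Notation e_ i := (delta_mx ord0 i : rV).

(** [iter_partial] adds derivatives on the outside; peeling off the innermost one instead lets an
    induction on the list replace [F] by one of its partial derivatives. *)
Lemma iter_partial_rcons s i F :
  iter_partial (rcons s i) F = iter_partial s ('D_(e_ i) (F : rV -> R^o)).
Proof. by elim: s => //= j s ->. Qed.

Lemma iter_partial_eq O F G s : open O -> (forall y, O y -> F y = G y) ->
  forall y, O y -> iter_partial s F y = iter_partial s G y.
Proof.
move=> oO FG; elim: s => [|i s IH] y Oy /=; first exact: FG.
apply: near_eq_derive; near=> z; apply: IH.
by near: z; exact: open_nbhs_nbhs.
Unshelve. all: by end_near. Qed.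

Lemma smooth_open_eq O F G : open O -> (forall y, O y -> F y = G y) ->
  smooth_open O F -> smooth_open O G.
Proof.
move=> oO FG sF s x Ox; apply: differentiable_near_eq (sF s x Ox).
near=> z; apply: (iter_partial_eq _ oO FG).
by near: z; exact: open_nbhs_nbhs.
Unshelve. all: by end_near. Qed.

Lemma smooth_open_sub O O' F : O `<=` O' -> smooth_open O' F -> smooth_open O F.
Proof. by move=> s sF t x Ox; apply: sF; exact: s. Qed.

Lemma smooth_open_differentiable O F x : smooth_open O F -> O x ->
  differentiable (F : rV -> R^o) x.
Proof. by move=> sF Ox; exact: (sF [::] x Ox). Qed.

Lemma smooth_open_partial O F i : smooth_open O F ->
  smooth_open O ('D_(e_ i) (F : rV -> R^o)).
Proof. by move=> sF s x Ox; rewrite -iter_partial_rcons; exact: sF. Qed.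

(** Coinduction for smoothness: one differentiation step inside the class [P] suffices, since
    induction from the innermost derivative moves from [F] to another member of [P]. The derivative
    and that member only agree on [O], but openness of [O] makes their further derivatives agree
    there too. *)
Lemma smooth_open_coind O (P : (rV -> R) -> Prop) : open O ->
  (forall F, P F -> (forall x, O x -> differentiable (F : rV -> R^o) x) /\
     forall i, exists2 G, P G & forall x, O x -> 'D_(e_ i) (F : rV -> R^o) x = G x) ->
  forall F, P F -> smooth_open O F.
Proof.
move=> oO hP F PF s; elim/last_ind: s F PF => [|s i IH] F PF x Ox.
  by have [dF _] := hP F PF; exact: dF.
have [_ /(_ i)[G PG eG]] := hP F PF.
rewrite iter_partial_rcons; apply: differentiable_near_eq (IH _ PG x Ox).
near=> z; apply: esym; apply: (@iter_partial_eq O) => //.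
by near: z; exact: open_nbhs_nbhs.
Unshelve. all: by end_near. Qed.

Lemma derive_sum_partial F x (v : rV) : differentiable (F : rV -> R^o) x ->
  'D_v (F : rV -> R^o) x = \sum_i v ord0 i * 'D_(e_ i) (F : rV -> R^o) x.
Proof.
move=> dF; rewrite deriveE// {1}(row_sum_delta v) linear_sum/=.
by apply: eq_bigr => i _; rewrite linearZ /= deriveE.
Qed.

Lemma differentiable_rV (Phi : rV -> rV) x :
  (forall j, differentiable (fun y => Phi y ord0 j : R^o) x) ->
  differentiable Phi x /\
  forall v, 'D_v Phi x = \row_j 'D_v (fun y => Phi y ord0 j : R^o) x.
Proof.
move=> dP.
have E : Phi = \sum_j (fun y => (Phi y ord0 j) *: e_ j).
  by apply/funext => y; rewrite fct_sumE {1}(row_sum_delta (Phi y)).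
have dPhi : differentiable Phi x.
  rewrite E; apply: differentiable_sum => j.
  exact: (@differentiableZl _ _ _ (fun y => Phi y ord0 j)).
split=> // v.
rewrite derive_mx; last exact: diff_derivable.
by apply/rowP => j; rewrite !mxE.
Qed.

Lemma derive_comp_rV (Phi : rV -> rV) F x v :
  (forall j, differentiable (fun y => Phi y ord0 j : R^o) x) ->
  differentiable (F : rV -> R^o) (Phi x) ->
  differentiable ((F \o Phi) : rV -> R^o) x /\
  'D_v ((F \o Phi) : rV -> R^o) x =
    \sum_j 'D_v (fun y => Phi y ord0 j : R^o) x * 'D_(e_ j) (F : rV -> R^o) (Phi x).
Proof.
move=> dP dF; have [dPhi dv] := differentiable_rV dP.
have dC : differentiable ((F \o Phi) : rV -> R^o) x by exact: differentiable_comp.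
split=> //; rewrite deriveE// diff_comp//= -deriveE// -deriveE// derive_sum_partial//.
by apply: eq_bigr => j _; rewrite dv mxE.
Qed.

(* This class is stable under partial derivatives, hence consists of smooth
   functions by [smooth_open_coind]. *)
Inductive smooth_closure O : (rV -> R) -> Prop :=
| SmBase F : smooth_open O F -> smooth_closure O F
| SmAdd F G : smooth_closure O F -> smooth_closure O G ->
    smooth_closure O (fun x => F x + G x)
| SmMul F G : smooth_closure O F -> smooth_closure O G ->
    smooth_closure O (fun x => F x * G x)
| SmInv F : smooth_closure O F -> (forall x, O x -> F x != 0) ->
    smooth_closure O (fun x => (F x)^-1)
| SmPow F a : smooth_closure O F -> (forall x, O x -> 0 < F x) ->
    smooth_closure O (fun x => F x `^ a)
| SmComp O' F (Phi : rV -> rV) : smooth_open O' F ->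
    (forall j, smooth_closure O (fun x => Phi x ord0 j)) ->
    (forall x, O x -> O' (Phi x)) ->
    smooth_closure O (F \o Phi).

Lemma smooth_open_cst O (a : R) : smooth_open O (cst a).
Proof.
move=> s x _; have -> : iter_partial s (cst a : rV -> R^o) = cst (if s is [::] then a else 0).
  elim: s => //= i s ->; apply/funext => y; exact: derive_cst.
exact: differentiable_cst.
Qed.

Lemma smooth_closure_sum O n (F : 'I_n -> rV -> R) :
  (forall i, smooth_closure O (F i)) -> smooth_closure O (fun x => \sum_i F i x).
Proof.
elim: n F => [|n IH] F sF.
  have -> : (fun x => \sum_(i < 0) F i x) = cst 0.
    by apply/funext => x; rewrite big_ord0.
  by apply: SmBase; exact: smooth_open_cst.
have -> : (fun x => \sum_(i < n.+1) F i x) =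
    (fun x => F ord0 x + \sum_(i < n) F (lift ord0 i) x).
  by apply/funext => x; rewrite big_ord_recl.
by apply: SmAdd => //; apply: IH.
Qed.

Lemma derive_comp_powR F a x v : differentiable (F : rV -> R^o) x -> 0 < F x ->
  differentiable (fun y => F y `^ a : R^o) x /\
  'D_v (fun y => F y `^ a : R^o) x = a * F x `^ (a - 1) * 'D_v (F : rV -> R^o) x.
Proof.
move=> dF Fx; have [dp ep] := is_derive1_powR a Fx.
pose pw : R^o -> R^o := fun y => @powR R y a.
have dP : differentiable pw (F x) by exact/derivable1_diffP.
have dC : differentiable (pw \o (F : rV -> R^o)) x by exact: differentiable_comp.
split; first exact: dC.
rewrite -[LHS]/('D_v (pw \o (F : rV -> R^o)) x).
rewrite deriveE// diff_comp//= diff1E//= derive1E ep -deriveE// mulrC.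
by rewrite /GRing.scale /= mulrC.
Qed.

(** Each constructor is differentiated by its own rule, and the result is again built from
    constructors. The side conditions on inverses and powers make these rules valid at every point
    of [O]. *)
Lemma smooth_closureP O F : open O -> smooth_closure O F ->
  (forall x, O x -> differentiable (F : rV -> R^o) x) /\
  forall i, exists2 G, smooth_closure O G &
    forall x, O x -> 'D_(e_ i) (F : rV -> R^o) x = G x.
Proof.
move=> oO; elim=> {F}.
- move=> F sF; split=> [x Ox|i]; first exact: smooth_open_differentiable sF Ox.
  by eexists; [apply: SmBase; exact: (smooth_open_partial i sF)|].
- move=> F G sF [dF eF] sG [dG eG]; split=> [x Ox|i].
    by apply: differentiableD; [exact: dF|exact: dG].
  have [F' sF' F'E] := eF i; have [G' sG' G'E] := eG i.
  exists (fun x => F' x + G' x) => [|x Ox]; first exact: SmAdd.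
  rewrite -F'E// -G'E//.
  by apply: (@deriveD _ _ _ (F : rV -> R^o) (G : rV -> R^o)); apply: diff_derivable;
    [exact: dF|exact: dG].
- move=> F G sF [dF eF] sG [dG eG]; split=> [x Ox|i].
    by apply: differentiableM; [exact: dF|exact: dG].
  have [F' sF' F'E] := eF i; have [G' sG' G'E] := eG i.
  exists (fun x => F x * G' x + G x * F' x) => [|x Ox]; first by apply: SmAdd; exact: SmMul.
  rewrite -F'E// -G'E//.
  by apply: (@deriveM _ _ (F : rV -> R) (G : rV -> R)); apply: diff_derivable;
    [exact: dF|exact: dG].
- move=> F sF [dF eF] F0; split=> [x Ox|i].
    by apply: (@differentiableV _ _ (F : rV -> R)); [exact: dF|exact: F0].
  have [F' sF' F'E] := eF i.
  exists (fun x => -1 * ((F x)^-1 * (F x)^-1) * F' x) => [|x Ox].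
    apply: SmMul => //; apply: SmMul; first by apply: SmBase; exact: smooth_open_cst.
    by apply: SmMul; exact: SmInv.
  rewrite -F'E// -[LHS]/('D_(e_ i) (fun x => (F x)^-1) x).
  rewrite (@deriveV _ _ (F : rV -> R)) ?F0//; last exact/diff_derivable/dF.
  by rewrite /GRing.scale/= mulN1r -[in RHS]invfM -expr2.
- move=> F a sF [dF eF] F0; split=> [x Ox|i].
    by have [] := derive_comp_powR a 0 (dF x Ox) (F0 x Ox).
  have [F' sF' F'E] := eF i.
  exists (fun x => a * F x `^ (a - 1) * F' x) => [|x Ox].
    apply: SmMul => //; apply: SmMul; first by apply: SmBase; exact: smooth_open_cst.
    exact: SmPow.
  by rewrite -F'E//; have [] := derive_comp_powR a (e_ i) (dF x Ox) (F0 x Ox).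
- move=> O' F Phi sF sP eP PO; split=> [x Ox|i].
    have [|//] := @derive_comp_rV Phi F x 0 (fun j => (eP j).1 x Ox).
    by apply: smooth_open_differentiable sF _; exact: PO.
  have /choice[P' hP'] : forall j, exists G, smooth_closure O G /\
      forall x, O x -> 'D_(e_ i) (fun y => Phi y ord0 j : R^o) x = G x.
    by move=> j; have [G ? ?] := (eP j).2 i; exists G.
  exists (fun x => \sum_j P' j x * ('D_(e_ j) (F : rV -> R^o) \o Phi) x) => [|x Ox].
    apply: smooth_closure_sum => j; apply: SmMul; first by have [] := hP' j.
    by apply: SmComp PO => //; exact: smooth_open_partial.
  have [|_ ->] := @derive_comp_rV Phi F x (e_ i) (fun j => (eP j).1 x Ox).
    by apply: smooth_open_differentiable sF _; exact: PO.
  by apply: eq_bigr => j _; rewrite (hP' j).2.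
Qed.

Lemma smooth_closure_smooth O F : open O -> smooth_closure O F -> smooth_open O F.
Proof.
by move=> oO; apply: smooth_open_coind => // G; exact: smooth_closureP.
Qed.

Section Operations.
Variables (O : set rV) (oO : open O).

Lemma smooth_openD F G : smooth_open O F -> smooth_open O G ->
  smooth_open O (fun x => F x + G x).
Proof.
by move=> sF sG; apply: smooth_closure_smooth oO _; apply: SmAdd; exact: SmBase.
Qed.

Lemma smooth_openM F G : smooth_open O F -> smooth_open O G ->
  smooth_open O (fun x => F x * G x).
Proof.
by move=> sF sG; apply: smooth_closure_smooth oO _; apply: SmMul; exact: SmBase.
Qed.

Lemma smooth_openV F : smooth_open O F -> (forall x, O x -> F x != 0) ->
  smooth_open O (fun x => (F x)^-1).
Proof.
by move=> sF F0; apply: smooth_closure_smooth oO _; apply: SmInv => //; exact: SmBase.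
Qed.

Lemma smooth_open_powR F a : smooth_open O F -> (forall x, O x -> 0 < F x) ->
  smooth_open O (fun x => F x `^ a).
Proof.
by move=> sF F0; apply: smooth_closure_smooth oO _; apply: SmPow => //; exact: SmBase.
Qed.

Lemma smooth_open_comp O' F (Phi : rV -> rV) : smooth_open O' F ->
  (forall j, smooth_open O (fun x => Phi x ord0 j)) ->
  (forall x, O x -> O' (Phi x)) -> smooth_open O (F \o Phi).
Proof.
move=> sF sP PO; apply: smooth_closure_smooth oO _.
by apply: SmComp sF _ PO => j; exact: SmBase.
Qed.

Lemma smooth_openN F : smooth_open O F -> smooth_open O (fun x => - F x).
Proof.
move=> sF; rewrite (_ : (fun x => - F x) = fun x => cst (-1) x * F x).
  by apply: smooth_openM => //; exact: smooth_open_cst.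
by apply/funext => x /=; rewrite mulN1r.
Qed.

Lemma smooth_openZ a F : smooth_open O F -> smooth_open O (fun x => a * F x).
Proof. by move=> sF; apply: smooth_openM => //; exact: smooth_open_cst. Qed.

Lemma smooth_openB F G : smooth_open O F -> smooth_open O G ->
  smooth_open O (fun x => F x - G x).
Proof. by move=> sF sG; apply: smooth_openD => //; exact: smooth_openN. Qed.

Lemma smooth_open_sum (I : Type) (r : seq I) (P : pred I) (F : I -> rV -> R) :
  (forall i, smooth_open O (F i)) -> smooth_open O (fun x => \sum_(i <- r | P i) F i x).
Proof.
move=> sF; elim: r => [|i r IH].
  rewrite (_ : (fun _ => _) = cst 0); first exact: smooth_open_cst.
  by apply/funext => x; rewrite big_nil.
case Pi : (P i).
  rewrite (_ : (fun _ => _) = fun x => F i x + \sum_(j <- r | P j) F j x).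
    exact: smooth_openD.
  by apply/funext => x; rewrite big_cons Pi.
rewrite (_ : (fun _ => _) = fun x => \sum_(j <- r | P j) F j x)//.
by apply/funext => x; rewrite big_cons Pi.
Qed.

Lemma smooth_open_derive F v : smooth_open O F -> smooth_open O ('D_v (F : rV -> R^o)).
Proof.
move=> sF; apply: (@smooth_open_eq O (fun y => \sum_i v ord0 i * 'D_(e_ i) (F : rV -> R^o) y)) => //.
  by move=> y Oy; rewrite -derive_sum_partial//; exact: smooth_open_differentiable sF Oy.
by apply: smooth_open_sum => i; apply: smooth_openZ; exact: smooth_open_partial.
Qed.

Lemma smooth_open_prod (I : Type) (r : seq I) (P : pred I) (F : I -> rV -> R) :
  (forall i, smooth_open O (F i)) -> smooth_open O (fun x => \prod_(i <- r | P i) F i x).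
Proof.
move=> sF; elim: r => [|i r IH].
  rewrite (_ : (fun _ => _) = cst 1); first exact: smooth_open_cst.
  by apply/funext => x; rewrite big_nil.
case Pi : (P i).
  rewrite (_ : (fun _ => _) = fun x => F i x * \prod_(j <- r | P j) F j x).
    exact: smooth_openM.
  by apply/funext => x; rewrite big_cons Pi.
rewrite (_ : (fun _ => _) = fun x => \prod_(j <- r | P j) F j x)//.
by apply/funext => x; rewrite big_cons Pi.
Qed.

Lemma smooth_openX F n : smooth_open O F -> smooth_open O (fun x => F x ^+ n).
Proof.
move=> sF; elim: n => [|n IH].
  by rewrite (_ : (fun _ => _) = cst 1); [exact: smooth_open_cst|exact/funext].
rewrite (_ : (fun _ => _) = fun x => F x * F x ^+ n); first exact: smooth_openM.
by apply/funext => x; rewrite exprS.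
Qed.

Lemma smooth_open_det n (A : rV -> 'M[R]_n) :
  (forall i j, smooth_open O (fun x => A x i j)) -> smooth_open O (fun x => \det (A x)).
Proof.
move=> sA; apply: smooth_open_sum => s; apply: smooth_openM.
  exact: smooth_open_cst.
exact: smooth_open_prod.
Qed.

(** On invertible matrices the inverse is the adjugate over the determinant, a quotient of
    polynomials in the entries. *)
Lemma smooth_open_inv n (A : rV -> 'M[R]_n) i j :
  (forall i j, smooth_open O (fun x => A x i j)) ->
  (forall x, O x -> A x \in unitmx) -> smooth_open O (fun x => invmx (A x) i j).
Proof.
move=> sA uA.
apply: (@smooth_open_eq O (fun x => (\det (A x))^-1 * cofactor (A x) j i)) => //.
  by move=> x Ox; rewrite /invmx uA// mxE mxE.
apply: smooth_openM.
  apply: smooth_openV; first exact: smooth_open_det.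
  by move=> x Ox; have := uA x Ox; rewrite unitmxE unitfE.
apply: smooth_openM; first exact: smooth_open_cst.
apply: smooth_open_det => k l.
rewrite (_ : (fun x => _) = fun x => A x (lift j k) (lift i l)) //.
by apply/funext => x; rewrite !mxE.
Qed.

Lemma smooth_open_mul (n p q : nat) (A : rV -> 'M[R]_(n, p)) (B : rV -> 'M[R]_(p, q)) i j :
  (forall i j, smooth_open O (fun x => A x i j)) ->
  (forall i j, smooth_open O (fun x => B x i j)) ->
  smooth_open O (fun x => (A x *m B x) i j).
Proof.
move=> sA sB; rewrite (_ : (fun _ => _) = fun x => \sum_k A x i k * B x k j).
  by apply: smooth_open_sum => k; exact: smooth_openM.
by apply/funext => x; rewrite mxE.
Qed.

Lemma smooth_open_coord i : smooth_open O (fun x : rV => x ord0 i).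
Proof.
(* The coordinate together with the constants is a class closed under partial derivatives. *)
apply: (@smooth_open_coind O (fun F => F = (fun x => x ord0 i) \/ exists a, F = cst a)) => //; last by left.
move=> F [->|[a ->]]; split=> [x Ox|j].
- exact: differentiable_coord.
- exists (cst ((e_ j : rV) ord0 i)); first by right; exists ((e_ j : rV) ord0 i).
  move=> x Ox.
  have := @derive_mx R _ 1 m.+1 id x (e_ j) (@derivable_id _ _ _ _).
  by rewrite derive_id => /matrixP /(_ ord0 i); rewrite !mxE.
- exact: differentiable_cst.
- by exists (cst 0) => [|x Ox]; [right; exists 0|exact: derive_cst].
Qed.

End Operations.

Lemma smooth_open_continuous O F x : smooth_open O F -> O x -> {for x, continuous F}.
Proof.
by move=> sF Ox; apply: (@differentiable_continuous _ _ R^o); exact: smooth_open_differentiable sF Ox.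
Qed.

End SmoothOpen.

(** * Metrics with a double pole along a hyperplane *)

Section Core.
Context {R : realType} {m : nat}.
Local Notation rV := 'rV[R]_m.+1.
Local Notation e_ i := (delta_mx ord0 i : rV).
Local Notation o0 := (@ord0 m).
Implicit Types (O : set rV) (F : rV -> R) (A G M : rV -> 'M[R]_m.+1) (u v w z x y : rV).

Definition chr A (k i j : 'I_m.+1) (x : rV) : R :=
  2^-1 * \sum_l invmx (A x) k l *
    ('D_(e_ i) (fun y => A y j l : R^o) x + 'D_(e_ j) (fun y => A y i l : R^o) x
     - 'D_(e_ l) (fun y => A y i j : R^o) x).

Definition ctr (h : 'I_m.+1 -> 'I_m.+1 -> 'I_m.+1 -> rV -> R) (x u z : rV) : rV :=
  \row_k \sum_i \sum_j h k i j x * u ord0 i * z ord0 j.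

(** R(v, w) w for the connection with coefficients [h] and constant vector fields [v] and [w], whose
    bracket vanishes. *)
Definition curv_vec (h : 'I_m.+1 -> 'I_m.+1 -> 'I_m.+1 -> rV -> R) (v w x : rV) : rV :=
  \row_l ('D_v (fun y => ctr h y w w ord0 l : R^o) x
          - 'D_w (fun y => ctr h y v w ord0 l : R^o) x)
  + ctr h x v (ctr h x w w) - ctr h x w (ctr h x v w).

(** Sectional curvature -1 cleared of its denominator, so that no quotient has to be followed up to
    t = 0. *)
Definition hyp_eq A v w x : Prop :=
  ip (A x) (curv_vec (chr A) v w x) v =
  - (ip (A x) v v * ip (A x) w w - ip (A x) v w ^+ 2).

Lemma derive_coord (i : 'I_m.+1) v x : 'D_v (fun y : rV => y ord0 i : R^o) x = v ord0 i.
Proof.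
have := @derive_mx R _ 1 m.+1 id x v (@derivable_id _ _ _ _).
by rewrite derive_id => /matrixP /(_ ord0 i); rewrite !mxE.
Qed.

Lemma ip_addl (B : 'M[R]_m.+1) u v w : ip B (u + v) w = ip B u w + ip B v w.
Proof. by rewrite /ip !mulmxDl mxE. Qed.
Lemma ip_addr (B : 'M[R]_m.+1) u v w : ip B u (v + w) = ip B u v + ip B u w.
Proof. by rewrite /ip linearD mulmxDr mxE. Qed.
Lemma ip_scalel (B : 'M[R]_m.+1) a u w : ip B (a *: u) w = a * ip B u w.
Proof. by rewrite /ip -!scalemxAl mxE. Qed.
Lemma ip_scaler (B : 'M[R]_m.+1) a u w : ip B u (a *: w) = a * ip B u w.
Proof. by rewrite /ip linearZ /= -!scalemxAr mxE. Qed.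
Lemma ip_oppl (B : 'M[R]_m.+1) u w : ip B (- u) w = - ip B u w.
Proof. by rewrite /ip !mulNmx mxE. Qed.
Lemma ip_mxD (B C : 'M[R]_m.+1) u w : ip (B + C) u w = ip B u w + ip C u w.
Proof. by rewrite /ip mulmxDr mulmxDl mxE. Qed.
Lemma ip_mxZ a (B : 'M[R]_m.+1) u w : ip (a *: B) u w = a * ip B u w.
Proof. by rewrite /ip -scalemxAr -scalemxAl mxE. Qed.
Lemma ip_sym (B : 'M[R]_m.+1) u w : B^T = B -> ip B u w = ip B w u.
Proof.
move=> sB; rewrite /ip -[in LHS](trmxK (u *m B *m w^T)) mxE.
by rewrite !trmx_mul trmxK sB mulmxA.
Qed.
Lemma ipE (B : 'M[R]_m.+1) u w : ip B u w = \sum_i \sum_j B i j * u ord0 i * w ord0 j.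
Proof.
rewrite /ip !mxE exchange_big /=; apply: eq_bigr => j _; rewrite !mxE mulr_suml.
by apply: eq_bigr => i _; rewrite [_ * B _ _]mulrC.
Qed.

Section Ctr.
Implicit Types h : 'I_m.+1 -> 'I_m.+1 -> 'I_m.+1 -> rV -> R.

Lemma ctrDr h x u v w : ctr h x u (v + w) = ctr h x u v + ctr h x u w.
Proof.
apply/rowP => k; rewrite !mxE -big_split; apply: eq_bigr => i _ /=.
rewrite -big_split; apply: eq_bigr => j _ /=; rewrite !mxE; ring.
Qed.

Lemma ctrZl h x a u w : ctr h x (a *: u) w = a *: ctr h x u w.
Proof.
apply/rowP => k; rewrite !mxE mulr_sumr; apply: eq_bigr => i _ /=.
rewrite mulr_sumr; apply: eq_bigr => j _ /=; rewrite !mxE; ring.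
Qed.

Lemma ctrZr h x a u w : ctr h x u (a *: w) = a *: ctr h x u w.
Proof.
apply/rowP => k; rewrite !mxE mulr_sumr; apply: eq_bigr => i _ /=.
rewrite mulr_sumr; apply: eq_bigr => j _ /=; rewrite !mxE; ring.
Qed.

Lemma ctr_add h h' h'' x a u w :
  (forall k i j, h k i j x = h' k i j x + a * h'' k i j x) ->
  ctr h x u w = ctr h' x u w + a *: ctr h'' x u w.
Proof.
move=> E; apply/rowP => k; rewrite !mxE mulr_sumr -big_split; apply: eq_bigr => i _ /=.
rewrite mulr_sumr -big_split; apply: eq_bigr => j _ /=; rewrite E; ring.
Qed.

Lemma ctr_scale h h' x a u w : (forall k i j, h k i j x = a * h' k i j x) ->
  ctr h x u w = a *: ctr h' x u w.
Proof.
move=> E; apply/rowP => k; rewrite !mxE mulr_sumr; apply: eq_bigr => i _ /=.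
rewrite mulr_sumr; apply: eq_bigr => j _ /=; rewrite E; ring.
Qed.

Lemma smooth_ctr O h (u w : rV -> rV) k : open O ->
  (forall k i j, smooth_open O (h k i j)) ->
  (forall i, smooth_open O (fun y => u y ord0 i)) ->
  (forall i, smooth_open O (fun y => w y ord0 i)) ->
  smooth_open O (fun y => ctr h y (u y) (w y) ord0 k).
Proof.
move=> oO sh su sw.
rewrite (_ : (fun _ => _) =
  fun y => \sum_i \sum_j h k i j y * u y ord0 i * w y ord0 j); last first.
  by apply/funext => y; rewrite mxE.
apply: (smooth_open_sum oO) => i; apply: (smooth_open_sum oO) => j.
by apply: (smooth_openM oO) => //; apply: (smooth_openM oO).
Qed.

(* The terms produced by differentiating a power of the coordinate x_0 in the
   Christoffel symbols have this shape. *)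
Lemma ctr_delta h (B C : 'M[R]_m.+1) x u w :
  (forall k i j, h k i j x = \sum_l B k l *
     ((i == o0)%:R * C j l + (j == o0)%:R * C i l - (l == o0)%:R * C i j)) ->
  ctr h x u w = (u ord0 o0 *: (w *m C) + w ord0 o0 *: (u *m C) - ip C u w *: e_ o0) *m B^T.
Proof.
move=> E; apply/rowP => k; rewrite mxE.
have dl (f : 'I_m.+1 -> R) : \sum_i (i == o0)%:R * f i = f o0.
  rewrite (bigD1 o0) //= mul1r big1 ?addr0 // => i /negbTE ->.
  by rewrite mul0r.
transitivity (\sum_l B k l * (u ord0 o0 * (\sum_j C j l * w ord0 j) +
   w ord0 o0 * (\sum_i C i l * u ord0 i) -
   (l == o0)%:R * (\sum_i \sum_j C i j * u ord0 i * w ord0 j))).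
  transitivity (\sum_l \sum_i \sum_j B k l *
     ((i == o0)%:R * C j l + (j == o0)%:R * C i l - (l == o0)%:R * C i j) *
     u ord0 i * w ord0 j).
    rewrite [RHS]exchange_big; apply: eq_bigr => i _ /=.
    rewrite [RHS]exchange_big; apply: eq_bigr => j _ /=.
    by rewrite E !mulr_suml.
  apply: eq_bigr => l _.
  transitivity (B k l * (\sum_i \sum_j ((i == o0)%:R * (u ord0 i * (C j l * w ord0 j)) +
     (j == o0)%:R * (w ord0 j * (C i l * u ord0 i))
     - (l == o0)%:R * (C i j * u ord0 i * w ord0 j)))).
    rewrite mulr_sumr; apply: eq_bigr => i _.
    rewrite mulr_sumr; apply: eq_bigr => j _; ring.
  congr (_ * _).
  under eq_bigr do rewrite sumrB big_split /= -!mulr_sumr.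
  rewrite sumrB big_split /= -mulr_sumr; congr (_ + _ - _).
    rewrite (eq_bigr (fun i => (i == o0)%:R * (u ord0 i * \sum_j C j l * w ord0 j))) ?dl//.
  rewrite mulr_sumr; apply: eq_bigr => i' _.
  by rewrite dl mulrA [_ * C _ _]mulrC -mulrA; congr (_ * _); rewrite mulrC.
rewrite mxE; apply: eq_bigr => l _; rewrite !mxE [LHS]mulrC ipE eqxx andTb.
congr (_ * _); congr (_ + _ - _); last by rewrite mulrC.
- by congr (_ * _); apply: eq_bigr => j _; rewrite mulrC.
- by congr (_ * _); apply: eq_bigr => j _; rewrite mulrC.
Qed.

End Ctr.

Lemma derive_addf F (G : rV -> R) v x : differentiable (F : rV -> R^o) x -> differentiable (G : rV -> R^o) x ->
  'D_v (fun y => F y + G y : R^o) x = 'D_v (F : rV -> R^o) x + 'D_v (G : rV -> R^o) x.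
Proof.
by move=> dF dG; apply: (@deriveD _ _ _ (F : rV -> R^o) (G : rV -> R^o)); exact: diff_derivable.
Qed.

Lemma derive_mulf F (G : rV -> R) v x : differentiable (F : rV -> R^o) x -> differentiable (G : rV -> R^o) x ->
  'D_v (fun y => F y * G y : R^o) x = F x * 'D_v (G : rV -> R^o) x + G x * 'D_v (F : rV -> R^o) x.
Proof.
by move=> dF dG; apply: (@deriveM _ _ F G); exact: diff_derivable.
Qed.

Lemma diff_height x : differentiable (fun y : rV => y ord0 o0 : R^o) x.
Proof. exact: differentiable_coord. Qed.

Lemma diff_heightX n x : differentiable (fun y : rV => y ord0 o0 ^+ n : R^o) x.
Proof.
elim: n => [|n IH].
  rewrite (_ : (fun _ => _) = cst 1); first exact: differentiable_cst.
  by apply/funext => y; rewrite expr0.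
rewrite (_ : (fun _ => _) = (fun y : rV => y ord0 o0 : R) * (fun y => y ord0 o0 ^+ n)).
  by apply: (differentiableM (f := fun y : rV => y ord0 o0)) => //; exact: diff_height.
by apply/funext => y; rewrite exprS.
Qed.

Lemma derive_heightX n v x : 'D_v (fun y : rV => y ord0 o0 ^+ n.+1 : R^o) x =
  n.+1%:R * x ord0 o0 ^+ n * v ord0 o0.
Proof.
have := @deriveX R rV (fun y => y ord0 o0) n.+1 x v (diff_derivable (diff_height x)).
rewrite derive_coord => h; rewrite -[RHS]h.
by congr (derive _ x v); apply/funext => y; rewrite fctE.
Qed.

Lemma derive_powM n F v x : differentiable (F : rV -> R^o) x ->
  'D_v (fun y : rV => y ord0 o0 ^+ n.+1 * F y : R^o) x =
  x ord0 o0 ^+ n * (n.+1%:R * v ord0 o0 * F x + x ord0 o0 * 'D_v (F : rV -> R^o) x).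
Proof.
move=> dF; rewrite derive_mulf//; last exact: diff_heightX.
by rewrite derive_heightX exprS; ring.
Qed.

Lemma diff_pVM n F x : 0 < x ord0 o0 -> differentiable (F : rV -> R^o) x ->
  differentiable (fun y : rV => (y ord0 o0 ^+ n)^-1 * F y : R^o) x.
Proof.
move=> x0 dF; apply: differentiableM => //.
apply: (@differentiableV _ _ (fun y : rV => y ord0 o0 ^+ n)); first exact: diff_heightX.
by rewrite expf_neq0// gt_eqF.
Qed.

Lemma derive_pVM n F v x : 0 < x ord0 o0 -> differentiable (F : rV -> R^o) x ->
  'D_v (fun y : rV => (y ord0 o0 ^+ n)^-1 * F y : R^o) x =
  (x ord0 o0 ^+ n.+1)^-1 * (x ord0 o0 * 'D_v (F : rV -> R^o) x - n%:R * v ord0 o0 * F x).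
Proof.
move=> x0 dF; have xn0 : x ord0 o0 != 0 by rewrite gt_eqF.
rewrite derive_mulf//; last first.
  have := @diff_pVM n (cst 1) x x0 (@differentiable_cst _ _ _ _ _).
  by congr (differentiable _ _); apply/funext => y /=; rewrite mulr1.
rewrite (@deriveV _ _ (fun y : rV => y ord0 o0 ^+ n)); last 2 first.
- by rewrite expf_neq0.
- exact/diff_derivable/diff_heightX.
case: n => [|n].
  rewrite (_ : (fun _ => _) = cst 1) ?derive_cst; last by apply/funext => y; rewrite expr0.
  by rewrite scaler0 expr0 expr1; field.
by rewrite derive_heightX /GRing.scale /= !exprS; field; rewrite xn0 expf_neq0.
Qed.

Section Singular.
Variables (O : set rV) (oO : open O).
Variable G : rV -> 'M[R]_m.+1.
Hypothesis sG : forall i j, smooth_open O (fun y => G y i j).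
Hypothesis uG : forall y, O y -> G y \in unitmx.

(* The singular metric is [sing] = t^-2 G with t the normal coordinate.  [Hof] is t
   times its Christoffel symbols, [Qof] is t^2 times its curvature R(v,w)w, and [Pof] is
   t^4 times the defect of sectional curvature -1: all are smooth up to t = 0. *)
Definition Wof (l i j : 'I_m.+1) (y : rV) : R :=
  y ord0 o0 * ('D_(e_ i) (fun y => G y j l : R^o) y + 'D_(e_ j) (fun y => G y i l : R^o) y
     - 'D_(e_ l) (fun y => G y i j : R^o) y)
  - 2 * ((i == o0)%:R * G y j l + (j == o0)%:R * G y i l - (l == o0)%:R * G y i j).

Definition Hof (k i j : 'I_m.+1) (y : rV) : R :=
  2^-1 * \sum_l invmx (G y) k l * Wof l i j y.

Definition Qof v w y : rV :=
  (\row_l (y ord0 o0 * ('D_v (fun y => ctr Hof y w w ord0 l : R^o) y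
          - 'D_w (fun y => ctr Hof y v w ord0 l : R^o) y)))
  - v ord0 o0 *: ctr Hof y w w + w ord0 o0 *: ctr Hof y v w
  + ctr Hof y v (ctr Hof y w w) - ctr Hof y w (ctr Hof y v w).

Definition Pof v w y : R :=
  ip (G y) (Qof v w y) v + (ip (G y) v v * ip (G y) w w - ip (G y) v w ^+ 2).

Definition sing (y : rV) : 'M[R]_m.+1 := (y ord0 o0 ^+ 2)^-1 *: G y.

Lemma smooth_W l i j : smooth_open O (Wof l i j).
Proof.
apply: (smooth_openB oO).
  apply: (smooth_openM oO); first exact: smooth_open_coord.
  apply: (smooth_openB oO); last exact: smooth_open_partial.
  by apply: (smooth_openD oO); exact: smooth_open_partial.
apply: (smooth_openZ oO); apply: (smooth_openB oO); last exact: smooth_openZ.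
by apply: (smooth_openD oO); exact: smooth_openZ.
Qed.

Lemma smooth_H k i j : smooth_open O (Hof k i j).
Proof.
apply: (smooth_openZ oO); apply: (smooth_open_sum oO) => l; apply: (smooth_openM oO).
  exact: smooth_open_inv.
exact: smooth_W.
Qed.

Definition pos_part := O `&` [set y : rV | 0 < y ord0 o0].

Lemma open_pos_part : open pos_part.
Proof.
apply: openI => //.
have -> : [set y : rV | 0 < y ord0 o0] = (fun y : rV => y ord0 o0) @^-1` [set t | 0 < t] by [].
apply: open_comp; last exact: open_gt.
by move=> y _; exact: coord_continuous.
Qed.

(** Power counting: the inverse metric is t^2 G^-1, and a derivative of t^-2 G is t^-3 times an
    expression smooth at t = 0, which leaves t^-1. *)
Lemma chr_sing k i j y : pos_part y -> chr sing k i j y = (y ord0 o0)^-1 * Hof k i j y.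
Proof.
case=> Oy /= t0; have tn0 : y ord0 o0 != 0 by rewrite gt_eqF.
have dG i' j' v : 'D_v (fun y => sing y i' j' : R^o) y = (y ord0 o0 ^+ 3)^-1 *
   (y ord0 o0 * 'D_v (fun y => G y i' j' : R^o) y - 2 * v ord0 o0 * G y i' j').
  rewrite -derive_pVM//; last exact: smooth_open_differentiable (sG _ _) Oy.
  by congr ('D__ _ _); apply/funext => z; rewrite mxE.
rewrite /chr /Hof [RHS]mulrCA; congr (_ * _); rewrite mulr_sumr; apply: eq_bigr => l _.
rewrite !dG /sing invmxZ; last by rewrite unitmxZ ?uG// unitfE invr_eq0 expf_neq0.
rewrite invrK !mxE eqxx !andTb /Wof (eq_sym o0 i) (eq_sym o0 j) (eq_sym o0 l).
by field.
Qed.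

Lemma smooth_ctrH u w k : smooth_open O (fun y => ctr Hof y u w ord0 k).
Proof.
apply: (@smooth_ctr O Hof (cst u) (cst w)) => //.
- exact: smooth_H.
- by move=> i; exact: smooth_open_cst.
- by move=> i; exact: smooth_open_cst.
Qed.

Lemma ctr_sing u w y : pos_part y -> ctr (chr sing) y u w = (y ord0 o0)^-1 *: ctr Hof y u w.
Proof. by move=> Py; apply: ctr_scale => k i j; exact: chr_sing. Qed.

Lemma derive_ctr_sing u w v l y : pos_part y ->
  'D_v (fun y => ctr (chr sing) y u w ord0 l : R^o) y =
  (y ord0 o0 ^+ 2)^-1 * (y ord0 o0 * 'D_v (fun y => ctr Hof y u w ord0 l : R^o) y
    - v ord0 o0 * ctr Hof y u w ord0 l).
Proof.
move=> Py.
transitivity ('D_v (fun y => (y ord0 o0 ^+ 1)^-1 * ctr Hof y u w ord0 l : R^o) y).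
  apply: near_eq_derive; near=> z; rewrite ctr_sing; first by rewrite mxE expr1.
  by near: z; apply: open_nbhs_nbhs; split=> //; exact: open_pos_part.
rewrite derive_pVM ?mul1r//; first by case: Py.
by apply: (smooth_open_differentiable (smooth_ctrH _ _ _)); case: Py.
Unshelve. all: by end_near. Qed.

(** Differentiating t^-1 H yields t^-2 (t D_v H - v_0 H), and the terms quadratic in t^-1 H have the
    same order t^-2. *)
Lemma curv_sing v w y : pos_part y ->
  curv_vec (chr sing) v w y = (y ord0 o0 ^+ 2)^-1 *: Qof v w y.
Proof.
move=> Py; have t0 : y ord0 o0 != 0 by case: Py => _ /= t0; rewrite gt_eqF.
rewrite /curv_vec !ctr_sing// !ctrZr !scalerA /Qof.
rewrite -invfM -expr2 !scalerDr !scalerN.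
congr (_ + _ - _); apply/rowP => l; rewrite ![in RHS]mxE mxE !derive_ctr_sing// ![ctr _ _ _ _ _ _]mxE.
by ring.
Qed.

Lemma Pof_eq0 v w y : pos_part y -> hyp_eq sing v w y -> Pof v w y = 0.
Proof.
move=> Py; have t0 : y ord0 o0 != 0 by case: Py => _ /= t0; rewrite gt_eqF.
rewrite /hyp_eq curv_sing// /sing !ip_mxZ ip_scalel /Pof => h.
apply/eqP; rewrite -(mulrI_eq0 _ (x := (y ord0 o0 ^+ 2)^-1 * (y ord0 o0 ^+ 2)^-1)).
  by rewrite mulrDr -mulrA h; apply/eqP; field.
by apply/mulrI; rewrite unitfE mulf_neq0 ?invr_eq0 ?expf_neq0.
Qed.

End Singular.

(** Small positive steps in the normal direction stay in both neighbourhoods. This is how identities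
    known for t > 0 reach the hyperplane. *)
Lemma pos_dense O (P : set rV) x : x ord0 o0 = 0 -> nbhs x P -> nbhs x O ->
  exists y, [/\ P y, O y & 0 < y ord0 o0].
Proof.
move=> x0 Px Ox.
have cp : x + t *: e_ o0 @[t --> (0 : R)] --> x.
  rewrite -[x in _ --> x]addr0 -(scale0r (e_ o0)).
  apply: cvgD; first exact: cvg_cst.
  by apply: cvgZl; exact: cvg_id.
have [t [Pt Ot t0]] : exists t : R, [/\ P (x + t *: e_ o0), O (x + t *: e_ o0) & 0 < t].
  have /filter_ex[t []] : \forall t \near (0 : R)^'+,
      [/\ P (x + t *: e_ o0), O (x + t *: e_ o0) & 0 < t].
    near=> t; split; last by near: t; exact: nbhs_right_gt.
    - by near: t; apply: cvg_within; exact: cp.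
    - by near: t; apply: cvg_within; exact: cp.
  by exists t.
by exists (x + t *: e_ o0); rewrite !mxE eqxx x0 add0r mulr1.
Unshelve. all: by end_near. Qed.

Section Perturbation.
Variables (O : set rV) (oO : open O).
Variables (G1 M : rV -> 'M[R]_m.+1).
Hypothesis sG1 : forall i j, smooth_open O (fun y => G1 y i j).
Hypothesis sM : forall i j, smooth_open O (fun y => M y i j).
Let G2 (y : rV) : 'M[R]_m.+1 := G1 y + y ord0 o0 ^+ m.+1 *: M y.
Hypothesis uG1 : forall y, O y -> G1 y \in unitmx.
Hypothesis uG2 : forall y, O y -> G2 y \in unitmx.

Let sG2 i j : smooth_open O (fun y => G2 y i j).
Proof.
rewrite (_ : (fun _ => _) = fun y => G1 y i j + y ord0 o0 ^+ m.+1 * M y i j).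
  apply: (smooth_openD oO) => //; apply: (smooth_openM oO) => //.
  by apply: (smooth_openX oO); exact: smooth_open_coord.
by apply/funext => y; rewrite !mxE.
Qed.

(* [Z], [N], [S], [Delta] and [B] are the differences between G2 and G1 of [Wof], of the
   inverse metric, of [Hof], [Qof] and [Pof], divided by t^(m+1). *)
Let Z (l i j : 'I_m.+1) (y : rV) : R :=
  y ord0 o0 * ('D_(e_ i) (fun y => M y j l : R^o) y + 'D_(e_ j) (fun y => M y i l : R^o) y
     - 'D_(e_ l) (fun y => M y i j : R^o) y)
  + (m%:R - 1) * ((i == o0)%:R * M y j l + (j == o0)%:R * M y i l - (l == o0)%:R * M y i j).

Let N (y : rV) : 'M[R]_m.+1 := - (invmx (G2 y) *m M y *m invmx (G1 y)).

Let S (k i j : 'I_m.+1) (y : rV) : R :=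
  2^-1 * \sum_l (N y k l * Wof G1 l i j y + invmx (G2 y) k l * Z l i j y).

(** The factor m - 1 in [Z] is (m + 1) - 2: t times the derivative of t^(m+1) contributes m + 1, and
    the double pole of the metric contributes -2. *)
Let WE l i j y : O y -> Wof G2 l i j y = Wof G1 l i j y + y ord0 o0 ^+ m.+1 * Z l i j y.
Proof.
move=> Oy.
have dG i' j' v : 'D_v (fun y => G2 y i' j' : R^o) y = 'D_v (fun y => G1 y i' j' : R^o) y +
   y ord0 o0 ^+ m * (m.+1%:R * v ord0 o0 * M y i' j' + y ord0 o0 * 'D_v (fun y => M y i' j' : R^o) y).
  have d1 := smooth_open_differentiable (sG1 i' j') Oy.
  have d2 := smooth_open_differentiable (sM i' j') Oy.
  rewrite -derive_powM// -derive_addf//.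
    by congr ('D__ _ _); apply/funext => z; rewrite !mxE.
  by apply: differentiableM => //; exact: diff_heightX.
rewrite /Wof !dG /Z /G2 !mxE eqxx !andTb (eq_sym o0 i) (eq_sym o0 j) (eq_sym o0 l).
by rewrite exprS -[m.+1%:R]natr1; ring.
Qed.

(** The resolvent identity G2^-1 - G1^-1 = G2^-1 (G1 - G2) G1^-1. Keeping both inverses makes it
    exact, with no remainder to estimate. *)
Let invE y : O y -> invmx (G2 y) = invmx (G1 y) + y ord0 o0 ^+ m.+1 *: N y.
Proof.
move=> Oy; have u1 := uG1 Oy; have u2 := uG2 Oy.
have -> : y ord0 o0 ^+ m.+1 *: N y = invmx (G2 y) *m (G1 y - G2 y) *m invmx (G1 y).
  rewrite /N /G2 opprD addrA subrr sub0r mulmxN mulNmx scalerN.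
  by rewrite -scalemxAr -scalemxAl.
by rewrite mulmxBr mulmxBl mulVmx// mul1mx -mulmxA mulmxV// mulmx1 addrC subrK.
Qed.

Let HE k i j y : O y -> Hof G2 k i j y = Hof G1 k i j y + y ord0 o0 ^+ m.+1 * S k i j y.
Proof.
move=> Oy; rewrite /Hof /S mulrCA -mulrDr; congr (_ * _).
rewrite mulr_sumr -big_split; apply: eq_bigr => l _ /=.
rewrite WE// mulrDr {1}invE// mxE [(_ *: N y) k l]mxE; ring.
Qed.

Let ctrE u w y : O y -> ctr (Hof G2) y u w = ctr (Hof G1) y u w + y ord0 o0 ^+ m.+1 *: ctr S y u w.
Proof. by move=> Oy; apply: ctr_add => k i j; exact: HE. Qed.

Let sN i j : smooth_open O (fun y => N y i j).
Proof.
rewrite (_ : (fun _ => _) = fun y => - ((invmx (G2 y) *m M y *m invmx (G1 y)) i j)).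
  apply: (smooth_openN oO); apply: (smooth_open_mul oO) => i' j'; last exact: smooth_open_inv.
  by apply: (smooth_open_mul oO) => // k l; exact: smooth_open_inv.
by apply/funext => y; rewrite mxE.
Qed.

Let sS k i j : smooth_open O (S k i j).
Proof.
apply: (smooth_openZ oO); apply: (smooth_open_sum oO) => l; apply: (smooth_openD oO).
  by apply: (smooth_openM oO) => //; exact: smooth_W.
apply: (smooth_openM oO); first exact: smooth_open_inv.
apply: (smooth_openD oO).
  apply: (smooth_openM oO); first exact: smooth_open_coord.
  apply: (smooth_openB oO); last exact: smooth_open_partial.
  by apply: (smooth_openD oO); exact: smooth_open_partial.
apply: (smooth_openZ oO); apply: (smooth_openB oO); last exact: smooth_openZ.
by apply: (smooth_openD oO); exact: smooth_openZ.
Qed.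

Let sctrS u w k : smooth_open O (fun y => ctr S y u w ord0 k).
Proof.
apply: (@smooth_ctr O S (cst u) (cst w)) => //.
- by move=> i; exact: smooth_open_cst.
- by move=> i; exact: smooth_open_cst.
Qed.

Let Delta v w y : rV :=
  (\row_l (y ord0 o0 * ('D_v (fun y => ctr S y w w ord0 l : R^o) y
          - 'D_w (fun y => ctr S y v w ord0 l : R^o) y)))
  + m%:R *: (v ord0 o0 *: ctr S y w w - w ord0 o0 *: ctr S y v w)
  + (ctr S y v (ctr (Hof G1) y w w) + ctr (Hof G1) y v (ctr S y w w)
     + y ord0 o0 ^+ m.+1 *: ctr S y v (ctr S y w w))
  - (ctr S y w (ctr (Hof G1) y v w) + ctr (Hof G1) y w (ctr S y v w)
     + y ord0 o0 ^+ m.+1 *: ctr S y w (ctr S y v w)).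

(** The factor m in [Delta] is (m + 1) - 1: the derivative of t^(m+1) contributes m + 1, and the
    simple pole of the Christoffel symbols contributes -1. Products of two [S] keep a factor
    t^(m+1), which vanishes on the hyperplane. *)
Let QE v w y : O y -> Qof G2 v w y = Qof G1 v w y + y ord0 o0 ^+ m.+1 *: Delta v w y.
Proof.
move=> Oy.
have dc u w' v' l : 'D_v' (fun y => ctr (Hof G2) y u w' ord0 l : R^o) y =
   'D_v' (fun y => ctr (Hof G1) y u w' ord0 l : R^o) y +
   y ord0 o0 ^+ m * (m.+1%:R * v' ord0 o0 * ctr S y u w' ord0 l + y ord0 o0 * 'D_v' (fun y => ctr S y u w' ord0 l : R^o) y).
  have d1 := smooth_open_differentiable (smooth_ctrH oO sG1 uG1 u w' l) Oy.
  have d2 := smooth_open_differentiable (sctrS u w' l) Oy.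
  rewrite -derive_powM// -derive_addf//; last by apply: differentiableM => //; exact: diff_heightX.
  apply: near_eq_derive; near=> z; rewrite ctrE ?mxE//=.
  by near: z; exact: open_nbhs_nbhs.
rewrite /Qof !ctrE// !ctrDr !ctrZr.
apply/rowP => l; rewrite /Delta ![in RHS]mxE ![in LHS]mxE !dc.
rewrite ![ctr _ _ _ _ _ _]mxE.
by rewrite exprS -[m.+1%:R]natr1; ring.
Unshelve. all: by end_near. Qed.

Let B v w y : R :=
  ip (M y) (Qof G1 v w y) v + ip (G2 y) (Delta v w y) v +
  (ip (M y) v v * ip (G2 y) w w + ip (G1 y) v v * ip (M y) w w
   - ip (M y) v w * (ip (G1 y) v w + ip (G2 y) v w)).

Let PE v w y : O y -> Pof G2 v w y = Pof G1 v w y + y ord0 o0 ^+ m.+1 * B v w y.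
Proof.
move=> Oy; rewrite /Pof QE//.
rewrite [ip (G2 y) (_ + _) v]ip_addl ip_scalel.
have gE u' w' : ip (G2 y) u' w' = ip (G1 y) u' w' + y ord0 o0 ^+ m.+1 * ip (M y) u' w'.
  by rewrite ip_mxD ip_mxZ.
by rewrite /B !gE; ring.
Qed.

Let smooth_ip A (u w : rV -> rV) : (forall i j, smooth_open O (fun y => A y i j)) ->
  (forall i, smooth_open O (fun y => u y ord0 i)) ->
  (forall i, smooth_open O (fun y => w y ord0 i)) ->
  smooth_open O (fun y => ip (A y) (u y) (w y)).
Proof.
move=> sA su sw; rewrite (_ : (fun _ => _) =
    fun y => \sum_i \sum_j A y i j * u y ord0 i * w y ord0 j).
  apply: (smooth_open_sum oO) => i; apply: (smooth_open_sum oO) => j.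
  by apply: (smooth_openM oO) => //; apply: (smooth_openM oO).
by apply/funext => y; rewrite ipE.
Qed.

Let smooth_t : smooth_open O (fun y : rV => y ord0 o0).
Proof. exact: smooth_open_coord. Qed.

Let smooth_Q v w l : smooth_open O (fun y => Qof G1 v w y ord0 l).
Proof.
have sc u z k := smooth_ctrH oO sG1 uG1 u z k.
have sH := smooth_H oO sG1 uG1.
have scst u i : smooth_open O (fun y : rV => (cst u y : rV) ord0 i) by exact: smooth_open_cst.
apply: (@smooth_open_eq _ _ O (fun y =>
   y ord0 o0 * ('D_v (fun y => ctr (Hof G1) y w w ord0 l : R^o) y
          - 'D_w (fun y => ctr (Hof G1) y v w ord0 l : R^o) y)
   - v ord0 o0 * ctr (Hof G1) y w w ord0 l + w ord0 o0 * ctr (Hof G1) y v w ord0 l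
   + ctr (Hof G1) y v (ctr (Hof G1) y w w) ord0 l
   - ctr (Hof G1) y w (ctr (Hof G1) y v w) ord0 l)) => //.
  by move=> y Oy; rewrite /Qof !mxE.
apply: (smooth_openB oO); first apply: (smooth_openD oO); first apply: (smooth_openD oO);
  first apply: (smooth_openB oO).
- apply: (smooth_openM oO) => //.
  by apply: (smooth_openB oO); exact: smooth_open_derive.
- exact: smooth_openZ.
- exact: smooth_openZ.
- exact: (@smooth_ctr O (Hof G1) (cst v)).
- exact: (@smooth_ctr O (Hof G1) (cst w)).
Qed.

Let smooth_Delta v w l : smooth_open O (fun y => Delta v w y ord0 l).
Proof.
have sc u z k := smooth_ctrH oO sG1 uG1 u z k.
have sH := smooth_H oO sG1 uG1.
have scst u i : smooth_open O (fun y : rV => (cst u y : rV) ord0 i) by exact: smooth_open_cst.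
apply: (@smooth_open_eq _ _ O (fun y =>
   y ord0 o0 * ('D_v (fun y => ctr S y w w ord0 l : R^o) y
          - 'D_w (fun y => ctr S y v w ord0 l : R^o) y)
   + m%:R * (v ord0 o0 * ctr S y w w ord0 l - w ord0 o0 * ctr S y v w ord0 l)
   + (ctr S y v (ctr (Hof G1) y w w) ord0 l + ctr (Hof G1) y v (ctr S y w w) ord0 l
     + y ord0 o0 ^+ m.+1 * ctr S y v (ctr S y w w) ord0 l)
   - (ctr S y w (ctr (Hof G1) y v w) ord0 l + ctr (Hof G1) y w (ctr S y v w) ord0 l
     + y ord0 o0 ^+ m.+1 * ctr S y w (ctr S y v w) ord0 l))) => //.
  by move=> y Oy; rewrite /Delta !mxE.
apply: (smooth_openB oO); first apply: (smooth_openD oO); first apply: (smooth_openD oO).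
- apply: (smooth_openM oO) => //.
  by apply: (smooth_openB oO); exact: smooth_open_derive.
- by apply: (smooth_openZ oO); apply: (smooth_openB oO); exact: smooth_openZ.
- apply: (smooth_openD oO); first apply: (smooth_openD oO).
  + exact: (@smooth_ctr O S (cst v)).
  + exact: (@smooth_ctr O (Hof G1) (cst v)).
  + apply: (smooth_openM oO); first exact: smooth_openX.
    exact: (@smooth_ctr O S (cst v)).
- apply: (smooth_openD oO); first apply: (smooth_openD oO).
  + exact: (@smooth_ctr O S (cst w)).
  + exact: (@smooth_ctr O (Hof G1) (cst w)).
  + apply: (smooth_openM oO); first exact: smooth_openX.
    exact: (@smooth_ctr O S (cst w)).
Qed.

Let smooth_B v w : smooth_open O (B v w).
Proof.
have scst u i : smooth_open O (fun y : rV => (cst u y : rV) ord0 i) by exact: smooth_open_cst.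
have sip A u z : (forall i j, smooth_open O (fun y => A y i j)) -> smooth_open O (fun y => ip (A y) u z).
  by move=> sA; apply: (@smooth_ip A (cst u) (cst z)).
apply: (smooth_openD oO); first apply: (smooth_openD oO).
- exact: (@smooth_ip M _ (cst v)).
- exact: (@smooth_ip G2 _ (cst v)).
- apply: (smooth_openB oO); first by apply: (smooth_openD oO); apply: (smooth_openM oO); exact: sip.
  apply: (smooth_openM oO); first exact: sip.
  by apply: (smooth_openD oO); exact: sip.
Qed.

Variables (x v w : rV).
Hypotheses (Ox : O x) (x0 : x ord0 o0 = 0).
Hypothesis hyp1 : forall y, pos_part O y -> hyp_eq (sing G1) v w y.
Hypothesis hyp2 : forall y, pos_part O y -> hyp_eq (sing G2) v w y.

Let B_eq0 : B v w x = 0.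
Proof.
have Bpos y : pos_part O y -> B v w y = 0.
  move=> Py; have [Oy /= t0] := Py.
  have := PE v w Oy; rewrite (Pof_eq0 oO sG1 uG1 Py (hyp1 Py)) (Pof_eq0 oO sG2 uG2 Py (hyp2 Py)).
  move/esym/eqP; rewrite add0r mulf_eq0 => /orP[|/eqP//].
  by rewrite expf_eq0 /= (gt_eqF t0).
apply/eqP; apply: contrapT => /negP Bx.
have [y [By Oy ty]] : exists y, [/\ B v w y != 0, O y & 0 < y ord0 o0].
  apply: (pos_dense (P := fun y => B v w y != 0) x0 _ (open_nbhs_nbhs (conj oO Ox))).
  have cB := smooth_open_continuous (smooth_B v w) Ox.
  exact: (cvgr_neq0 _ cB Bx).
by move: By; rewrite Bpos ?eqxx.
Qed.

Let g := G1 x.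
Let gi := invmx g.
Let Mx := M x.
Hypotheses (g_sym : g^T = g) (M_sym : Mx^T = Mx).
Hypotheses (vE : v = e_ o0 *m gi) (v0 : v ord0 o0 = 1) (w0 : w ord0 o0 = 0).

(** At t = 0 the derivatives of [G1] carry a vanishing factor, and only the terms created by the
    pole remain. Here [v] is the gradient of t for the metric [g]. *)
Let HxE u z : ctr (Hof G1) x u z = - (u ord0 o0 *: z + z ord0 o0 *: u - ip g u z *: v).
Proof.
rewrite (@ctr_delta _ (- gi) g); last first.
  move=> k i j; rewrite /Hof mulr_sumr; apply: eq_bigr => l _.
  by rewrite /Wof x0 mul0r sub0r mxE -/g -/gi; field.
have ug := uG1 Ox.
have gT : (- gi)^T = - gi by rewrite linearN /= /gi trmx_inv g_sym.
rewrite gT mulmxN; congr (- _).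
by rewrite mulmxBl mulmxDl -!scalemxAl -!mulmxA mulmxV// !mulmx1 vE.
Qed.

(** The first summand comes from the change [N] of the inverse metric, the second from [Z], whose
    derivatives of [M] again carry the factor t = 0. *)
Let SxE u z : ctr S x u z =
  (u ord0 o0 *: z + z ord0 o0 *: u - ip g u z *: v) *m Mx *m gi +
  ((m%:R - 1) / 2) *: ((u ord0 o0 *: (z *m Mx) + z ord0 o0 *: (u *m Mx)) *m gi - ip Mx u z *: v).
Proof.
have ug := uG1 Ox.
have G2x : G2 x = g by rewrite /G2 x0 expr0n /= scale0r addr0.
pose h1 k i j (y : rV) : R := \sum_l (gi *m Mx *m gi) k l *
  ((i == o0)%:R * g j l + (j == o0)%:R * g i l - (l == o0)%:R * g i j).
pose h2 k i j (y : rV) : R := \sum_l gi k l *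
  ((i == o0)%:R * Mx j l + (j == o0)%:R * Mx i l - (l == o0)%:R * Mx i j).
have -> : ctr S x u z = ctr h1 x u z + ((m%:R - 1) / 2) *: ctr h2 x u z.
  apply: ctr_add => k i j; rewrite /S /h1 /h2 !mulr_sumr -big_split; apply: eq_bigr => l _ /=.
  by rewrite /N G2x -/g -/gi -/Mx /Wof /Z x0 !mul0r sub0r add0r mxE -/g -/Mx; field.
have giT : gi^T = gi by rewrite /gi trmx_inv g_sym.
rewrite (@ctr_delta h1 (gi *m Mx *m gi) g x u z) // (@ctr_delta h2 gi Mx x u z)//.
rewrite !trmx_mul giT M_sym; congr (_ + _ *: _).
  rewrite !mulmxA; congr (_ *m _ *m _).
  by rewrite mulmxBl mulmxDl -!scalemxAl -!mulmxA mulmxV// !mulmx1 vE.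
by rewrite mulmxBl -scalemxAl vE.
Qed.

(** Inserting the boundary values into [B] gives -c ((m + 1) M(w, w) + M(v, v) g(w, w)) with c = (m
    - 1) / 2. In dimension 2 the factor c vanishes and the equation is empty; [m != 1] allows it to
    be cancelled. *)
Lemma core_quadratic : (m != 1)%N -> m.+1%:R * ip Mx w w + ip Mx v v * ip g w w = 0.
Proof.
move=> m1; have ug := uG1 Ox.
have G2x : G2 x = g by rewrite /G2 x0 expr0n /= scale0r addr0.
have gv u : ip g u v = u ord0 o0.
  rewrite /ip vE trmx_mul trmx_inv g_sym mulmxA -(mulmxA u) mulmxV// mulmx1.
  rewrite mxE (bigD1 o0)//= big1 ?addr0; first by rewrite !mxE eqxx mulr1.
  by move=> i /negbTE i0; rewrite !mxE i0 andbF mulr0.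
have vg u : ip g v u = u ord0 o0 by rewrite ip_sym// gv.
have M0 u : (u *m Mx *m gi) ord0 o0 = ip Mx u v.
  have giT : gi^T = gi by rewrite /gi trmx_inv g_sym.
  rewrite /ip vE trmx_mul giT mulmxA [RHS]mxE (bigD1 o0)//= big1 ?addr0; first by rewrite !mxE eqxx mulr1.
  by move=> i /negbTE i0; rewrite !mxE i0 andbF mulr0.
have gM u z : ip g z (u *m Mx *m gi) = ip Mx u z.
  by rewrite ip_sym// /ip -(mulmxA _ gi g) mulVmx// mulmx1.
have Mvw : ip Mx w v = ip Mx v w by rewrite ip_sym.
set a := ip g w w; set q := ip Mx w w; set p := ip Mx v v; set r := ip Mx v w.
set c : R := (m%:R - 1) / 2.
set v' := v *m Mx *m gi; set w' := w *m Mx *m gi.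
have Hww : ctr (Hof G1) x w w = a *: v by rewrite HxE w0 !scale0r addr0 sub0r opprK.
have Hvw : ctr (Hof G1) x v w = - w by rewrite HxE w0 v0 vg w0 !scale0r scale1r addr0 subr0.
have Hvv : ctr (Hof G1) x v v = - v by rewrite HxE v0 vg v0 !scale1r addrK.
have Hwv : ctr (Hof G1) x w v = - w by rewrite HxE w0 v0 gv w0 !scale0r scale1r add0r subr0.
have Sww : ctr S x w w = (- a) *: v' + (- (c * q)) *: v.
  rewrite SxE w0 !scale0r addr0 sub0r mul0mx !sub0r !mulNmx -!scalemxAl -/v' -/a -/q -/c.
  by rewrite scalerN scalerA !scaleNr.
have Svv : ctr S x v v = v' + c *: (v' + v' - p *: v).
  by rewrite SxE v0 vg v0 !scale1r addrK mulmxDl.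
have Svw : ctr S x v w = w' + (c *: w' + (- (c * r)) *: v).
  rewrite SxE v0 w0 vg w0 !scale0r !scale1r addr0 subr0 addr0.
  by rewrite scalerBr scalerA scaleNr.
have Hvv' : ctr (Hof G1) x v v' = - v'.
  by rewrite HxE v0 vg !M0 scale1r addrK.
have Hww' : ctr (Hof G1) x w w' = - (r *: w) + q *: v.
  by rewrite HxE w0 M0 Mvw gM scale0r add0r opprB addrC.
have Q1 : Qof G1 v w x = - (a *: v).
  rewrite /Qof Hww Hvw v0 w0 scale1r scale0r addr0 ctrZr Hvv -[- w]scaleN1r ctrZr Hww.
  have -> : (\row_l (x ord0 o0 * ('D_v (fun y => ctr (Hof G1) y w w ord0 l : R^o) x
          - 'D_w (fun y => ctr (Hof G1) y v w ord0 l : R^o) x))) = 0.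
    by apply/rowP => l; rewrite !mxE x0 mul0r.
  rewrite scalerN scaleN1r; apply/rowP => l; rewrite !mxE; ring.
have DE : Delta v w x = m%:R *: (- (a *: v') - (c * q) *: v) + a *: (v' + c *: (v' + v' - p *: v))
    + r *: w - ((1 + c) * q) *: v.
  rewrite /Delta Hww Hvw v0 w0 scale1r scale0r subr0 ctrZr Svv x0 expr0n /= !scale0r !addr0.
  have -> : (\row_l (0 * ('D_v (fun y => ctr S y w w ord0 l : R^o) x
          - 'D_w (fun y => ctr S y v w ord0 l : R^o) x))) = 0.
    by apply/rowP => l; rewrite !mxE mul0r.
  rewrite add0r -[- w]scaleN1r !ctrZr Svw Sww.
  rewrite !ctrDr !ctrZr Hvv' Hvv Hww' Hwv.
  by apply/rowP => l; rewrite !mxE; ring.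
have := B_eq0; rewrite /B G2x -/g -/Mx Q1 DE.
have gD : ip g (m%:R *: (- (a *: v') - (c * q) *: v) + a *: (v' + c *: (v' + v' - p *: v))
    + r *: w - ((1 + c) * q) *: v) v = m%:R * (- (a * p) - c * q) + a * (p + c * (p + p - p)) - (1 + c) * q.
  by rewrite !(ip_addl, ip_scalel, ip_oppl) !gv v0 w0 !M0 -/p; ring.
rewrite gD ip_oppl ip_scalel -/p -/q -/a -/r !vg v0 w0.
have mE : m%:R = 2 * c + 1 :> R by rewrite /c; field.
rewrite mE => h.
have c0 : c != 0 by rewrite /c mulf_neq0 ?invr_eq0// subr_eq0 (eqr_nat R m 1).
apply: (mulfI c0); rewrite mulr0 -[RHS]oppr0 -h -natr1 mE; ring.
Qed.

End Perturbation.
End Core.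

(** * The trace over tangential directions *)

Section CoreTrace.
Context {R : realType} {m : nat}.
Local Notation rV := 'rV[R]_m.+1.
Local Notation e_ i := (delta_mx ord0 i : rV).
Local Notation o0 := (@ord0 m).

(** Polarisation on pairs of basis vectors. *)
Lemma quad_eq0 n (S : 'M[R]_n.+1) : S^T = S -> (forall u, ip S u u = 0) -> S = 0.
Proof.
move=> sS h.
have Sij i j : S i j = ip S (delta_mx ord0 i) (delta_mx ord0 j).
  by rewrite /ip -rowE trmx_delta -colE !mxE.
apply/matrixP => i j; rewrite mxE Sij.
have := h (delta_mx ord0 i + delta_mx ord0 j).
rewrite ip_addl !ip_addr !h add0r addr0 [X in _ + X]ip_sym// -mulr2n => /eqP.
by rewrite mulrn_eq0 /= => /eqP.
Qed.

Lemma row_free_normal (v w : rV) : v ord0 o0 = 1 -> w ord0 o0 = 0 -> w != 0 ->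
  row_free (col_mx v w).
Proof.
move=> v0 w0 wn0; rewrite -kermx_eq0; apply/rowV0P => u /sub_kermxP.
rewrite -[u]hsubmxK mul_row_col.
set a := lsubmx u; set b := rsubmx u => h.
have sc (c : 'M[R]_1) (z : rV) : c *m z = c ord0 ord0 *: z.
  by rewrite [c in LHS]mx11_scalar mul_scalar_mx.
rewrite !sc in h.
have a0 : a ord0 ord0 = 0.
  by have := congr1 (fun z : rV => z ord0 o0) h; rewrite !mxE v0 w0 mulr0 mulr1 addr0.
have b0 : b ord0 ord0 = 0.
  move/eqP: h; rewrite a0 scale0r add0r scaler_eq0 (negbTE wn0) orbF => /eqP //.
rewrite [a]mx11_scalar [b]mx11_scalar a0 b0.
by rewrite !raddf0 row_mx0.
Qed.

(** By hypothesis B = n M + p g, with p = M(v, v), vanishes on the tangential hyperplane, so its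
    full trace is the normal entry B(v, v). This reads n tr M + n p = n p + p, because g has trace m
    + 1 = n and v is a unit vector. *)
Lemma trace_of_quadratic (g M gi : 'M[R]_m.+1) (n : R) (v := e_ o0 *m gi) :
  gi *m g = 1%:M -> g^T = g -> gi^T = gi -> M^T = M -> gi o0 o0 = 1 ->
  (forall w : rV, w ord0 o0 = 0 -> n * ip M w w + ip M v v * ip g w w = 0) -> n = m.+1%:R ->
  n * \tr (gi *m M) = ip M v v.
Proof.
move=> gig gs gis Ms gi0 h nE.
have v0 : v ord0 o0 = 1 by rewrite /v -rowE mxE.
set p := ip M v v in h *.
pose B := n *: M + p *: g.
(* Acting on row vectors from the right, this is the projection along [v] onto the vectors with zero
   normal coordinate. *)
pose P : 'M[R]_m.+1 := 1%:M - (e_ o0)^T *m v.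
have uP (u : rV) : u *m P = u - u ord0 o0 *: v.
  rewrite mulmxBr mulmx1 mulmxA; congr (_ - _).
  rewrite [u *m _]mx11_scalar mul_scalar_mx; congr (_ *: _).
  by rewrite trmx_delta -colE mxE.
have PB0 : P *m B *m P^T = 0.
  apply: quad_eq0 => [|u].
    by rewrite !trmx_mul trmxK mulmxA /B linearD !linearZ /= gs Ms.
  have -> : ip (P *m B *m P^T) u u = ip B (u *m P) (u *m P).
    by rewrite /ip trmx_mul !mulmxA.
  rewrite /B ip_mxD !ip_mxZ; apply: h.
  have -> : (u *m P) ord0 o0 = u ord0 o0 - u ord0 o0 * v ord0 o0 by rewrite uP !mxE.
  by rewrite v0 mulr1 subrr.
have PgP : P^T *m gi *m P = gi - v^T *m v.
  have gv : gi *m (e_ o0)^T = v^T by rewrite /v trmx_mul gis.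
  have vv : (v *m (e_ o0)^T) = 1%:M.
    by rewrite [LHS]mx11_scalar trmx_delta -colE [in LHS]mxE v0.
  have PT : P^T = 1%:M - v^T *m e_ o0 by rewrite linearB /= trmx1 trmx_mul trmxK.
  rewrite PT mulmxBl mul1mx -mulmxA -/v mulmxBl mulmxBr mulmx1 mulmxA gv.
  by rewrite -mulmxA mulmxBr mulmx1 (mulmxA v) vv mul1mx subrr mulmx0 subr0.
have tB : \tr (gi *m B) = ip B v v.
  have : \tr (P^T *m gi *m P *m B) = 0.
    by rewrite -!mulmxA mxtrace_mulC -!mulmxA (mulmxA P) PB0 mulmx0 mxtrace0.
  rewrite PgP mulmxBl linearB /= => /eqP; rewrite subr_eq0 => /eqP ->.
  by rewrite -mulmxA mxtrace_mulC /ip trace_mx11.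
move: tB; rewrite /B ip_mxD !ip_mxZ mulmxDr -!scalemxAr linearD !linearZ /= gig mxtrace1 -/p.
have -> : ip g v v = 1.
  by rewrite /ip {1}/v -(mulmxA _ gi) gig mulmx1 /v trmx_mul gis mulmxA -rowE trmx_delta -colE !mxE.
rewrite -nE => h2; apply: (addIr (p * n)); rewrite h2; ring.
Qed.

Lemma core_trace (O : set rV) (G1 M : rV -> 'M[R]_m.+1) (x : rV)
  (G2 := fun y => G1 y + y ord0 o0 ^+ m.+1 *: M y) (gi := invmx (G1 x)) :
  open O -> O x -> x ord0 o0 = 0 -> (m != 1)%N ->
  (forall i j, smooth_open O (fun y => G1 y i j)) ->
  (forall i j, smooth_open O (fun y => M y i j)) ->
  (forall y, O y -> G1 y \in unitmx) -> (forall y, O y -> G2 y \in unitmx) ->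
  (forall y v w, pos_part O y -> row_free (col_mx v w) -> hyp_eq (sing G1) v w y) ->
  (forall y v w, pos_part O y -> row_free (col_mx v w) -> hyp_eq (sing G2) v w y) ->
  (G1 x)^T = G1 x -> (M x)^T = M x -> gi o0 o0 = 1 ->
  m.+1%:R * \tr (gi *m M x) = ip (M x) (e_ o0 *m gi) (e_ o0 *m gi).
Proof.
move=> oO Ox x0 m1 sG sM uG uG2 h1 h2 gs Ms gi0.
apply: (trace_of_quadratic (g := G1 x)) => //.
- by rewrite mulVmx// uG.
- by rewrite /gi trmx_inv gs.
(* The zero vector spans no plane with the normal, so it is treated apart. *)
move=> w w0; have [->|wn0] := eqVneq w 0.
  by rewrite /ip !mul0mx !mxE mulr0 mulr0 addr0.
have v0 : (e_ o0 *m gi) ord0 o0 = 1 by rewrite -rowE mxE.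
apply: (core_quadratic oO sG sM uG uG2 Ox x0 _ _ gs Ms) => //.
- by move=> y Py; apply: h1 => //; exact: row_free_normal.
- by move=> y Py; apply: h2 => //; exact: row_free_normal.
Qed.

End CoreTrace.

(** * Naturality of the curvature *)

Section Schwarz.
Context {R : realType} {m : nat}.
Local Notation rV := 'rV[R]_m.+1.
Local Notation e_ i := (delta_mx ord0 i : rV).
Implicit Types (O : set rV) (F : rV -> R) (u v w x y : rV).

Lemma derive_line F x w (c : R) : differentiable (F : rV -> R^o) (x + c *: w) ->
  is_derive c (1 : R) (fun t : R => F (x + t *: w) : R^o) ('D_w (F : rV -> R^o) (x + c *: w)).
Proof.
move=> dF.
have E : (fun h : R => h^-1 *: (((fun t : R => F (x + t *: w) : R^o) \o shift c) (h *: (1 : R)) - F (x + c *: w) : R^o))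
   = (fun h : R => h^-1 *: (((F : rV -> R^o) \o shift (x + c *: w)) (h *: w) - F (x + c *: w) : R^o)).
  apply/funext => h /=; congr (_ *: (F _ - _)).
  by rewrite -[h *: (1 : R)]/(h * 1) mulr1 scalerDl addrCA.
have := @diff_derivable _ _ _ _ _ w dF; rewrite /derivable -E => h.
by apply: DeriveDef; [exact: h|rewrite /derive E].
Qed.

Lemma mvt_line F x w (r : R) : 0 <= r ->
  (forall c, 0 <= c <= r -> differentiable (F : rV -> R^o) (x + c *: w)) ->
  exists2 c, 0 <= c <= r & F (x + r *: w) - F x = r * 'D_w (F : rV -> R^o) (x + c *: w).
Proof.
move=> r0 dF.
have [| |c] := @MVT_segment R (fun t => F (x + t *: w)) (fun c => 'D_w (F : rV -> R^o) (x + c *: w)) 0 r r0.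
- move=> t; rewrite in_itv /= => /andP[t0 tr]; apply: derive_line; apply: dF.
  by rewrite (ltW t0) (ltW tr).
- apply: derivable_within_continuous => t; rewrite in_itv /= => tr.
  by have [] := derive_line (dF t tr).
rewrite in_itv /= => cr h; exists c => //.
by move: h; rewrite scale0r addr0 subr0 mulrC.
Qed.

(** The mean value theorem is applied twice: to the increment y -> F(y + r v) - F(y) in the
    direction [u], and then to D_u F in the direction [v]. *)
Lemma mixed_mean_value O F x u v (r : R) : 0 < r -> open O -> smooth_open O F ->
  (forall a b, 0 <= a <= r -> 0 <= b <= r -> O (x + a *: u + b *: v)) ->
  exists a b, [/\ 0 <= a <= r, 0 <= b <= r &
    F (x + r *: u + r *: v) - F (x + r *: u) - F (x + r *: v) + F x =
    r * (r * 'D_v ('D_u (F : rV -> R^o)) (x + a *: u + b *: v))].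
Proof.
move=> r0 oO sF hO.
have r01 : 0 <= r <= r by rewrite (ltW r0) lexx.
have z01 : 0 <= (0 : R) <= r by rewrite lexx (ltW r0).
have dF y : O y -> differentiable (F : rV -> R^o) y by exact: smooth_open_differentiable sF.
have Orv c : 0 <= c <= r -> O (x + r *: v + c *: u) by move=> cr; rewrite addrAC; exact: hO.
have Or0 c : 0 <= c <= r -> O (x + c *: u) by move=> cr; rewrite -[_ + _]addr0 -(scale0r v); exact: hO.
pose phi (y : rV) := F (r *: v + y) + - F y.
have dsh (y : rV) : O (r *: v + y) -> differentiable ((fun z => F (r *: v + z)) : rV -> R^o) y /\
   'D_u (fun z => F (r *: v + z) : R^o) y = 'D_u (F : rV -> R^o) (r *: v + y).
  move=> Oy; split.
    apply: (@differentiable_comp _ _ _ R^o (fun z => r *: v + z) F).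
      by apply: (@differentiableD _ _ _ (cst (r *: v)) id) => //; exact: differentiable_cst.
    exact: dF.
  rewrite /derive; suff -> : (fun h : R => h^-1 *: (((fun z => F (r *: v + z) : R^o) \o shift y) (h *: u) - F (r *: v + y) : R^o)) = (fun h : R => h^-1 *: (((F:rV -> R^o) \o shift (r *: v + y)) (h *: u) - F (r *: v + y) : R^o)) by [].
  by apply/funext => h /=; congr (_ *: (F _ - _)); rewrite addrCA.
have dphi c : 0 <= c <= r -> differentiable (phi : rV -> R^o) (x + c *: u) /\
   'D_u (phi : rV -> R^o) (x + c *: u) =
   'D_u (F : rV -> R^o) (x + c *: u + r *: v) - 'D_u (F : rV -> R^o) (x + c *: u).
  move=> cr; have [|d1 d2] := dsh (x + c *: u).
    by rewrite addrC; exact: hO.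
  have d3 := dF _ (Or0 c cr); split.
    by apply: (@differentiableB _ _ _ (fun z => F (r *: v + z) : R^o) (F : rV -> R^o)).
  rewrite [LHS](@deriveB _ _ _ (fun z => F (r *: v + z) : R^o) (F : rV -> R^o));
    by [rewrite d2 addrC [r *: v + _]addrC [LHS]addrC|exact: diff_derivable].
have [a ar ha] := mvt_line (ltW r0) (fun c cr => (dphi c cr).1).
have sDF := smooth_open_derive oO u sF.
have [|b br hb] := @mvt_line ('D_u (F : rV -> R^o)) (x + a *: u) v r (ltW r0).
  by move=> c cr; apply: smooth_open_differentiable sDF _; exact: hO.
exists a, b; split => //.
rewrite -hb -(dphi a ar).2 -ha /phi [r *: v + _]addrC [r *: v + x]addrC.
by rewrite opprB addrA addrAC.
Qed.

Lemma common_modulus O (A B : rV -> R) x e : open O -> O x -> 0 < e ->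
  {for x, continuous A} -> {for x, continuous B} ->
  exists2 d : R, 0 < d & forall y, `|x - y| < d ->
    [/\ O y, `|A x - A y| < e & `|B x - B y| < e].
Proof.
move=> oO Ox e0 cA cB.
have nO : \forall y \near x, O y by exact: open_nbhs_nbhs.
have nA : \forall y \near x, `|A x - A y| < e by move/cvgrPdist_lt : cA; exact.
have nB : \forall y \near x, `|B x - B y| < e by move/cvgrPdist_lt : cB; exact.
have : \forall y \near x, [/\ O y, `|A x - A y| < e & `|B x - B y| < e].
  by apply: filterS3 nO nA nB.
move/nbhs_ballP => [d /= d0 hd]; exists d => // y xy.
by apply: hd; rewrite -ball_normE.
Qed.

(* [D r] is a second difference of a function along [r *: u] and [r *: v], and [A]
   and [B] are the two mixed derivatives of this function. *)
Lemma iterated_limits_eq O (D : R -> R) (A B : rV -> R) x u v : open O -> O x ->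
  (forall r, 0 < r ->
    (forall a b, 0 <= a <= r -> 0 <= b <= r -> O (x + a *: u + b *: v)) ->
    exists a b, [/\ 0 <= a <= r, 0 <= b <= r & D r = r * (r * B (x + a *: u + b *: v))]) ->
  (forall r, 0 < r ->
    (forall a b, 0 <= a <= r -> 0 <= b <= r -> O (x + a *: v + b *: u)) ->
    exists a b, [/\ 0 <= a <= r, 0 <= b <= r & D r = r * (r * A (x + a *: v + b *: u))]) ->
  {for x, continuous A} -> {for x, continuous B} -> A x = B x.
Proof.
move=> oO Ox h1 h2 cA cB.
apply/eqP; rewrite -subr_eq0 -normr_le0; apply/ler_addgt0Pr => e e0; rewrite add0r.
have e20 : 0 < e / 2 by rewrite divr_gt0.
have [d d0 hd] := common_modulus oO Ox e20 cA cB.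
(* The summand 1 keeps [K] positive when [u] and [v] vanish, and makes the bound r (|u| + |v|) < d
   strict. *)
set K := `|u| + `|v| + 1.
have K0 : 0 < K by rewrite /K ltr_wpDl// addr_ge0.
set r := d / K.
have r0 : 0 < r by rewrite divr_gt0.
have inball a b : 0 <= a <= r -> 0 <= b <= r -> `|x - (x + a *: u + b *: v)| < d.
  move=> /andP[a0 ar] /andP[b0 br].
  rewrite -addrA opprD addrA subrr sub0r normrN (le_lt_trans (ler_normD _ _))//.
  rewrite !normrZ (ger0_norm a0) (ger0_norm b0).
  have -> : d = r * K by rewrite /r divfK// gt_eqF.
  have le1 : a * `|u| <= r * `|u| by rewrite ler_wpM2r.
  have le2 : b * `|v| <= r * `|v| by rewrite ler_wpM2r.
  rewrite /K !mulrDr mulr1; lra.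
have rr0 : 0 <= r by exact: ltW.
have Oin a b : 0 <= a <= r -> 0 <= b <= r -> O (x + a *: u + b *: v).
  by move=> ar br; have [] := hd _ (inball a b ar br).
have [a [b [ar br {}h1]]] := h1 r r0 Oin.
have [|a' [b' [ar' br' {}h2]]] := h2 r r0.
  by move=> a' b' ar' br'; rewrite addrAC; exact: Oin.
have [_ _ hB] := hd _ (inball a b ar br).
have := inball b' a' br' ar'; rewrite addrAC => /hd[_ hA _].
have rn : r != 0 by rewrite gt_eqF.
have E : A (x + a' *: v + b' *: u) = B (x + a *: u + b *: v).
  apply: (mulfI rn); apply: (mulfI rn); rewrite -h2 -h1.
  by [].
rewrite (_ : A x - B x = (A x - A (x + a' *: v + b' *: u)) - (B x - B (x + a *: u + b *: v))).
  by rewrite (le_trans (ler_normB _ _))// (splitr e) lerD// ltW.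
by rewrite E; ring.
Qed.

Lemma schwarz O F x u v : open O -> smooth_open O F -> O x ->
  'D_u ('D_v (F : rV -> R^o)) x = 'D_v ('D_u (F : rV -> R^o)) x.
Proof.
move=> oO sF Ox.
have cA := smooth_open_continuous (smooth_open_derive oO u (smooth_open_derive oO v sF)) Ox.
have cB := smooth_open_continuous (smooth_open_derive oO v (smooth_open_derive oO u sF)) Ox.
pose D r := F (x + r *: u + r *: v) - F (x + r *: u) - F (x + r *: v) + F x.
apply: (@iterated_limits_eq O D _ _ x u v oO Ox _ _ cA cB) => r r0 hO.
  exact: mixed_mean_value r0 oO sF hO.
have [a [b [ar br h]]] := mixed_mean_value r0 oO sF hO.
exists a, b; split=> //; rewrite -h /D (addrAC x (r *: v)).
by congr (_ + F x); rewrite [LHS]addrAC.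
Qed.

End Schwarz.

(** * Curvature under local isometries *)

Section CurvatureNaturality.
Context {R : realType} {m : nat}.
Local Notation rV := 'rV[R]_m.+1.
Local Notation e_ i := (delta_mx ord0 i : rV).
Local Notation coefs := ('I_m.+1 -> 'I_m.+1 -> 'I_m.+1 -> rV -> R).
Implicit Types (O : set rV) (F : rV -> R) (u v w x y z : rV) (f g : rV -> rV)
  (A : rV -> 'M[R]_m.+1) (h : coefs).

Definition Dr u f x : rV := \row_l 'D_u (fun y => f y ord0 l : R^o) x.
Definition Dmx u A x : 'M[R]_m.+1 := \matrix_(i, j) 'D_u (fun y => A y i j : R^o) x.
Definition Dcoef u h : coefs := fun k i j x => 'D_u (h k i j : rV -> R^o) x.

Definition diff_row f x := forall i, differentiable (fun y => f y ord0 i : R^o) x.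
Definition diff_mx A x := forall i j, differentiable (fun y => A y i j : R^o) x.

Lemma derive_ext F (G : rV -> R) v x : (forall y, F y = G y) ->
  'D_v (F : rV -> R^o) x = 'D_v (G : rV -> R^o) x.
Proof. by move=> FG; have -> : F = G by apply/funext. Qed.

Lemma derive_bigsum (n : nat) (F : 'I_n -> rV -> R) v x :
  (forall i, differentiable (F i : rV -> R^o) x) ->
  'D_v (fun y => \sum_i F i y : R^o) x = \sum_i 'D_v (F i : rV -> R^o) x.
Proof.
move=> dF; rewrite -[RHS](@derive_sum R rV R^o n (fun i => F i : rV -> R^o)); last first.
  by move=> i; exact: diff_derivable.
by apply: derive_ext => y; rewrite fct_sumE.
Qed.

Lemma diff_bigsum (n : nat) (F : 'I_n -> rV -> R) x :
  (forall i, differentiable (F i : rV -> R^o) x) ->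
  differentiable (fun y => \sum_i F i y : R^o) x.
Proof.
move=> dF; have := @differentiable_sum R rV R^o n (fun i => F i : rV -> R^o) x dF.
apply: differentiable_near_eq; near=> y; by rewrite fct_sumE.
Unshelve. all: by end_near. Qed.

Lemma derive_mulf3 (F G H : rV -> R) v x : differentiable (F : rV -> R^o) x ->
  differentiable (G : rV -> R^o) x -> differentiable (H : rV -> R^o) x ->
  differentiable (fun y => F y * G y * H y : R^o) x /\
  'D_v (fun y => F y * G y * H y : R^o) x =
  'D_v (F : rV -> R^o) x * G x * H x + F x * 'D_v (G : rV -> R^o) x * H x +
  F x * G x * 'D_v (H : rV -> R^o) x.
Proof.
move=> dF dG dH; have dFG : differentiable (fun y => F y * G y : R^o) x by exact: differentiableM.
split; first exact: (@differentiableM _ _ (fun y => F y * G y) H).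
by rewrite (@derive_mulf _ _ (fun y => F y * G y) H)// derive_mulf//; ring.
Qed.

Lemma derive_ip A f g u x : diff_mx A x -> diff_row f x -> diff_row g x ->
  'D_u (fun y => ip (A y) (f y) (g y) : R^o) x =
  ip (Dmx u A x) (f x) (g x) + ip (A x) (Dr u f x) (g x) + ip (A x) (f x) (Dr u g x).
Proof.
move=> dA df dg.
have d3 i j v := derive_mulf3 v (dA i j) (df i) (dg j).
transitivity ('D_u (fun y => \sum_i \sum_j A y i j * f y ord0 i * g y ord0 j : R^o) x).
  by apply: derive_ext => y; rewrite ipE.
rewrite derive_bigsum; last by move=> i; apply: diff_bigsum => j; have [] := d3 i j 0.
rewrite !ipE -!big_split; apply: eq_bigr => i _ /=.
rewrite derive_bigsum; last by move=> j; have [] := d3 i j 0.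
rewrite -!big_split; apply: eq_bigr => j _ /=.
by have [_ ->] := d3 i j u; rewrite !mxE.
Qed.

Lemma Dr_ctr h f g u x : (forall k i j, differentiable (h k i j : rV -> R^o) x) ->
  diff_row f x -> diff_row g x ->
  Dr u (fun y => ctr h y (f y) (g y)) x =
  ctr (Dcoef u h) x (f x) (g x) + ctr h x (Dr u f x) (g x) + ctr h x (f x) (Dr u g x).
Proof.
move=> dh df dg; apply/rowP => k.
have d3 i j v := derive_mulf3 v (dh k i j) (df i) (dg j).
rewrite mxE; transitivity ('D_u (fun y => \sum_i \sum_j h k i j y * f y ord0 i * g y ord0 j : R^o) x).
  by apply: derive_ext => y; rewrite mxE.
rewrite derive_bigsum; last by move=> i; apply: diff_bigsum => j; have [] := d3 i j 0.
rewrite !mxE -!big_split; apply: eq_bigr => i _ /=.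
rewrite derive_bigsum; last by move=> j; have [] := d3 i j 0.
rewrite -!big_split; apply: eq_bigr => j _ /=.
by have [_ ->] := d3 i j u; rewrite !mxE.
Qed.

Lemma ip_0l (C : 'M[R]_m.+1) u : ip C 0 u = 0.
Proof. by rewrite /ip !mul0mx mxE. Qed.
Lemma ip_0r (C : 'M[R]_m.+1) u : ip C u 0 = 0.
Proof. by rewrite /ip trmx0 mulmx0 mxE. Qed.

Lemma ip_inj (C : 'M[R]_m.+1) u v : C \in unitmx ->
  (forall w, ip C u w = ip C v w) -> u = v.
Proof.
move=> uC h; have E : u *m C = v *m C.
  apply/rowP => i; have := h (e_ i); rewrite /ip trmx_delta -!colE.
  by rewrite [X in X = _ -> _]mxE [X in _ = X -> _]mxE.
by rewrite -[u](mulmxK uC) E mulmxK.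
Qed.

Lemma Dr_cst u v x : Dr u (cst v) x = 0.
Proof. by apply/rowP => l; rewrite !mxE; exact: derive_cst. Qed.

Lemma diff_row_cst v x : diff_row (cst v) x.
Proof. by move=> i; exact: differentiable_cst. Qed.

Lemma curv_vecE h v w x : curv_vec h v w x =
  Dr v (fun y => ctr h y w w) x - Dr w (fun y => ctr h y v w) x
  + ctr h x v (ctr h x w w) - ctr h x w (ctr h x v w).
Proof. by congr (_ + _ - _); apply/rowP => l; rewrite !mxE. Qed.

Lemma koszul A u v z x : diff_mx A x -> A x \in unitmx -> (A x)^T = A x ->
  ip (A x) (ctr (chr A) x u v) z =
  2^-1 * (ip (Dmx u A x) v z + ip (Dmx v A x) u z - ip (Dmx z A x) u v).
Proof.
move=> dA uA sA.
(* Twice the covector metrically dual to the contracted Christoffel symbols; [cE] raises its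
   index. *)
pose W : rV := \row_l (ip (Dmx u A x) v (e_ l) + ip (Dmx v A x) u (e_ l) - ip (Dmx (e_ l) A x) u v).
have DmxE w : Dmx w A x = \sum_i w ord0 i *: Dmx (e_ i) A x.
  apply/matrixP => i j; rewrite mxE derive_sum_partial// summxE.
  by apply: eq_bigr => k _; rewrite !mxE.
have ip_sum n (B : 'I_n -> 'M[R]_m.+1) a b : ip (\sum_i B i) a b = \sum_i ip (B i) a b.
  by rewrite /ip mulmx_sumr mulmx_suml summxE.
have ip_e (B : 'M[R]_m.+1) a l : ip B a (e_ l) = \sum_i B i l * a ord0 i.
  rewrite ipE; apply: eq_bigr => i _; rewrite (bigD1 l)//= !mxE !eqxx mulr1 big1 ?addr0// => j jl.
  by rewrite mxE (negbTE jl) andbF mulr0.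
have cE : ctr (chr A) x u v = 2^-1 *: (W *m invmx (A x)).
  have iT k l : invmx (A x) k l = invmx (A x) l k by rewrite -[in LHS]sA -trmx_inv mxE.
  apply/rowP => k; rewrite !mxE mulr_sumr.
  transitivity (\sum_l \sum_i \sum_j 2^-1 * (invmx (A x) k l *
    ('D_(e_ i) (fun y => A y j l : R^o) x + 'D_(e_ j) (fun y => A y i l : R^o) x
     - 'D_(e_ l) (fun y => A y i j : R^o) x) * u ord0 i * v ord0 j)).
    rewrite [RHS]exchange_big; apply: eq_bigr => i _; rewrite [RHS]exchange_big; apply: eq_bigr => j _ /=.
    by rewrite /chr -!mulrA mulr_suml mulr_sumr; apply: eq_bigr => l _; rewrite !mulrA.
  apply: eq_bigr => l _; rewrite mxE iT.
  transitivity (2^-1 * (invmx (A x) l k * \sum_i \sum_j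
     ('D_(e_ i) (fun y => A y j l : R^o) x * u ord0 i * v ord0 j + 'D_(e_ j) (fun y => A y i l : R^o) x * u ord0 i * v ord0 j
     - 'D_(e_ l) (fun y => A y i j : R^o) x * u ord0 i * v ord0 j))).
    rewrite !mulr_sumr; apply: eq_bigr => i _; rewrite !mulr_sumr; apply: eq_bigr => j _; ring.
  rewrite [_ * invmx _ _ _]mulrC; congr (_ * (_ * _)).
  under eq_bigr do rewrite sumrB big_split /=.
  rewrite sumrB big_split /=; congr (_ + _ - _).
  - rewrite exchange_big ip_e; apply: eq_bigr => j _ /=.
    by rewrite mxE derive_sum_partial// mulr_suml; apply: eq_bigr => i _; rewrite [_ * u _ _]mulrC.
  - rewrite ip_e; apply: eq_bigr => i _ /=.
    rewrite mxE derive_sum_partial// mulr_suml; apply: eq_bigr => j _; ring.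
  - by rewrite ipE; apply: eq_bigr => i _; apply: eq_bigr => j _; rewrite mxE.
rewrite cE ip_scalel; congr (_ * _).
have -> : ip (A x) (W *m invmx (A x)) z = (W *m z^T) ord0 ord0.
  by rewrite /ip -(mulmxA W) mulVmx// mulmx1.
rewrite mxE.
rewrite (DmxE z) ip_sum.
have ipz (B : 'M[R]_m.+1) a : ip B a z = \sum_l z ord0 l * ip B a (e_ l).
  rewrite {1}(row_sum_delta z) /ip linear_sum mulmx_sumr summxE.
  by apply: eq_bigr => l _; rewrite linearZ /= -scalemxAr mxE.
rewrite !ipz -big_split -sumrB; apply: eq_bigr => l _ /=.
have -> : W ord0 l = ip (Dmx u A x) v (e_ l) + ip (Dmx v A x) u (e_ l) - ip (Dmx (e_ l) A x) u v.
  by rewrite mxE.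
have -> : z^T l ord0 = z ord0 l by rewrite mxE.
by rewrite ip_mxZ mulrBl mulrDl ![_ * z ord0 l]mulrC.
Qed.

Section Naturality.
Variables (O O' : set rV) (oO : open O) (oO' : open O').
Variables (phi : rV -> rV) (A B : rV -> 'M[R]_m.+1).
Hypothesis phiO : forall y, O y -> O' (phi y).
Hypothesis sphi : forall i, smooth_open O (fun y => phi y ord0 i).
Hypothesis sA : forall i j, smooth_open O (fun y => A y i j).
Hypothesis sB : forall i j, smooth_open O' (fun y => B y i j).
Hypothesis uA : forall y, O y -> A y \in unitmx.
Hypothesis uB : forall y, O' y -> B y \in unitmx.
Hypothesis symA : forall y, O y -> (A y)^T = A y.
Hypothesis symB : forall y, O' y -> (B y)^T = B y.
Hypothesis isom : forall y u v, O y ->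
  ip (A y) u v = ip (B (phi y)) (Dr u phi y) (Dr v phi y).
Hypothesis surj : forall y w, O y -> exists z, Dr z phi y = w.

Lemma diff_rowP f y : (forall i, smooth_open O (fun y => f y ord0 i)) -> O y -> diff_row f y.
Proof. by move=> sf Oy i; exact: smooth_open_differentiable (sf i) Oy. Qed.

Lemma smooth_Dr f u i : (forall i, smooth_open O (fun y => f y ord0 i)) ->
  smooth_open O (fun y => Dr u f y ord0 i).
Proof.
move=> sf; rewrite (_ : (fun _ => _) = 'D_u (fun y => f y ord0 i : R^o)).
  exact: smooth_open_derive.
by apply/funext => y; rewrite mxE.
Qed.

Lemma derive_comp_phi F u y : smooth_open O' F -> O y ->
  'D_u (fun z => F (phi z) : R^o) y = 'D_(Dr u phi y) (F : rV -> R^o) (phi y).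
Proof.
move=> sF Oy; have dF := smooth_open_differentiable sF (phiO Oy).
have [_ ->] := derive_comp_rV u (diff_rowP sphi Oy) dF.
by rewrite derive_sum_partial//; apply: eq_bigr => j _; rewrite mxE.
Qed.

Lemma diff_comp_phi F y : smooth_open O' F -> O y ->
  differentiable (fun z => F (phi z) : R^o) y.
Proof.
move=> sF Oy; have dF := smooth_open_differentiable sF (phiO Oy).
by have [] := derive_comp_rV 0 (diff_rowP sphi Oy) dF.
Qed.

Lemma Dr_swap f u v y : (forall i, smooth_open O (fun y => f y ord0 i)) -> O y ->
  Dr u (Dr v f) y = Dr v (Dr u f) y.
Proof.
move=> sf Oy.
have E w w' i : Dr w (Dr w' f) y ord0 i = 'D_w ('D_w' (fun y => f y ord0 i : R^o)) y.
  by rewrite mxE; apply: derive_ext => z; rewrite mxE.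
apply/rowP => i.
apply: (etrans (E u v i)); apply: (etrans _ (esym (E v u i))).
exact: (schwarz u v oO (sf i) Oy).
Qed.

Lemma DrD f u v y : diff_row f y -> Dr (u + v) f y = Dr u f y + Dr v f y.
Proof.
move=> df; apply/rowP => i; rewrite !mxE !deriveE// linearD //.
Qed.

Lemma smooth_chr (U : set rV) (C : rV -> 'M[R]_m.+1) k i j : open U ->
  (forall i j, smooth_open U (fun y => C y i j)) ->
  (forall y, U y -> C y \in unitmx) -> smooth_open U (chr C k i j).
Proof.
move=> oU sC uC; apply: (smooth_openZ oU); apply: (smooth_open_sum oU) => l.
apply: (smooth_openM oU); first exact: smooth_open_inv.
apply: (smooth_openB oU); last exact: smooth_open_partial.
by apply: (smooth_openD oU); exact: smooth_open_partial.
Qed.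

Let derive_isom u v z y : O y ->
  ip (Dmx u A y) v z = ip (Dmx (Dr u phi y) B (phi y)) (Dr v phi y) (Dr z phi y)
   + ip (B (phi y)) (Dr u (Dr v phi) y) (Dr z phi y)
   + ip (B (phi y)) (Dr v phi y) (Dr u (Dr z phi) y).
Proof.
move=> Oy.
have dA : diff_mx A y by move=> i j; exact: smooth_open_differentiable (sA i j) Oy.
have := derive_ip u dA (diff_row_cst v y) (diff_row_cst z y).
rewrite !Dr_cst !ip_0l !ip_0r !addr0 => <-.
transitivity ('D_u (fun y => ip ((B \o phi) y) (Dr v phi y) (Dr z phi y) : R^o) y).
  apply: near_eq_derive; near=> w; rewrite -isom//.
  by near: w; exact: open_nbhs_nbhs.
have dBp : diff_mx (B \o phi) y by move=> i j; exact: (diff_comp_phi (sB i j) Oy).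
have dr w : diff_row (Dr w phi) y.
  by apply: diff_rowP Oy => i; exact: smooth_Dr.
apply: (etrans (derive_ip u dBp (dr v) (dr z))).
suff -> : Dmx u (B \o phi) y = Dmx (Dr u phi y) B (phi y) by [].
apply/matrixP => i j; rewrite [LHS]mxE [RHS]mxE.
exact: (derive_comp_phi u (sB i j) Oy).
Unshelve. all: by end_near. Qed.

(** Transformation law of the Christoffel symbols. Both sides are tested against pushed-forward
    vectors, which exhaust the space by [surj]. The Koszul formula and the differentiated isometry
    condition then leave a cancellation among second derivatives of [phi], symmetric by Schwarz. *)
Lemma push_chr u v y : O y -> Dr (ctr (chr A) y u v) phi y =
  Dr u (Dr v phi) y + ctr (chr B) (phi y) (Dr u phi y) (Dr v phi y).
Proof.
move=> Oy.
have Oy' := phiO Oy.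
have dA : diff_mx A y by move=> i j; exact: smooth_open_differentiable (sA i j) Oy.
have dB : diff_mx B (phi y) by move=> i j; exact: smooth_open_differentiable (sB i j) Oy'.
suff h w : ip (B (phi y)) (Dr (ctr (chr A) y u v) phi y) w =
  ip (B (phi y)) (Dr u (Dr v phi) y + ctr (chr B) (phi y) (Dr u phi y) (Dr v phi y)) w.
  exact: ip_inj (uB Oy') h.
have [z <-] := surj w Oy.
rewrite -isom// koszul ?uA ?symA// !derive_isom// ip_addl koszul ?uB ?symB//.
rewrite (Dr_swap v u sphi Oy) (Dr_swap z u sphi Oy) (Dr_swap z v sphi Oy).
rewrite [ip (B (phi y)) (Dr v phi y) (Dr u (Dr z phi) y)]ip_sym ?symB//.
have alg (a1 a2 a3 a4 a5 a6 : R) :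
  2^-1 * (a1 + a2 + a3 + (a4 + a2 + a5) - (a6 + a3 + a5)) = a2 + 2^-1 * (a1 + a4 - a6).
  by field.
exact: alg.
Qed.

Let push_const z y : O y -> Dr z phi y = \row_i \sum_j z ord0 j * 'D_(e_ j) (fun y => phi y ord0 i : R^o) y.
Proof.
move=> Oy; apply/rowP => i; rewrite [LHS]mxE [RHS]mxE.
exact: derive_sum_partial (smooth_open_differentiable (sphi i) Oy).
Qed.

Lemma Dr_push u f y : O y -> diff_row f y ->
  Dr u (fun x => Dr (f x) phi x) y = Dr u (Dr (f y) phi) y + Dr (Dr u f y) phi y.
Proof.
move=> Oy df.
have dP i j : differentiable ('D_(e_ j) (fun y => phi y ord0 i : R^o)) y.
  exact: smooth_open_differentiable (smooth_open_partial j (sphi i)) Oy.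
have E (g : rV -> rV) i : diff_row g y -> Dr u (fun x => Dr (g x) phi x) y ord0 i =
    \sum_j (g y ord0 j * 'D_u ('D_(e_ j) (fun y => phi y ord0 i : R^o)) y
     + 'D_(e_ j) (fun y => phi y ord0 i : R^o) y * Dr u g y ord0 j).
  move=> dg; rewrite mxE.
  transitivity ('D_u (fun x => \sum_j g x ord0 j * 'D_(e_ j) (fun y => phi y ord0 i : R^o) x : R^o) y).
    apply: near_eq_derive; near=> x; rewrite push_const; first by rewrite mxE.
    by near: x; exact: open_nbhs_nbhs.
  rewrite derive_bigsum; last by move=> j; apply: differentiableM; [exact: dg|exact: dP].
  apply: eq_bigr => j _; rewrite (derive_mulf u (dg j) (dP i j)); congr (_ + _ * _).
  by rewrite mxE.
apply/rowP => i; apply: (etrans (E f i df)).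
have := E (cst (f y)) i (@diff_row_cst (f y) y); rewrite Dr_cst => h.
rewrite [RHS]mxE h (push_const _ Oy) [X in _ = _ + X]mxE -big_split; apply: eq_bigr => j _ /=.
by rewrite [(0 : rV) ord0 j]mxE mulr0 addr0; congr (_ + _); rewrite mulrC.
Unshelve. all: by end_near. Qed.

(** Differentiating [push_chr] once more produces third derivatives of [phi] and mixed terms. By
    symmetry of second derivatives they occur equally in [main v w w] and [main w v w], and drop out
    of the difference that forms the curvature. *)
Lemma push_curv v w y : O y ->
  Dr (curv_vec (chr A) v w y) phi y = curv_vec (chr B) (Dr v phi y) (Dr w phi y) (phi y).
Proof.
move=> Oy; have Oy' := phiO Oy.
have schA k i j := @smooth_chr O A k i j oO sA uA.
have schB k i j := @smooth_chr O' B k i j oO' sB uB.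
have dchA k i j : differentiable (chr A k i j : rV -> R^o) y.
  exact: smooth_open_differentiable (schA k i j) Oy.
have dchB k i j : differentiable (chr B k i j : rV -> R^o) (phi y).
  exact: smooth_open_differentiable (schB k i j) Oy'.
have dphi : diff_row phi y := diff_rowP sphi Oy.
have sDr z i : smooth_open O (fun y => Dr z phi y ord0 i) by exact: smooth_Dr.
have dDr z : diff_row (Dr z phi) y by apply: diff_rowP Oy => i; exact: sDr.
have dDDr z z' : diff_row (Dr z (Dr z' phi)) y.
  by apply: diff_rowP Oy => i; apply: smooth_Dr => j; exact: sDr.
have dctr z z' : diff_row (fun x => ctr (chr A) x z z') y.
  apply: diff_rowP Oy => i; apply: (@smooth_ctr _ _ O (chr A) (cst z) (cst z')) => //.
  - by move=> j; exact: smooth_open_cst.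
  - by move=> j; exact: smooth_open_cst.
pose CB := (fun k i j x => chr B k i j (phi x)).
have dCB k i j : differentiable (CB k i j : rV -> R^o) y.
  exact: diff_comp_phi (schB k i j) Oy.
have main u a b : Dr (Dr u (fun x => ctr (chr A) x a b) y) phi y
    + Dr (ctr (chr A) y u (ctr (chr A) y a b)) phi y =
  Dr u (Dr a (Dr b phi)) y
  + ctr (Dcoef (Dr u phi y) (chr B)) (phi y) (Dr a phi y) (Dr b phi y)
  + ctr (chr B) (phi y) (Dr u (Dr a phi) y) (Dr b phi y)
  + ctr (chr B) (phi y) (Dr a phi y) (Dr u (Dr b phi) y)
  + ctr (chr B) (phi y) (Dr u phi y) (Dr a (Dr b phi) y)
  + ctr (chr B) (phi y) (Dr u phi y) (ctr (chr B) (phi y) (Dr a phi y) (Dr b phi y)).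
  have h1 := Dr_push u Oy (dctr a b).
  have h2 : Dr u (fun x => Dr (ctr (chr A) x a b) phi x) y =
    Dr u (Dr a (Dr b phi)) y + Dr u (fun x => ctr CB x (Dr a phi x) (Dr b phi x)) y.
    apply/rowP => i.
    have eDr (f : rV -> rV) : Dr u f y ord0 i = 'D_u (fun x => f x ord0 i : R^o) y by rewrite mxE.
    apply: (etrans (eDr _)); rewrite [RHS]mxE !eDr.
    rewrite -derive_addf; last 2 first.
    - exact: dDDr.
    - have sc : smooth_open O (fun x => ctr CB x (Dr a phi x) (Dr b phi x) ord0 i).
        apply: (@smooth_ctr _ _ O CB) => // k i' j'.
        by apply: (@smooth_open_comp _ _ O oO O' (chr B k i' j') phi).
      exact: smooth_open_differentiable sc Oy.
    apply: near_eq_derive; near=> x; rewrite push_chr; first by rewrite [LHS]mxE.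
    by near: x; exact: open_nbhs_nbhs.
  have h3 := Dr_ctr u dCB (dDr a) (dDr b).
  have h4 : ctr (Dcoef u CB) y (Dr a phi y) (Dr b phi y) =
     ctr (Dcoef (Dr u phi y) (chr B)) (phi y) (Dr a phi y) (Dr b phi y).
    have e k i j : Dcoef u CB k i j y = Dcoef (Dr u phi y) (chr B) k i j (phi y).
      exact: (derive_comp_phi u (schB k i j) Oy).
    apply/rowP => k; rewrite [LHS]mxE [RHS]mxE; apply: eq_bigr => i _; apply: eq_bigr => j _.
    by rewrite e.
  have h5 := push_chr u (ctr (chr A) y a b) Oy.
  have h6 := push_chr a b Oy.
  have h3' := etrans h3 (congr1 (fun z => z + _ + _) h4).
  have h6' := etrans (congr1 (ctr (chr B) (phi y) (Dr u phi y)) h6) (ctrDr _ _ _ _ _).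
  have alg (L1 L2 Z S X W K C1 C2 C3 K5 K6 : rV) : Z = S + L1 -> L2 = S + K -> Z = X + W ->
     W = C1 + C2 + C3 -> K = K5 + K6 -> L1 + L2 = X + C1 + C2 + C3 + K5 + K6.
    move=> e1 -> e2 e3 ->; have -> : L1 = X + W - S by rewrite -e2 e1 addrC addKr.
    by rewrite e3 addrA subrK !addrA.
  exact: alg h1 h5 h2 h3' h6'.
have Dsub a b : Dr (a - b) phi y = Dr a phi y - Dr b phi y.
  rewrite DrD//; congr (_ + _); apply/rowP => i; rewrite [LHS]mxE [RHS]mxE [in RHS]mxE.
  by rewrite !deriveE ?linearN.
have Dcst u a b : Dr u (fun x => ctr (chr B) x a b) (phi y) = ctr (Dcoef u (chr B)) (phi y) a b.
  apply: (etrans (Dr_ctr u dchB (@diff_row_cst a _) (@diff_row_cst b _))).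
  rewrite !Dr_cst -(scale0r (0 : rV)) ctrZl ctrZr !scale0r !addr0 //.
have swap1 : Dr w (Dr v (Dr w phi)) y = Dr v (Dr w (Dr w phi)) y.
  by apply: Dr_swap => // i; exact: sDr.
have swap2 : Dr w (Dr v phi) y = Dr v (Dr w phi) y by exact: Dr_swap.
have e1 := main v w w.
have e2 := main w v w; rewrite swap1 swap2 in e2.
have alg (P1 P2 Q1 Q2 X c1 c2 a b c d1 d2 : rV) :
    P1 + Q1 = X + c1 + a + b + c + d1 -> P2 + Q2 = X + c2 + a + c + b + d2 ->
    P1 - P2 + Q1 - Q2 = c1 - c2 + d1 - d2.
  move=> h1 h2; have -> : P1 - P2 + Q1 - Q2 = (P1 + Q1) - (P2 + Q2).
    by rewrite opprD addrACA addrA.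
  rewrite h1 h2; apply/rowP => i; rewrite !mxE; ring.
rewrite curv_vecE; apply: (etrans (Dsub _ _)).
apply: (etrans (congr1 (fun z => z - _) (etrans (DrD _ _ dphi) (congr1 (fun z => z + _) (Dsub _ _))))).
rewrite curv_vecE (Dcst (Dr v phi y)) (Dcst (Dr w phi y)).
exact: alg e1 e2.
Unshelve. all: by end_near. Qed.

End Naturality.
End CurvatureNaturality.

(** * Smooth extension across the boundary *)

Section HalfSpace.
Context {R : realType} {m : nat}.
Local Notation rV := 'rV[R]_m.+1.
Local Notation e_ i := (delta_mx ord0 i : rV).
Local Notation o0 := (@ord0 m).
Implicit Types (O : set rV) (F G : rV -> R) (u v w x y z : rV).

Definition smooth_near x F : Prop :=
  \forall y \near x, forall s, differentiable (iter_partial s (F : rV -> R^o)) y.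

Lemma smooth_open_near O F x : open O -> O x -> smooth_open O F -> smooth_near x F.
Proof. by move=> oO Ox sF; near=> y => s; apply: sF; near: y; exact: open_nbhs_nbhs.
Unshelve. all: by end_near. Qed.

Lemma near_open x (P : rV -> Prop) : (\forall y \near x, P y) ->
  exists O, [/\ open O, O x & forall y, O y -> P y].
Proof. by rewrite /prop_near1 nbhsE; case=> O [oO Ox] OP; exists O. Qed.

Lemma smooth_near_open x F : smooth_near x F -> exists O, [/\ open O, O x & smooth_open O F].
Proof. by move=> /near_open[U [oU Ux h]]; exists U; split=> // s y Uy; exact: h. Qed.

Lemma path_cvg x v : x + t *: v @[t --> (0 : R)] --> x.
Proof.
rewrite -[x in _ --> x]addr0 -(scale0r v).
apply: cvgD; first exact: cvg_cst.
by apply: cvgZl; exact: cvg_id.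
Qed.

Lemma halfspace_path x (t : R) i : halfspace x -> 0 <= t -> halfspace (x + t *: e_ i).
Proof. by move=> hx t0; rewrite /halfspace /= !mxE addr_ge0// mulr_ge0// ler0n. Qed.

Lemma path_right x (P : rV -> Prop) : halfspace x -> (\forall y \near x, halfspace y -> P y) ->
  \forall t \near (0 : R)^'+, P (x + t *: e_ o0).
Proof.
move=> hx h0.
have h1 : \forall t \near (0 : R), halfspace (x + t *: e_ o0) -> P (x + t *: e_ o0) :=
  @path_cvg x (e_ o0) _ h0.
have h : \forall t \near (0 : R)^'+, halfspace (x + t *: e_ o0) -> P (x + t *: e_ o0).
  by apply: cvg_within h1.
have t0 : \forall t \near (0 : R)^'+, 0 < t by exact: nbhs_right_gt.
by apply: filterS2 t0 h => t t0; apply; apply: halfspace_path => //; exact: ltW.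
Qed.

(** Near the boundary the half-space restricts the increments in [partial], but it always allows
    positive ones. Hence the filter is proper, and the limit is the two-sided derivative of any
    differentiable extension. *)
Lemma partial_ext i F G x : halfspace x ->
  (\forall y \near x, halfspace y -> F y = G y) -> differentiable (G : rV -> R^o) x ->
  partial i F x = 'D_(e_ i) (G : rV -> R^o) x.
Proof.
move=> hx FG dG; rewrite /partial.
set D := [set t : R | halfspace (x + t *: e_ i)].
have pf : ProperFilter (within D (0 : R)^').
  apply: Build_ProperFilter_ex => P; rewrite /within /=; case=> r /= r0 hr.
  exists (r / 2); apply: hr.
  - rewrite /ball_ /= sub0r normrN gtr0_norm ?divr_gt0//.
    by rewrite ltr_pdivrMr// ltr_pMr// ltr1n.
  - by rewrite gt_eqF// divr_gt0.
  - by apply: halfspace_path => //; rewrite divr_ge0// ltW.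
apply: cvg_lim => //.
have dv := @diff_derivable _ _ _ _ _ (e_ i) dG.
have Fx : F x = G x by exact: (nbhs_singleton FG hx).
have nF : \forall t \near within D (0 : R)^', F (x + t *: e_ i) = G (x + t *: e_ i).
  have h0 : \forall t \near (0 : R), halfspace (x + t *: e_ i) ->
      F (x + t *: e_ i) = G (x + t *: e_ i) := @path_cvg x (e_ i) _ FG.
  rewrite near_withinE /dnbhs near_withinE.
  by apply: filterS h0 => t /= h _; exact: h.
have cG0 : t^-1 * (G (x + t *: e_ i) - G x) @[t --> (0 : R)^'] --> ('D_(e_ i) (G : rV -> R^o) x : R).
  have := dv; rewrite /derivable /derive.
  suff -> : (fun t : R => t^-1 * (G (x + t *: e_ i) - G x)) =
    (fun h : R => h^-1 *: (((G : rV -> R^o) \o shift x) (h *: e_ i) - G x : R^o)) by [].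
  by apply/funext => t /=; congr (_ * (G _ - _)); rewrite addrC.
have cG := cvg_within_filter D cG0.
move=> P lP.
have PG : \forall t \near within D (0 : R)^', P (t^-1 * (G (x + t *: e_ i) - G x)) := cG _ P lP.
suff : \forall t \near within D (0 : R)^', P (t^-1 * (F (x + t *: e_ i) - F x)) by [].
near=> t.
have -> : F (x + t *: e_ i) = G (x + t *: e_ i) by near: t.
rewrite Fx; near: t.
exact: PG.
Unshelve. all: by end_near. Qed.

Lemma derive_at_min F x v : differentiable (F : rV -> R^o) x ->
  (\forall y \near x, F x <= F y) -> (\forall y \near x, differentiable (F : rV -> R^o) y) ->
  'D_v (F : rV -> R^o) x = 0.
Proof.
move=> dF mF dnF.
have : \forall t \near (0 : R), F x <= F (x + t *: v) /\
    differentiable (F : rV -> R^o) (x + t *: v).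
  exact: (@path_cvg x v _ (filterI mF dnF)).
move/nbhs_ballP => [r /= r0 hr].
have hb (t : R) : - r < t < r -> F x <= F (x + t *: v) /\ differentiable (F : rV -> R^o) (x + t *: v).
  by move=> tr; apply: hr; rewrite /ball /= sub0r normrN ltr_norml.
have rr : - r < r by rewrite gtrN.
have z0 : (0 : R) \in `]- r, r[ by rewrite in_itv /= r0 oppr_lt0 r0.
have h1 (t : R) : t \in `]- r, r[ -> derivable (fun s : R => F (x + s *: v)) t 1.
  by rewrite in_itv /= => /hb[_ d]; have [] := derive_line d.
have h2 (t : R) : t \in `]- r, r[ -> F (x + 0 *: v) <= F (x + t *: v).
  by rewrite in_itv /= scale0r addr0 => /hb[].
have := @derive1_at_min R (fun s : R => F (x + s *: v)) (- r) r 0 (ltW rr) h1 z0 h2.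
move=> [_ <-]; have := @derive_line R m F x v 0.
by rewrite scale0r addr0 => /(_ dF)[_ ->].
Qed.

Lemma derive_tangent_eq0 F x v : (\forall t \near (0 : R), F (x + t *: v) = 0) ->
  'D_v (F : rV -> R^o) x = 0.
Proof.
move=> F0; have Fx : F x = 0 by have := nbhs_singleton F0; rewrite /= scale0r addr0.
rewrite /derive; apply: cvg_lim => //; apply: cvg_near_cst.
rewrite /dnbhs near_withinE; apply: filterS F0 => t /= Ft _.
by rewrite [t *: v + x]addrC Ft Fx subrr scaler0.
Qed.

End HalfSpace.

(** * Charts and extensions of functions off the half-space *)

Section Charts.
Context {R : realType} {T : topologicalType} {m : nat} (X : oriented_mfd R T m).
Local Notation rV := 'rV[R]_m.+1.
Local Notation e_ i := (delta_mx ord0 i : rV).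
Local Notation o0 := (@ord0 m).
Implicit Types (c d e : chart R T m) (p q : T) (W U V : set T) (phi : T -> T)
  (x y : rV) (f F : rV -> R).

Lemma chart_halfspace c p : atlas X c -> cdom c p -> halfspace (cmap c p).
Proof.
move=> /atlas_wf[_ [V oV E] _ _ _] cp.
have : (cmap c @` cdom c) (cmap c p) by exists p.
by rewrite E => -[].
Qed.

Lemma cinvK c p : atlas X c -> cdom c p -> cinv c (cmap c p) = p.
Proof. by move=> /atlas_wf[_ _ h _ _] cp; exact: h. Qed.

Lemma open_cdom c : atlas X c -> open (cdom c).
Proof. by move=> /atlas_wf[]. Qed.

(** A chart image is open only relative to the half-space, so the inverse chart is controlled at
    points of the half-space only. *)
Lemma chart_near c p W : atlas X c -> cdom c p -> (\forall q \near p, W q) ->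
  \forall y \near cmap c p, halfspace y ->
    [/\ W (cinv c y), cdom c (cinv c y) & cmap c (cinv c y) = y].
Proof.
move=> Xc cp Wp; have [oc [V oV E] cK _ ci] := atlas_wf Xc.
have imp : (cmap c @` cdom c) (cmap c p) by exists p.
have Vp : V (cmap c p) by move: imp; rewrite E => -[].
have nV : \forall y \near cmap c p, V y by exact: open_nbhs_nbhs.
have nW : \forall y \near cmap c p, (cmap c @` cdom c) y -> W (cinv c y).
  move/subspace_continuousP : ci => /(_ _ imp) h.
  have Wp' : nbhs (cinv c (cmap c p)) W by rewrite cK.
  exact: (h W Wp').
apply: filterS2 nV nW => y Vy hW hy.
have imy : (cmap c @` cdom c) y by rewrite E.
have [q cq qy] := imy.
by split; [exact: hW|rewrite -qy cK|rewrite -qy cK].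
Qed.

Lemma cmap_near c p (P : rV -> Prop) : atlas X c -> cdom c p ->
  (\forall y \near cmap c p, P y) -> \forall q \near p, cdom c q /\ P (cmap c q).
Proof.
move=> Xc cp Pp; have [oc _ _ /subspace_continuousP/(_ _ cp) cc _] := atlas_wf Xc.
have n1 : \forall q \near p, cdom c q by exact: open_nbhs_nbhs.
have n2 : \forall q \near p, cdom c q -> P (cmap c q) by exact: (cc P Pp).
by apply: filterS2 n1 n2 => q c1 h; split=> //; exact: h.
Qed.

(** Working notion of smoothness up to the boundary. The extension [F] is not unique, but its
    derivatives at points of the half-space are the partial derivatives of [f], so any choice will
    do. *)
Definition hext (x : rV) (f F : rV -> R) : Prop :=
  smooth_near x F /\ \forall y \near x, halfspace y -> f y = F y.

Lemma smooth_on_hext c p W (f : rV -> R) : atlas X c -> cdom c p -> (\forall q \near p, W q) ->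
  smooth_on (cmap c @` (W `&` cdom c)) f -> exists F, hext (cmap c p) f F.
Proof.
move=> Xc cp Wp sf.
have Wp' : W p by exact: nbhs_singleton.
have [|V [F [oV Vx sF VF]]] := sf (cmap c p); first by exists p.
exists F; split; first exact: smooth_open_near Vx sF.
have nV : \forall y \near cmap c p, V y by exact: open_nbhs_nbhs.
apply: filterS2 nV (chart_near Xc cp Wp) => y Vy h hy.
have [Wy cy yE] := h hy.
by rewrite VF//; exists (cinv c y).
Qed.

Lemma smooth_near_hext x F : smooth_near x F -> hext x F F.
Proof. by move=> sF; split=> //; near=> y => _.
Unshelve. all: by end_near. Qed.

Lemma smooth_near_differentiable x F : smooth_near x F -> differentiable (F : rV -> R^o) x.
Proof. by move=> /nbhs_singleton h; exact: (h [::]). Qed.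

Lemma smooth_near_near x F : smooth_near x F -> \forall y \near x, smooth_near y F.
Proof.
move=> /smooth_near_open[V [oV Vx sF]].
near=> y; apply: smooth_open_near sF => //.
by near: y; exact: open_nbhs_nbhs.
Unshelve. all: by end_near. Qed.

Lemma near_near x (P : rV -> Prop) : (\forall y \near x, P y) ->
  \forall y \near x, \forall z \near y, P z.
Proof.
move=> /near_open[V [oV Vx h]].
near=> y; near=> z; apply: h; near: z; apply: open_nbhs_nbhs; split=> //.
by near: y; exact: open_nbhs_nbhs.
Unshelve. all: by end_near. Qed.

Lemma hext_near x f F : hext x f F -> \forall y \near x, halfspace y -> hext y f F.
Proof.
move=> [sF fF]; apply: filterS2 (smooth_near_near sF) (near_near fF) => y h1 h2 _.
by split.
Qed.

Lemma hext_partial i x f F : halfspace x -> hext x f F ->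
  partial i f x = 'D_(e_ i) (F : rV -> R^o) x.
Proof.
by move=> hx [sF fF]; apply: partial_ext => //; exact: smooth_near_differentiable.
Qed.

Lemma hext_partial_near i x f F : hext x f F ->
  hext x (partial i f) ('D_(e_ i) (F : rV -> R^o)).
Proof.
move=> h; split.
  have [/smooth_near_open[V [oV Vx sF]] _] := h.
  exact: smooth_open_near Vx (smooth_open_partial i sF).
by apply: filterS (hext_near h) => y hy hsy; rewrite (hext_partial _ hsy (hy hsy)).
Qed.

Lemma hextE x f F : halfspace x -> hext x f F -> f x = F x.
Proof. by move=> hx [_ /nbhs_singleton]; exact. Qed.

End Charts.

(** * Smooth maps in charts and invariance of the boundary *)

Section Maps.
Context {R : realType} {T : topologicalType} {m : nat} (X : oriented_mfd R T m).
Local Notation rV := 'rV[R]_m.+1.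
Local Notation e_ i := (delta_mx ord0 i : rV).
Local Notation o0 := (@ord0 m).
Implicit Types (c d e : chart R T m) (p q : T) (W U V : set T) (phi psi : T -> T)
  (x y : rV) (f F G : rV -> R).

Definition smooth_self phi : Prop := continuous phi /\
  forall c d, atlas X c -> atlas X d -> smooth_map_on setT c d phi.

Lemma smooth_self_id : smooth_self id.
Proof. by split=> [p|c d Xc Xd]; [exact: cvg_id|exact: (atlas_smooth Xc Xd)]. Qed.

Lemma eq_hext x f f' F : (\forall y \near x, halfspace y -> f y = f' y) ->
  hext x f F -> hext x f' F.
Proof.
move=> ff' [sF fF]; split=> //; apply: filterS2 ff' fF => y h1 h2 hy.
by rewrite -h1// h2.
Qed.

Lemma smooth_near_eq x F G : (\forall y \near x, F y = G y) -> smooth_near x F -> smooth_near x G.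
Proof.
move=> FG sF.
have [V [oV Vx h]] := near_open (filterI FG sF).
apply: (smooth_open_near oV Vx); apply: (@smooth_open_eq _ _ V F) => //.
  by move=> y /h[].
by move=> s y /h[_]; exact.
Qed.

Lemma smooth_near_comp x (Phi : rV -> rV) G :
  (forall i, smooth_near x (fun y => Phi y ord0 i)) -> smooth_near (Phi x) G ->
  smooth_near x (G \o Phi).
Proof.
move=> sP /smooth_near_open[V [oV Vx sG]].
have nP : \forall y \near x, forall i s, differentiable (iter_partial s (fun y => Phi y ord0 i : R^o)) y.
  exact: near_forall.
have cP : {for x, continuous Phi}.
  have [dP _] := @differentiable_rV R m Phi x (fun i => smooth_near_differentiable (sP i)).
  exact: differentiable_continuous.
have nV : \forall y \near x, V (Phi y) by apply: cP; exact: open_nbhs_nbhs.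
have [U [oU Ux h]] := near_open (filterI nP nV).
apply: (smooth_open_near oU Ux); apply: (@smooth_open_comp _ _ U oU V) => //.
- by move=> i s y /h[h1 _]; exact: h1.
- by move=> y /h[].
Qed.

Section OneMap.
Variables (phi : T -> T) (sphi : smooth_self phi).
Variables (c d : chart R T m) (p : T).
Hypotheses (Xc : atlas X c) (Xd : atlas X d) (cp : cdom c p) (dp : cdom d (phi p)).

Let near_phi W : (\forall q \near phi p, W q) -> \forall q \near p, W (phi q).
Proof. by move=> Wp; exact: (sphi.1 p W Wp). Qed.

Lemma map_ext : exists F : rV -> rV, forall i,
  hext (cmap c p) (fun y => cmap d (phi (cinv c y)) ord0 i) (fun y => F y ord0 i).
Proof.
have h i : exists F, hext (cmap c p) (fun y => cmap d (phi (cinv c y)) ord0 i) F.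
  have nd : \forall q \near p, cdom d (phi q).
    by apply: near_phi; apply: open_nbhs_nbhs; split=> //; exact: open_cdom Xd.
  apply: (smooth_on_hext Xc cp nd).
  have := sphi.2 c d Xc Xd i.
  by rewrite setTI setIC.
have [F hF] := choice h.
exists (fun y => \row_i F i y) => i.
have -> : (fun y => (\row_i F i y) ord0 i) = F i by apply/funext => y; rewrite mxE.
exact: hF.
Qed.

Lemma jac_ext (F : rV -> rV) i j :
  (forall i, hext (cmap c p) (fun y => cmap d (phi (cinv c y)) ord0 i) (fun y => F y ord0 i)) ->
  jac phi c d p i j = 'D_(e_ j) (fun y => F y ord0 i : R^o) (cmap c p).
Proof.
move=> hF; rewrite mxE; apply: hext_partial (hF i).
exact: chart_halfspace Xc cp.
Qed.

Lemma jac_hext (F : rV -> rV) i j :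
  (forall i, hext (cmap c p) (fun y => cmap d (phi (cinv c y)) ord0 i) (fun y => F y ord0 i)) ->
  hext (cmap c p) (fun y => jac phi c d (cinv c y) i j) ('D_(e_ j) (fun y => F y ord0 i : R^o)).
Proof.
move=> hF; apply: eq_hext (hext_partial_near j (hF i)).
have nT : \forall q \near p, setT q by near=> q.
apply: filterS (chart_near Xc cp nT) => y hy hsy.
by have [_ _ yE] := hy hsy; rewrite mxE yE.
Unshelve. all: by end_near. Qed.

(** At points of the half-space the extension [F] gives the actual coordinates of [phi], hence takes
    values in the half-space, where [G] is known. Agreement is asked nowhere else. *)
Lemma hext_comp (F : rV -> rV) (f : T -> R) G :
  (forall i, hext (cmap c p) (fun y => cmap d (phi (cinv c y)) ord0 i) (fun y => F y ord0 i)) ->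
  hext (cmap d (phi p)) (fun y => f (cinv d y)) G ->
  F (cmap c p) = cmap d (phi p) /\ hext (cmap c p) (fun y => f (phi (cinv c y))) (G \o F).
Proof.
move=> hF [sG fG].
have hx := chart_halfspace Xc cp.
have Fx : F (cmap c p) = cmap d (phi p).
  apply/rowP => i; have := hextE hx (hF i).
  by rewrite (cinvK Xc cp).
split=> //; split.
  by apply: smooth_near_comp => [i|]; [have [] := hF i|rewrite Fx].
have nFG : \forall q \near p, (cdom d (phi q)) /\ (halfspace (cmap d (phi q)) ->
    f (cinv d (cmap d (phi q))) = G (cmap d (phi q))).
  exact: (near_phi (cmap_near Xd dp fG)).
have nF : \forall y \near cmap c p, forall i, halfspace y -> cmap d (phi (cinv c y)) ord0 i = F y ord0 i.
  by apply: near_forall => i; have [] := hF i.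
apply: filterS2 nF (chart_near Xc cp nFG) => y h1 h2 hy.
have [[dq h3] cq yE] := h2 hy.
have E : F y = cmap d (phi (cinv c y)) by apply/rowP => i; rewrite h1.
by rewrite /= E -h3 ?(cinvK Xd dq)//; exact: chart_halfspace Xd dq.
Qed.

Lemma hext_comp_ex (f : T -> R) G : hext (cmap d (phi p)) (fun y => f (cinv d y)) G ->
  exists F, hext (cmap c p) (fun y => f (phi (cinv c y))) F.
Proof. by have [F hF] := map_ext => /(hext_comp hF)[_ h]; eexists; exact: h. Qed.

Lemma partial_comp (f : T -> R) G j : hext (cmap d (phi p)) (fun y => f (cinv d y)) G ->
  partial j (fun y => f (phi (cinv c y))) (cmap c p) =
  \sum_k partial k (fun y => f (cinv d y)) (cmap d (phi p)) * jac phi c d p k j.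
Proof.
move=> hG; have [F hF] := map_ext; have [Fx hc] := hext_comp hF hG.
have hx := chart_halfspace Xc cp; have hx' := chart_halfspace Xd dp.
rewrite (hext_partial _ hx hc).
have dF i : differentiable (fun y => F y ord0 i : R^o) (cmap c p).
  by apply: smooth_near_differentiable; have [] := hF i.
have dG : differentiable (G : rV -> R^o) (F (cmap c p)).
  by rewrite Fx; apply: smooth_near_differentiable; have [] := hG.
have [_ ->] := derive_comp_rV (e_ j) dF dG.
apply: eq_bigr => k _.
by rewrite (jac_ext _ _ hF) (hext_partial _ hx' hG) Fx mulrC.
Qed.

Lemma drho_comp (rho : T -> R) G : hext (cmap d (phi p)) (fun y => rho (cinv d y)) G ->
  drho (rho \o phi) c p = drho rho d (phi p) *m jac phi c d p.
Proof.
move=> hG; apply/rowP => j; rewrite [LHS]mxE [RHS]mxE (partial_comp j hG).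
by apply: eq_bigr => k _; rewrite [in RHS]mxE.
Qed.

(* Otherwise the normal coordinate of [phi] would have an interior minimum at [p], and
   its differential would vanish. *)
Lemma det_jac_min : \det (jac phi c d p) != 0 -> cmap d (phi p) ord0 o0 = 0 -> cmap c p ord0 o0 = 0.
Proof.
move=> dn0 d0; have hx := chart_halfspace Xc cp.
apply/eqP; apply: contraNT dn0 => x0.
have {}x0 : 0 < cmap c p ord0 o0 by rewrite lt_neqAle eq_sym x0.
have [F hF] := map_ext.
have nd : \forall q \near p, cdom d (phi q).
  by apply: near_phi; apply: open_nbhs_nbhs; split=> //; exact: open_cdom Xd.
have nx : \forall y \near cmap c p, 0 < (y : rV) ord0 o0.
  have ccoord := @coord_continuous R 1 m.+1 ord0 o0 (cmap c p).
  exact: (cvgr_gt _ ccoord _ x0).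
have [sF0 F0] := hF o0.
have Fx : F (cmap c p) ord0 o0 = 0.
  by rewrite -(hextE hx (hF o0)) (cinvK Xc cp).
have nF : \forall y \near cmap c p, F (cmap c p) ord0 o0 <= F y ord0 o0.
  rewrite Fx; apply: filterS3 nx F0 (chart_near Xc cp nd) => y y0 h1 h2.
  have hy : halfspace y by rewrite /halfspace /= ltW.
  rewrite -h1//; have [dq _ _] := h2 hy.
  exact: (chart_halfspace Xd dq).
rewrite (expand_det_row _ o0); apply/eqP; apply: big1 => j _.
rewrite (jac_ext _ _ hF) derive_at_min ?mul0r//.
- exact: smooth_near_differentiable.
- apply: filterS (smooth_near_near sF0) => y; exact: smooth_near_differentiable.
Qed.

End OneMap.

Lemma jac_comp phi psi c d e p : smooth_self phi -> smooth_self psi ->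
  atlas X c -> atlas X d -> atlas X e -> cdom c p -> cdom d (phi p) -> cdom e (psi (phi p)) ->
  jac (psi \o phi) c e p = jac psi d e (phi p) *m jac phi c d p.
Proof.
move=> sphi spsi Xc Xd Xe cp dp ep; apply/matrixP => i j; rewrite [LHS]mxE [RHS]mxE.
have [F hF] := map_ext spsi Xd Xe dp ep.
rewrite (@partial_comp phi sphi c d p Xc Xd cp dp (fun q => cmap e (psi q) ord0 i) _ j (hF i)).
by apply: eq_bigr => k _; rewrite [in RHS]mxE.
Qed.

Lemma jac_id c p : atlas X c -> cdom c p -> jac id c c p = 1%:M.
Proof.
move=> Xc cp; have hx := chart_halfspace Xc cp.
have hF i : hext (cmap c p) (fun y => cmap c (cinv c y) ord0 i) (fun y => y ord0 i).
  split; first by apply: smooth_open_near openT _ (smooth_open_coord openT i).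
  have nT : \forall q \near p, setT q by near=> q.
  by apply: filterS (chart_near Xc cp nT) => y h hy; have [_ _ ->] := h hy.
apply/matrixP => i j; rewrite [LHS]mxE (hext_partial _ hx (hF i)) derive_coord !mxE eqxx /=.
by rewrite eq_sym.
Unshelve. all: by end_near. Qed.

(** [bdry] asks for a single chart. That every other chart puts the point at t = 0 follows from
    [det_jac_min] for the identity, since transition maps have positive Jacobian. *)
Lemma bdry_cmap c p : atlas X c -> cdom c p -> bdry X p <-> cmap c p ord0 o0 = 0.
Proof.
move=> Xc cp; split=> [[d [Xd dp d0]]|c0]; last by exists c.
apply: (det_jac_min smooth_self_id Xc Xd cp dp) => //.
by rewrite gt_eqF//; exact: (atlas_oriented Xc Xd).
Qed.

Lemma inter_cmap c p : atlas X c -> cdom c p -> inter X p <-> 0 < cmap c p ord0 o0.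
Proof.
move=> Xc cp; have := chart_halfspace Xc cp; rewrite /halfspace /= le_eqVlt => /orP[/eqP h|h].
  by rewrite -h ltxx; split=> // np; exfalso; apply: np; apply/(bdry_cmap Xc cp).
by split=> // _ /(bdry_cmap Xc cp) h0; rewrite h0 ltxx in h.
Qed.

End Maps.

(** * Calculus of germs and of extensions *)

Section SmoothNear.
Context {R : realType} {m : nat}.
Local Notation rV := 'rV[R]_m.+1.
Implicit Types (x y : rV) (f F G : rV -> R).

Lemma smooth_near2 x F G H : smooth_near x F -> smooth_near x G ->
  (forall O, open O -> smooth_open O F -> smooth_open O G -> smooth_open O H) -> smooth_near x H.
Proof.
move=> sF sG h; have [V [oV Vx hV]] := near_open (filterI sF sG).
apply: (smooth_open_near oV Vx); apply: h => // s y /hV[h1 h2]; [exact: h1|exact: h2].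
Qed.

Lemma smooth_nearD x F G : smooth_near x F -> smooth_near x G -> smooth_near x (fun y => F y + G y).
Proof. by move=> sF sG; apply: smooth_near2 sF sG _ => V oV; exact: smooth_openD. Qed.

Lemma smooth_nearM x F G : smooth_near x F -> smooth_near x G -> smooth_near x (fun y => F y * G y).
Proof. by move=> sF sG; apply: smooth_near2 sF sG _ => V oV; exact: smooth_openM. Qed.

Lemma smooth_near_cst x (a : R) : smooth_near x (cst a).
Proof. by apply: (smooth_open_near openT); [|exact: smooth_open_cst]. Qed.

Definition smooth_mx_near x n (A : rV -> 'M[R]_n) : Prop :=
  forall i j, smooth_near x (fun y => A y i j).

Lemma smooth_mx_near_open x n (A : rV -> 'M[R]_n) : smooth_mx_near x A ->
  exists O, [/\ open O, O x & forall i j, smooth_open O (fun y => A y i j)].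
Proof.
move=> sA.
have h : \forall y \near x, forall i j l, differentiable (iter_partial l (fun y => A y i j : R^o)) y.
  by apply: near_forall => i; apply: near_forall => j; exact: sA.
have [V [oV Vx hV]] := near_open h.
by exists V; split=> // i j l y Vy; exact: hV.
Qed.

Lemma hext_cst x (a : R) : hext x (cst a) (cst a).
Proof. exact: smooth_near_hext (smooth_near_cst x a). Qed.

Lemma hextD x f g F G : hext x f F -> hext x g G -> hext x (fun y => f y + g y) (fun y => F y + G y).
Proof.
move=> [sF fF] [sG gG]; split; first exact: smooth_nearD.
by apply: filterS2 fF gG => y h1 h2 hy; rewrite h1// h2.
Qed.

Lemma hextM x f g F G : hext x f F -> hext x g G -> hext x (fun y => f y * g y) (fun y => F y * G y).
Proof.
move=> [sF fF] [sG gG]; split; first exact: smooth_nearM.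
by apply: filterS2 fF gG => y h1 h2 hy; rewrite h1// h2.
Qed.

Lemma hext_sum x n (f F : 'I_n -> rV -> R) : (forall i, hext x (f i) (F i)) ->
  hext x (fun y => \sum_i f i y) (fun y => \sum_i F i y).
Proof.
elim: n f F => [|n IH] f F h.
  have E (g : 'I_0 -> rV -> R) : (fun y => \sum_i g i y) = cst 0.
    by apply/funext => y; rewrite big_ord0.
  by rewrite !E; exact: hext_cst.
have E (g : 'I_n.+1 -> rV -> R) : (fun y => \sum_i g i y) = (fun y => g ord0 y + \sum_i g (lift ord0 i) y).
  by apply/funext => y; rewrite big_ord_recl.
rewrite !E; apply: hextD => //; exact: IH.
Qed.

Lemma hext_mulmx x (a b c : nat) (A FA : rV -> 'M[R]_(a, b)) (B FB : rV -> 'M[R]_(b, c)) :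
  (forall i j, hext x (fun y => A y i j) (fun y => FA y i j)) ->
  (forall i j, hext x (fun y => B y i j) (fun y => FB y i j)) ->
  forall i j, hext x (fun y => (A y *m B y) i j) (fun y => (FA y *m FB y) i j).
Proof.
move=> hA hB i j.
have E (C : rV -> 'M[R]_(a, b)) (D : rV -> 'M[R]_(b, c)) :
    (fun y => (C y *m D y) i j) = (fun y => \sum_k C y i k * D y k j).
  by apply/funext => y; rewrite mxE.
by rewrite !E; apply: hext_sum => k; exact: hextM.
Qed.

Lemma smooth_near_continuous x F : smooth_near x F -> {for x, continuous F}.
Proof.
move=> sF; apply: (@differentiable_continuous _ _ R^o).
exact: smooth_near_differentiable.
Qed.

End SmoothNear.

(** * Boundary values as limits from the interior *)

Section BoundaryLimits.
Context {R : realType} {T : topologicalType} {m : nat} (X : oriented_mfd R T m).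
Local Notation rV := 'rV[R]_m.+1.
Local Notation e_ i := (delta_mx ord0 i : rV).
Local Notation o0 := (@ord0 m).
Implicit Types (c d e : chart R T m) (p q : T) (W U V : set T) (phi psi : T -> T)
  (x y : rV) (F G : rV -> R) (f g : T -> R).

Section Point.
Variables (c : chart R T m) (p : T).
Hypotheses (Xc : atlas X c) (cp : cdom c p) (bp : bdry X p).
Let x := cmap c p.
Let hx : halfspace x. Proof. exact: chart_halfspace Xc cp. Qed.
Let x0 : x ord0 o0 = 0. Proof. exact/(bdry_cmap Xc cp). Qed.

Definition bpath (t : R) : T := cinv c (x + t *: e_ o0).

Lemma bpath_near (W : T -> Prop) : (\forall q \near p, W q) ->
  \forall t \near (0 : R)^'+, [/\ W (bpath t), inter X (bpath t), cdom c (bpath t) &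
    cmap c (bpath t) = x + t *: e_ o0].
Proof.
move=> Wp.
have t0 : \forall t \near (0 : R)^'+, 0 < t by exact: nbhs_right_gt.
apply: filterS2 t0 (path_right hx (chart_near Xc cp Wp)) => t t0 [h2 h3 h4].
by split=> //; apply/(inter_cmap Xc h3); rewrite h4 !mxE x0 add0r eqxx mulr1.
Qed.

Lemma bpath_hext f F : hext x (fun y => f (cinv c y)) F ->
  f (bpath t) @[t --> (0 : R)^'+] --> f p.
Proof.
move=> hF; have [sF fF] := hF.
have -> : f p = F x by rewrite -(hextE hx hF) (cinvK Xc cp).
have cF : F (x + t *: e_ o0) @[t --> (0 : R)^'+] --> F x.
  apply: cvg_comp (smooth_near_continuous sF).
  move=> P hP; have n0 : \forall y \near x, P (F y) := hP.
  have n1 : \forall y \near x, halfspace y -> P (F y) by apply: filterS n0 => y.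
  exact: (path_right (P := fun y => P (F y)) hx n1).
apply: cvg_trans cF; apply: near_eq_cvg.
by apply: filterS (path_right hx fF) => t ->.
Qed.

(** It is enough to know the ratio [r] along the path. This serves the comparison of two defining
    functions, through the limit of their quotient alone. *)
Lemma boundary_unique f F g G (r : R -> R) (k : R) :
  hext x (fun y => f (cinv c y)) F -> hext x (fun y => g (cinv c y)) G ->
  (\forall t \near (0 : R)^'+, f (bpath t) = r t * g (bpath t)) ->
  r t @[t --> (0 : R)^'+] --> k -> f p = k * g p.
Proof.
move=> hF hG E rk.
have c1 := bpath_hext hF.
have c2 : r t * g (bpath t) @[t --> (0 : R)^'+] --> k * g p.
  by apply: cvgM => //; exact: bpath_hext hG.
have c3 : f (bpath t) @[t --> (0 : R)^'+] --> k * g p.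
  apply: cvg_trans c2; apply: near_eq_cvg.
  by apply: filterS E => t ->.
by rewrite -(cvg_lim (@Rhausdorff R) c1) -(cvg_lim (@Rhausdorff R) c3).
Qed.

Lemma boundary_eq f F g G : hext x (fun y => f (cinv c y)) F -> hext x (fun y => g (cinv c y)) G ->
  (\forall q \near p, inter X q -> f q = g q) -> f p = g p.
Proof.
move=> hF hG E; rewrite -[RHS]mul1r; apply: (boundary_unique hF hG (r := cst 1)); last exact: cvg_cst.
by apply: filterS (bpath_near E) => t [h iq _ _]; rewrite mul1r h.
Qed.

(** The limit defining [bval] is unique because interior points accumulate at [p], and it is the
    value of the continuous extension. *)
Lemma bval_hext f g G : hext x (fun y => g (cinv c y)) G ->
  (\forall q \near p, inter X q -> f q = g q) -> bval c f p = g p.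
Proof.
move=> hG E; have [sG gG] := hG; rewrite /bval -/x.
set D := [set y : rV | 0 < y ord0 o0].
have pf : ProperFilter (within D (nbhs x)).
  apply: Build_ProperFilter_ex => P hP.
  have [y [h1 _ h2]] := pos_dense x0 hP (@filterT _ (nbhs x) _).
  by exists y; exact: h1.
apply: cvg_lim => //.
have -> : g p = G x by rewrite -(hextE hx hG) (cinvK Xc cp).
have cG : G y @[y --> within D (nbhs x)] --> G x.
  apply: cvg_within_filter; exact: smooth_near_continuous.
apply: cvg_trans cG; apply: near_eq_cvg.
rewrite near_withinE.
apply: filterS2 gG (chart_near Xc cp E) => y h1 h2 y0.
have hy : halfspace y by rewrite /halfspace /= ltW.
have [h3 h4 h5] := h2 hy.
rewrite -h1// h3//; apply/(inter_cmap Xc h4); by rewrite h5.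
Qed.

Lemma partial_normal f F : hext x (fun y => f (cinv c y)) F -> f p = 0 ->
  t^-1 * f (bpath t) @[t --> (0 : R)^'+] --> partial o0 (fun y => f (cinv c y)) x.
Proof.
move=> hF fp; have [sF fF] := hF.
rewrite (hext_partial _ hx hF).
have Fx : F x = 0 by rewrite -(hextE hx hF) (cinvK Xc cp).
have dv := @diff_derivable _ _ _ _ _ (e_ o0) (smooth_near_differentiable sF).
have cG0 : t^-1 * F (x + t *: e_ o0) @[t --> (0 : R)^'] --> ('D_(e_ o0) (F : rV -> R^o) x : R).
  have := dv; rewrite /derivable /derive.
  suff -> : (fun t : R => t^-1 * F (x + t *: e_ o0)) =
    (fun h : R => h^-1 *: (((F : rV -> R^o) \o shift x) (h *: e_ o0) - F x : R^o)) by [].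
  by apply/funext => t /=; rewrite Fx subr0 [t *: _ + x]addrC.
have cG : t^-1 * F (x + t *: e_ o0) @[t --> (0 : R)^'+] --> ('D_(e_ o0) (F : rV -> R^o) x : R).
  exact: cvg_dnbhs_at_right cG0.
apply: cvg_trans cG; apply: near_eq_cvg.
by apply: filterS (path_right hx fF) => t; rewrite /bpath => ->.
Qed.

Lemma partial_normal_ge0 f F : hext x (fun y => f (cinv c y)) F -> f p = 0 ->
  (\forall q \near p, 0 <= f q) -> 0 <= partial o0 (fun y => f (cinv c y)) x.
Proof.
move=> hF fp f0; have := partial_normal hF fp.
move=> c1; have [G EG] : exists G : R -> R, G = (fun t => t^-1 * f (bpath t)) by eexists.
rewrite -EG in c1.
have pG : \forall t \near (0 : R)^'+, 0 <= G t.
  have p0 : \forall t \near (0 : R)^'+, 0 < t by exact: nbhs_right_gt.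
  by apply: filterS2 p0 (bpath_near f0) => t t0 [h _ _ _]; rewrite EG mulr_ge0// invr_ge0 ltW.
have := limr_ge (cvgP _ c1) pG; rewrite (cvg_lim (@Rhausdorff R) c1); exact.
Qed.

Lemma partial_tangential f F j : hext x (fun y => f (cinv c y)) F ->
  (\forall q \near p, bdry X q -> f q = 0) -> partial (lift o0 j) (fun y => f (cinv c y)) x = 0.
Proof.
move=> hF f0; have [sF fF] := hF.
rewrite (hext_partial _ hx hF); apply: derive_tangent_eq0.
have h := @path_cvg R m x (e_ (lift o0 j)) _ (filterI fF (chart_near Xc cp f0)).
have {}h : \forall t \near (0 : R), let y := x + t *: e_ (lift o0 j) in
  (halfspace y -> f (cinv c y) = F y) /\ (halfspace y -> [/\ bdry X (cinv c y) -> f (cinv c y) = 0, cdom c (cinv c y) & cmap c (cinv c y) = y]).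
  exact: h.
apply: filterS h => t /= [h1 h2].
have y0 : (x + t *: e_ (lift o0 j)) ord0 o0 = 0 by rewrite !mxE x0 add0r /= mulr0.
have hy : halfspace (x + t *: e_ (lift o0 j)) by rewrite /halfspace /= y0.
have [h3 h4 h5] := h2 hy.
by rewrite -h1// h3//; apply/(bdry_cmap Xc h4); rewrite h5.
Qed.

End Point.
End BoundaryLimits.

(** * Positive definite matrices and densities *)

Section PosDef.
Context {R : realType}.

Definition posdef (n : nat) (A : 'M[R]_n) : Prop :=
  forall v : 'rV[R]_n, v != 0 -> 0 < (v *m A *m v^T) ord0 ord0.

Lemma sqnorm_ge0 n (v : 'rV[R]_n) : 0 <= (v *m v^T) ord0 ord0.
Proof. by rewrite mxE sumr_ge0// => i _; rewrite mxE -expr2 sqr_ge0. Qed.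

Lemma sqnorm_gt0 n (v : 'rV[R]_n) : v != 0 -> 0 < (v *m v^T) ord0 ord0.
Proof.
move=> v0; rewrite lt_neqAle sqnorm_ge0 andbT eq_sym; apply: contraNN v0.
rewrite mxE psumr_eq0; last by move=> i _; rewrite mxE -expr2 sqr_ge0.
move=> /allP h; apply/eqP/rowP => i; rewrite mxE.
by have := h i (mem_index_enum _); rewrite mxE -expr2 sqrf_eq0 => /eqP.
Qed.

Lemma posdef_unit n (A : 'M[R]_n) : posdef A -> \det A != 0.
Proof.
move=> pA; apply/negP => /det0P[v v0 vA].
by have := pA v v0; rewrite vA mul0mx mxE ltxx.
Qed.

(* The determinant does not vanish on the segment from [A] to the identity. *)
Lemma posdef_det_gt0 n (A : 'M[R]_n) : posdef A -> 0 < \det A.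
Proof.
move=> pA.
pose M : 'M[{poly R}]_n := (1 - 'X) *: 1%:M + 'X *: map_mx polyC A.
have ME s : (\det M).[s] = \det ((1 - s) *: 1%:M + s *: A).
  rewrite -[LHS]/(horner_eval s (\det M)) -det_map_mx; congr (\det _).
  by apply/matrixP => i j; rewrite !mxE; case: (i == j); rewrite /= ?mulr1n ?mulr0n /horner_eval !hornerE.
have pos s : 0 <= s <= 1 -> posdef ((1 - s) *: 1%:M + s *: A).
  move=> /andP[s0 s1] v v0.
  have -> : (v *m ((1 - s) *: 1%:M + s *: A) *m v^T) ord0 ord0 =
      (1 - s) * (v *m v^T) ord0 ord0 + s * (v *m A *m v^T) ord0 ord0.
    rewrite mulmxDr mulmxDl -!scalemxAr -!scalemxAl mulmx1.
    by rewrite [LHS]mxE [X in X + _]mxE [X in _ + X]mxE.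
  have h1 := sqnorm_gt0 v0; have h2 := pA v v0.
  have [->|sn0] := eqVneq s 0; first by rewrite subr0 mul1r mul0r addr0.
  have sp : 0 < s by rewrite lt_neqAle eq_sym sn0.
  by apply: ltr_wpDl; [rewrite mulr_ge0 ?subr_ge0 ?(ltW h1)|rewrite mulr_gt0].
rewrite ltNge; apply/negP => detA.
have [||s] := @poly_ivt R (- \det M) 0 1.
- exact: ler01.
- rewrite !hornerN !ME subr0 subrr !scale1r !scale0r addr0 add0r det1.
  by rewrite oppr_le0 ler01 oppr_ge0.
move=> s01 /rootP; rewrite hornerN ME => /eqP; rewrite oppr_eq0.
by apply/negP/posdef_unit/pos; exact: s01.
Qed.

(** An isotropic vector of a positive semidefinite form lies in its kernel. This upgrades the
    boundary values of rho^2 g, which are limits of positive definite matrices and assumed only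
    nondegenerate. *)
Lemma posdef_of_semidef n (A : 'M[R]_n) : A^T = A -> A \in unitmx ->
  (forall v : 'rV[R]_n, 0 <= (v *m A *m v^T) ord0 ord0) -> posdef A.
Proof.
move=> sA uA h v v0; rewrite lt_neqAle h andbT eq_sym; apply: contraNN v0 => /eqP q0.
have b0 (w : 'rV[R]_n) : (v *m A *m w^T) ord0 ord0 = 0.
  set b := (v *m A *m w^T) ord0 ord0; set a := (w *m A *m w^T) ord0 ord0.
  have bs : (w *m A *m v^T) ord0 ord0 = b.
    by rewrite /b -[in LHS](trmxK (w *m A *m v^T)) mxE !trmx_mul trmxK sA mulmxA.
  have E (t : R) : ((v + t *: w) *m A *m (v + t *: w)^T) ord0 ord0 = 2 * t * b + t ^+ 2 * a.
    rewrite linearD linearZ /= !(mulmxDl, mulmxDr) -!scalemxAl -!scalemxAr.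
    have aD (B C : 'M[R]_1) : (B + C) ord0 ord0 = B ord0 ord0 + C ord0 ord0 by rewrite mxE.
    have aZ k (B : 'M[R]_1) : (k *: B) ord0 ord0 = k * B ord0 ord0 by rewrite mxE.
    by rewrite !(aD, aZ) q0 bs -/b -/a; ring.
  apply/eqP; rewrite eq_le; apply/andP; split; rewrite leNgt; apply/negP => b0.
  - have a1 : 0 < `|a| + 1 by rewrite ltr_wpDl.
    (* At t = -b / (|a| + 1) the value 2 t b + t^2 a is negative; the summand 1 avoids a zero
       denominator. *)
    have := h (v + (- (b / (`|a| + 1))) *: w); rewrite E.
    set c := b / (`|a| + 1); have c0 : 0 < c by rewrite divr_gt0.
    have bE : b = c * (`|a| + 1) by rewrite /c divfK// gt_eqF.
    have aa : a <= `|a| by exact: ler_norm.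
    rewrite bE; nra.
  - have a1 : 0 < `|a| + 1 by rewrite ltr_wpDl.
    have := h (v + (- (b / (`|a| + 1))) *: w); rewrite E.
    set c := b / (`|a| + 1); have c0 : c < 0 by rewrite ltr_pdivrMr// mul0r.
    have bE : b = c * (`|a| + 1) by rewrite /c divfK// gt_eqF.
    have aa : a <= `|a| by exact: ler_norm.
    rewrite bE; nra.
have vA : v *m A = 0.
  apply/rowP => i; have := b0 (delta_mx ord0 i).
  by rewrite trmx_delta -colE mxE => ->; rewrite mxE.
by rewrite -[v](mulmxK uA) vA mul0mx.
Qed.

Lemma posdef_congr n (A J : 'M[R]_n) : posdef A -> J \in unitmx -> posdef (J^T *m A *m J).
Proof.
move=> pA uJ v v0.
have := pA (v *m J^T); rewrite trmx_mul trmxK !mulmxA; apply.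
apply: contraNN v0 => /eqP h; apply/eqP.
have uT : J^T \in unitmx by rewrite unitmx_tr.
by rewrite -[v](mulmxK uT) h mul0mx.
Qed.

End PosDef.

(** * Restriction to the boundary, and weights *)

Section Tangential.
Context {R : realType} {m : nat}.
Local Notation rV := 'rV[R]_m.+1.
Local Notation o0 := (@ord0 m).
Implicit Types (A J M : 'M[R]_m.+1) (r : rV).

Lemma tangential_posdef A : posdef A -> posdef (tangential A).
Proof.
move=> pA v v0.
pose w : rV := \row_i (if unlift ord0 i is Some j then v ord0 j else 0).
have wl j : w ord0 (lift ord0 j) = v ord0 j by rewrite mxE liftK.
have w0 : w ord0 o0 = 0 by rewrite mxE unlift_none.
have wn0 : w != 0.
  apply: contraNN v0 => /eqP h; apply/eqP/rowP => j; by rewrite -wl h !mxE.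
have := pA w wn0; suff -> : (v *m tangential A *m v^T) ord0 ord0 = (w *m A *m w^T) ord0 ord0 by [].
rewrite !mxE big_ord_recl [w^T _ _]mxE w0 mulr0 add0r; apply: eq_bigr => j _.
rewrite ![_^T _ _]mxE wl; congr (_ * _); rewrite !mxE big_ord_recl w0 mul0r add0r.
by apply: eq_bigr => i _; rewrite wl mxE.
Qed.

(** The condition on [J] says that it maps vectors tangent to the boundary to tangent vectors. *)
Lemma tangential_mul A J : (forall j, J o0 (lift o0 j) = 0) ->
  tangential (A *m J) = tangential A *m tangential J.
Proof.
move=> J0; apply/matrixP => i j; rewrite !mxE big_ord_recl J0 mulr0 add0r.
by apply: eq_bigr => k _; rewrite !mxE.
Qed.

Lemma tangential_congr A J : (forall j, J o0 (lift o0 j) = 0) ->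
  tangential (J^T *m A *m J) = (tangential J)^T *m tangential A *m tangential J.
Proof.
move=> J0; rewrite tangential_mul//; congr (_ *m _).
have -> : J^T *m A = (A^T *m J)^T by rewrite trmx_mul trmxK.
have E B : tangential B^T = (tangential B)^T by apply/matrixP => i j; rewrite !mxE.
by rewrite E tangential_mul// trmx_mul E trmxK.
Qed.

Lemma det_tangential J : (forall j, J o0 (lift o0 j) = 0) -> \det J = J o0 o0 * \det (tangential J).
Proof.
move=> J0; rewrite (expand_det_row _ o0) big_ord_recl big1 ?addr0; last first.
  by move=> j _; rewrite J0 mul0r.
congr (_ * _); rewrite /cofactor addn0 expr0 mul1r; congr (\det _).
by apply/matrixP => i j; rewrite !mxE.
Qed.

Lemma tangentialZ a A : tangential (a *: A) = a *: tangential A.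
Proof. by apply/matrixP => i j; rewrite !mxE. Qed.

(* The product of the volume form by the inverse of the 1-density. *)
Definition vol_density (B : 'M[R]_m) : R := Num.sqrt (\det B) * (metric_density B)^-1.

Lemma vol_densityE B : 0 < \det B -> vol_density B = \det B `^ (2^-1 + (2 * m)%:R^-1).
Proof.
move=> B0; rewrite /vol_density /metric_density powRN invrK -powR12_sqrt ?ltW// powRD//.
by rewrite (gt_eqF B0) implybT.
Qed.

Lemma vol_density_scale B (a : R) : (0 < m)%N -> 0 < \det B -> 0 < a ->
  vol_density (a ^+ 2 *: B) = a ^+ m.+1 * vol_density B.
Proof.
move=> m0 B0 a0; have a20 : 0 < (a ^+ 2) ^+ m by rewrite !exprn_gt0.
have mn : m%:R != 0 :> R by rewrite pnatr_eq0 -lt0n.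
rewrite !vol_densityE ?detZ ?mulr_gt0// powRM ?ltW//; congr (_ * _).
rewrite -exprM -(powR_mulrn (2 * m) (ltW a0)) -powRrM mulrDr natrM.
have -> : 2 * m%:R / 2 + 2 * m%:R / (2 * m%:R) = m.+1%:R :> R by rewrite -natr1; field.
by rewrite powR_mulrn// ltW.
Qed.

(** The determinant is multiplied by (det J)^2, and the exponent 1/2 + 1/(2m) turns this into the
    factor of a volume form times the weight 1/m, as in the third slot of [pull_triple]. *)
Lemma vol_density_congr B (J : 'M[R]_m) : (0 < m)%N -> 0 < \det B -> 0 < \det J ->
  vol_density (J^T *m B *m J) = \det J * `|\det J| `^ (m%:R^-1) * vol_density B.
Proof.
move=> m0 B0 J0; set d := \det J in J0 *.
have mn : m%:R != 0 :> R by rewrite pnatr_eq0 -lt0n.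
have E : \det (J^T *m B *m J) = d ^+ 2 * \det B by rewrite !det_mulmx det_tr -/d; ring.
have d2 : 0 < d ^+ 2 by rewrite exprn_gt0.
rewrite !vol_densityE ?E ?mulr_gt0// powRM ?ltW//; congr (_ * _).
rewrite -(powR_mulrn 2 (ltW J0)) -powRrM mulrDr natrM.
have -> : 2 / 2 + 2 / (2 * m%:R) = 1 + m%:R^-1 :> R by field.
by rewrite powRD ?(gt_eqF J0) ?implybT// powRr1 ?ltW// gtr0_norm.
Qed.

(* The third slot of the cocycle, in terms of the boundary values [A] of rho^2 g, [M]
   of rho^-(n-2) (h - g), and [r] of d rho. *)
Definition kval A M r : R := vol_density (tangential A) *
  (2^-1 * (m.+1%:R * \tr (invmx A *m M) - ip M (r *m invmx A) (r *m invmx A))).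

Lemma kvalB A M M' r : kval A (M - M') r = kval A M r - kval A M' r.
Proof.
have iB w : ip (M - M') w w = ip M w w - ip M' w w.
  by rewrite /ip mulmxBr mulmxBl !mxE.
by rewrite /kval mulmxBr linearB /= iB; ring.
Qed.

(** Homogeneities cancel: the density has degree m + 1 in [a], the inverse of [A] in the trace and
    the square of the normal have degree -2, and [M] has degree -(m - 1), where m - 1 = n - 2 is the
    power of rho dividing h - g. *)
Lemma kval_scale A M r (a : R) : (0 < m)%N -> 0 < \det (tangential A) -> A \in unitmx -> 0 < a ->
  kval (a ^+ 2 *: A) ((a ^+ m.-1)^-1 *: M) (a *: r) = kval A M r.
Proof.
move=> m0 dA uA a0; have an : a != 0 by rewrite gt_eqF.
rewrite /kval tangentialZ vol_density_scale//.
rewrite invmxZ; last by rewrite unitmxZ// unitfE expf_neq0.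
rewrite -!scalemxAl -!scalemxAr !scalerA mxtraceZ ip_mxZ ip_scalel ip_scaler.
have -> : a ^+ m.+1 = a ^+ 2 * a ^+ m.-1 by rewrite -exprD; congr (_ ^+ _); case: (m) m0.
have am : a ^+ m.-1 != 0 by rewrite expf_neq0.
by field; rewrite am an.
Qed.

(** The trace and the value on the normal are invariants of the two forms and the covector, so only
    the density transforms. *)
Lemma kval_congr A M r J : (0 < m)%N -> 0 < \det (tangential A) -> A \in unitmx ->
  J \in unitmx -> (forall j, J o0 (lift o0 j) = 0) -> 0 < \det (tangential J) ->
  kval (J^T *m A *m J) (J^T *m M *m J) (r *m J) =
  \det (tangential J) * `|\det (tangential J)| `^ (m%:R^-1) * kval A M r.
Proof.
move=> m0 dA uA uJ J0 dJ.
rewrite /kval tangential_congr// vol_density_congr// -!mulrA; congr (_ * (_ * (_ * _))).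
have uJT : J^T \in unitmx by rewrite unitmx_tr.
have iE : invmx (J^T *m A *m J) = invmx J *m invmx A *m invmx J^T.
  have uAll : J^T *m A *m J \in unitmx by rewrite !unitmx_mul uJT uA.
  apply: (can_inj (mulmxK uAll)); rewrite mulVmx//.
  by rewrite !mulmxA mulmxKV// mulmxKV// mulVmx.
congr (_ * (_ * _)); rewrite iE; congr (_ * _ - _).
  by rewrite !mulmxA mulmxKV// mxtrace_mulC !mulmxA mulmxV// mul1mx.
rewrite !mulmxA mulmxK// /ip !mulmxA mulmxKV//.
rewrite trmx_mul trmx_inv trmxK -!mulmxA; congr ((_ *m (_ *m (_ *m _))) _ _).
by rewrite !mulmxA mulmxV// mul1mx.
Qed.

End Tangential.

(** * Sectional curvature in charts *)

Lemma exchange_sum4 (R : realType) n (F : 'I_n -> 'I_n -> 'I_n -> 'I_n -> R) :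
  \sum_q \sum_i \sum_j \sum_k F q i j k = \sum_k \sum_i \sum_j \sum_q F q i j k.
Proof.
rewrite exchange_big [RHS]exchange_big; apply: eq_bigr => i _ /=.
rewrite exchange_big [RHS]exchange_big; apply: eq_bigr => j _ /=.
by rewrite exchange_big.
Qed.

Section Sectional.
Context {R : realType} {T : topologicalType} {m : nat} (X : oriented_mfd R T m).
Local Notation rV := 'rV[R]_m.+1.
Local Notation e_ i := (delta_mx ord0 i : rV).
Local Notation o0 := (@ord0 m).
Implicit Types (c d e : chart R T m) (p q : T) (W U V : set T) (phi psi : T -> T)
  (x y v w : rV) (F : rV -> R) (g h : @tensor2 R T m) (A B : rV -> 'M[R]_m.+1).

Lemma chr_local A B k i j y : (\forall z \near y, A z = B z) -> chr A k i j y = chr B k i j y.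
Proof.
move=> AB; rewrite /chr (nbhs_singleton AB); congr (_ * _); apply: eq_bigr => l _.
have E i' j' v : 'D_v (fun z => A z i' j' : R^o) y = 'D_v (fun z => B z i' j' : R^o) y.
  by apply: near_eq_derive; apply: filterS AB => z ->.
by rewrite !E.
Qed.

Lemma curv_vec_local A B v w y : (\forall z \near y, A z = B z) ->
  curv_vec (chr A) v w y = curv_vec (chr B) v w y.
Proof.
move=> AB.
have nE : \forall z \near y, forall k i j, chr A k i j z = chr B k i j z.
  by apply: filterS (near_near AB) => z h k i j; exact: chr_local.
have cE u z : ctr (chr A) y u z = ctr (chr B) y u z.
  apply/rowP => k; rewrite [LHS]mxE [RHS]mxE; apply: eq_bigr => i _; apply: eq_bigr => j _.
  by rewrite (nbhs_singleton nE).
have dE u u1 u2 : Dr u (fun z => ctr (chr A) z u1 u2) y = Dr u (fun z => ctr (chr B) z u1 u2) y.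
  apply/rowP => l; rewrite [LHS]mxE [RHS]mxE.
  apply: near_eq_derive; apply: filterS nE => z h.
  rewrite [LHS]mxE [RHS]mxE; apply: eq_bigr => i _; apply: eq_bigr => j _.
  by rewrite h.
rewrite !curv_vecE.
have e1 := etrans (cE v _) (congr1 (ctr (chr B) y v) (cE w w)).
have e2 := etrans (cE w _) (congr1 (ctr (chr B) y w) (cE v w)).
by rewrite dE (dE w) e1 e2.
Qed.

Lemma hyp_eq_local A B v w y : (\forall z \near y, A z = B z) -> hyp_eq A v w y -> hyp_eq B v w y.
Proof. by move=> AB; rewrite /hyp_eq (curv_vec_local _ _ AB) (nbhs_singleton AB). Qed.

Section AtPoint.
Variables (g : @tensor2 R T m) (c : chart R T m) (p : T).
Hypotheses (mg : is_metric X g) (Xc : atlas X c) (cp : cdom c p) (ip0 : inter X p).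
Let gc (y : rV) := g c (cinv c y).
Let x := cmap c p.

Lemma inter_near : \forall y \near x, [/\ halfspace y, inter X (cinv c y), cdom c (cinv c y) & cmap c (cinv c y) = y].
Proof.
have x0 : 0 < x ord0 o0 by exact/(inter_cmap Xc cp).
have nx : \forall y \near x, 0 < (y : rV) ord0 o0.
  have ccoord := @coord_continuous R 1 m.+1 ord0 o0 x.
  exact: (cvgr_gt _ ccoord _ x0).
have nT : \forall q \near p, setT q by near=> q.
apply: filterS2 nx (chart_near Xc cp nT) => y y0 h.
have hy : halfspace y by rewrite /halfspace /= ltW.
have [_ h2 h3] := h hy; split=> //.
by apply/(inter_cmap Xc h2); rewrite h3.
Unshelve. all: by end_near. Qed.

Lemma open_inter_near : \forall q \near p, inter X q.
Proof.
have := cmap_near Xc cp inter_near; apply: filterS => q [cq [_ h _ _]].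
by rewrite (cinvK Xc cq) in h.
Qed.

Lemma metric_smooth_near : smooth_mx_near x gc.
Proof.
move=> i j; have [[_ sg] _] := mg.
have [F [sF fF]] := smooth_on_hext Xc cp open_inter_near (sg c i j Xc).
apply: smooth_near_eq sF; apply: filterS2 inter_near fF => y [hy _ _ _] h.
by rewrite h.
Qed.

End AtPoint.

Section AtPoint2.
Variables (g : @tensor2 R T m) (c : chart R T m) (p : T).
Hypotheses (mg : is_metric X g) (Xc : atlas X c) (cp : cdom c p) (ip0 : inter X p).
Let gc (y : rV) := g c (cinv c y).
Let x := cmap c p.

Lemma dcoordE i (f : T -> R) F : smooth_near x F -> (\forall y \near x, f (cinv c y) = F y) ->
  dcoord i f c p = 'D_(e_ i) (F : rV -> R^o) x.
Proof.
move=> sF fF; apply: partial_ext.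
- exact: chart_halfspace Xc cp.
- by apply: filterS fF => y h _.
- exact: smooth_near_differentiable.
Qed.

Lemma metric_unit : g c p \in unitmx.
Proof.
have [_ h] := mg; have [_ pd] := h c p Xc ip0 cp.
by rewrite unitmxE unitfE gt_eqF//; apply: posdef_det_gt0.
Qed.

Lemma christoffelE k i j : christoffel g c k i j p = chr gc k i j x.
Proof.
rewrite /christoffel /chr /gc /x (cinvK Xc cp).
congr (_ * _); apply: eq_bigr => l _.
have E i' j' k' : dcoord k' (fun q => g c q i' j') c p =
  'D_(e_ k') (fun y => g c (cinv c y) i' j' : R^o) (cmap c p).
  by apply: dcoordE; [exact: (metric_smooth_near mg Xc cp ip0)|near=> y].
by rewrite !E.
Unshelve. all: by end_near. Qed.

End AtPoint2.

Section AtPoint3.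
Variables (g : @tensor2 R T m) (c : chart R T m) (p : T).
Hypotheses (mg : is_metric X g) (Xc : atlas X c) (cp : cdom c p) (ip0 : inter X p).
Let gc (y : rV) := g c (cinv c y).
Let x := cmap c p.

Lemma smooth_near_chr k i j : smooth_near x (chr gc k i j).
Proof.
have [V [oV Vx sV]] := smooth_mx_near_open (metric_smooth_near mg Xc cp ip0).
have nu : \forall y \near x, gc y \in unitmx.
  apply: filterS (inter_near Xc cp ip0) => y [_ h1 h2 _].
  exact: metric_unit mg Xc h2 h1.
have [U [oU Ux h]] := near_open (filterI nu (open_nbhs_nbhs (conj oV Vx))).
apply: (smooth_open_near oU Ux); apply: smooth_chr oU _ _ => [i' j'|y /h[]//].
by apply: smooth_open_sub (sV i' j') => y /h[].
Qed.

Lemma riemannE l k i j : riemann g c l k i j p =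
  'D_(e_ i) (chr gc l j k : rV -> R^o) x - 'D_(e_ j) (chr gc l i k : rV -> R^o) x
  + \sum_q (chr gc l i q x * chr gc q j k x - chr gc l j q x * chr gc q i k x).
Proof.
have E a b b' i' : dcoord i' (christoffel g c a b b') c p = 'D_(e_ i') (chr gc a b b' : rV -> R^o) x.
  apply: (dcoordE Xc cp _ (smooth_near_chr a b b')).
  apply: filterS (inter_near Xc cp ip0) => y [_ h1 h2 h3].
  by rewrite (christoffelE mg Xc h2 h1) h3.
rewrite /riemann !E; congr (_ + _); apply: eq_bigr => q _.
by rewrite !(christoffelE mg Xc cp ip0).
Qed.

(** For constant [v] and [w] the derivatives fall on the Christoffel symbols only; [t1] to [t4] are
    the four kinds of terms of the index formula contracted with these vectors. *)
Lemma curv_vec_riemann v w : curv_vec (chr gc) v w x =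
  \row_l \sum_k \sum_i \sum_j
      riemann g c l k i j p * v ord0 i * w ord0 j * w ord0 k.
Proof.
have dchr k i j : differentiable (chr gc k i j : rV -> R^o) x.
  exact: smooth_near_differentiable (smooth_near_chr k i j).
have dctr u a b : Dr u (fun y => ctr (chr gc) y a b) x = ctr (Dcoef u (chr gc)) x a b.
  apply: (etrans (Dr_ctr u dchr (@diff_row_cst _ _ a _) (@diff_row_cst _ _ b _))).
  by rewrite !Dr_cst -(scale0r (0 : rV)) ctrZl ctrZr !scale0r !addr0.
rewrite curv_vecE !dctr; apply/rowP => l.
have DE u a b : Dcoef u (chr gc) l a b x = \sum_i u ord0 i * 'D_(e_ i) (chr gc l a b : rV -> R^o) x.
  exact: derive_sum_partial.
have t1 : ctr (Dcoef v (chr gc)) x w w ord0 l =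
   \sum_k \sum_i \sum_j 'D_(e_ i) (chr gc l j k : rV -> R^o) x * v ord0 i * w ord0 j * w ord0 k.
  rewrite mxE exchange_big; apply: eq_bigr => k _; rewrite exchange_big; apply: eq_bigr => j _ /=.
  rewrite DE !mulr_suml; apply: eq_bigr => i _; move: ('D__ _ _) => a; ring.
have t2 : ctr (Dcoef w (chr gc)) x v w ord0 l =
   \sum_k \sum_i \sum_j 'D_(e_ j) (chr gc l i k : rV -> R^o) x * v ord0 i * w ord0 j * w ord0 k.
  rewrite mxE exchange_big; apply: eq_bigr => k _; apply: eq_bigr => i _ /=.
  rewrite DE !mulr_suml; apply: eq_bigr => j _; move: ('D__ _ _) => a; ring.
have t3 : ctr (chr gc) x v (ctr (chr gc) x w w) ord0 l =
   \sum_k \sum_i \sum_j (\sum_q chr gc l i q x * chr gc q j k x) * v ord0 i * w ord0 j * w ord0 k.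
  rewrite mxE exchange_big /=.
  transitivity (\sum_q \sum_i \sum_j \sum_k chr gc l i q x * chr gc q j k x * v ord0 i * w ord0 j * w ord0 k).
    apply: eq_bigr => q _; apply: eq_bigr => i _; rewrite mxE mulr_sumr; apply: eq_bigr => j _.
    by rewrite mulr_sumr; apply: eq_bigr => k _; ring.
  rewrite exchange_sum4; apply: eq_bigr => k _; apply: eq_bigr => i _; apply: eq_bigr => j _.
  by rewrite !mulr_suml.
have t4 : ctr (chr gc) x w (ctr (chr gc) x v w) ord0 l =
   \sum_k \sum_i \sum_j (\sum_q chr gc l j q x * chr gc q i k x) * v ord0 i * w ord0 j * w ord0 k.
  rewrite mxE exchange_big /=.
  transitivity (\sum_q \sum_j \sum_i \sum_k chr gc l j q x * chr gc q i k x * v ord0 i * w ord0 j * w ord0 k).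
    apply: eq_bigr => q _; apply: eq_bigr => j _; rewrite mxE mulr_sumr; apply: eq_bigr => i _.
    by rewrite mulr_sumr; apply: eq_bigr => k _; ring.
  rewrite exchange_sum4; apply: eq_bigr => k _; rewrite exchange_big.
  apply: eq_bigr => i _; apply: eq_bigr => j _.
  by rewrite !mulr_suml.
have aD (a b : rV) : (a + b) ord0 l = a ord0 l + b ord0 l by rewrite mxE.
have aN (a : rV) : (- a) ord0 l = - a ord0 l by rewrite mxE.
apply: (etrans (aD _ _)); rewrite aN aD aD aN t1 t2 t3 t4 [RHS]mxE.
rewrite -!sumrB -!big_split -sumrB; apply: eq_bigr => k _ /=.
rewrite -!sumrB -!big_split -sumrB; apply: eq_bigr => i _ /=.
rewrite -!sumrB -!big_split -sumrB; apply: eq_bigr => j _ /=.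
rewrite riemannE sumrB.
move: ('D__ _ _) => a; move: ('D__ _ _) => b.
by ring.
Qed.

Lemma sectional_hyp v w : sectional g c p v w = -1 -> hyp_eq gc v w x.
Proof.
rewrite /sectional -curv_vec_riemann /hyp_eq.
have -> : gc x = g c p by rewrite /gc /x (cinvK Xc cp).
set a := ip _ _ _; set b := (X in a / X).
(* Division by zero yields 0, so the value -1 excludes a vanishing denominator. *)
have [->|b0] := eqVneq b 0; first by rewrite invr0 mulr0 => /eqP; rewrite eq_sym oppr_eq0 oner_eq0.
by move=> h; rewrite -[a](divfK b0) h mulN1r.
Qed.

Lemma hyp_sectional v w : hyp_eq gc v w x ->
  ip (g c p) v v * ip (g c p) w w - ip (g c p) v w ^+ 2 != 0 -> sectional g c p v w = -1.
Proof.
rewrite /sectional -curv_vec_riemann /hyp_eq.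
have -> : gc x = g c p by rewrite /gc /x (cinvK Xc cp).
by move=> -> h; rewrite mulNr divff.
Qed.

End AtPoint3.
End Sectional.

(** * Maps preserving the boundary *)

Section BoundaryMaps.
Context {R : realType} {T : topologicalType} {m : nat} (X : oriented_mfd R T m).
Local Notation rV := 'rV[R]_m.+1.
Local Notation e_ i := (delta_mx ord0 i : rV).
Local Notation o0 := (@ord0 m).
Implicit Types (c d e : chart R T m) (p q : T) (W U V : set T) (phi psi : T -> T)
  (x y v w : rV) (F : rV -> R) (g h : @tensor2 R T m) (A B : rV -> 'M[R]_m.+1)
  (rho : T -> R).

(* The identity, whose Jacobians are those of the changes of charts, is such a map. *)
Definition bmap phi : Prop :=
  [/\ smooth_self X phi, (forall q, bdry X (phi q) <-> bdry X q) &
      forall c d q, atlas X c -> atlas X d -> cdom c q -> cdom d (phi q) ->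
        0 < \det (jac phi c d q)].

Lemma bmap_id : bmap id.
Proof.
split=> //; first exact: smooth_self_id.
by move=> c d q Xc Xd cq dq; exact: (atlas_oriented Xc Xd).
Qed.

Lemma bmap_inter phi q : bmap phi -> inter X (phi q) <-> inter X q.
Proof. by case=> _ h _; split=> n1 n2; apply: n1; exact/h. Qed.

Lemma bmap_near phi q W : bmap phi -> (\forall z \near phi q, W z) -> \forall z \near q, W (phi z).
Proof. by case=> -[cphi _] _ _ Wq; exact: (cphi q W Wq). Qed.

Lemma jac_unit phi c d q : bmap phi -> atlas X c -> atlas X d -> cdom c q -> cdom d (phi q) ->
  jac phi c d q \in unitmx.
Proof.
by move=> [_ _ dp] Xc Xd cq dq; rewrite unitmxE unitfE gt_eqF//; exact: dp.
Qed.

(** The relation g' = phi^* g on the interior, for all pairs of charts, whereas [pull_tensor2] fixes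
    the target chart. It also covers pairs obtained by inverting a pull-back. *)
Definition related phi g g' : Prop := forall c d q, atlas X c -> atlas X d -> inter X q ->
  cdom c q -> cdom d (phi q) ->
  g' c q = (jac phi c d q)^T *m g d (phi q) *m jac phi c d q.

(** A zero denominator would make the quotient 0 instead of -1. The nonvanishing so obtained is
    transported by the isometry in [hyperbolic_pull], in place of a Cauchy-Schwarz argument. *)
Lemma sectional_denominator g c p v w : sectional g c p v w = -1 ->
  ip (g c p) v v * ip (g c p) w w - ip (g c p) v w ^+ 2 != 0.
Proof.
rewrite /sectional; move=> h; apply/negP => /eqP b0.
by move: h; rewrite /= b0 invr0 mulr0 => /eqP; rewrite eq_sym oppr_eq0 oner_eq0.
Qed.

Lemma row_free_push v w (J : 'M[R]_m.+1) : J \in unitmx -> row_free (col_mx v w) ->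
  row_free (col_mx (v *m J) (w *m J)).
Proof.
move=> uJ; rewrite -mul_col_mx /row_free => /eqP h; apply/eqP.
by rewrite mxrankMfree ?row_free_unit.
Qed.

(** In charts [phi] extends to a map [F] that is an isometry between the coordinate matrices of [g']
    and [g], so [push_curv] applies; dividing by the transported denominator recovers the sectional
    curvature. *)
Lemma hyperbolic_pull phi g g' U : bmap phi -> is_metric X g -> is_metric X g' ->
  related phi g g' -> hyperbolic_on X U g -> hyperbolic_on X (phi @^-1` U) g'.
Proof.
move=> bphi mg mg' rel hyp c p v w Xc Up ip0 cp rf.
have [Xd dp] := chart_at_atlas X (phi p); set d := chart_at X (phi p) in Xd dp.
have iq : inter X (phi p) by exact/(bmap_inter _ bphi).
have sphi : smooth_self X phi by case: bphi.
have [F hF] := map_ext sphi Xc Xd cp dp.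
pose x := cmap c p; pose A y := g' c (cinv c y); pose B y := g d (cinv d y).
have hx : halfspace x by exact: chart_halfspace Xc cp.
have Fx : F x = cmap d (phi p).
  by apply/rowP => i; rewrite -(hextE hx (hF i)) /x (cinvK Xc cp).
have sB : smooth_mx_near (cmap d (phi p)) B := metric_smooth_near mg Xd dp iq.
have sA : smooth_mx_near x A := metric_smooth_near mg' Xc cp ip0.
have [V1 [oV1 V1x sV1]] := smooth_mx_near_open sB.
have [V2 [oV2 V2x sV2]] := smooth_mx_near_open sA.
have [ O' [oO' O'x hO']] := near_open (filterI (inter_near Xd dp iq) (open_nbhs_nbhs (conj oV1 V1x))).
have nF : \forall y \near x, forall i, halfspace y -> cmap d (phi (cinv c y)) ord0 i = F y ord0 i.
  by apply: near_forall => i; have [] := hF i.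
have nsF : \forall y \near x, forall i s, differentiable (iter_partial s (fun y => F y ord0 i : R^o)) y.
  by apply: near_forall => i; have [] := hF i.
have nd : \forall q \near p, cdom d (phi q).
  by apply: (bmap_near bphi); apply: open_nbhs_nbhs; split=> //; exact: open_cdom Xd.
have nO' : \forall y \near x, O' (F y).
  have [dF _] := @differentiable_rV R m F x (fun i => smooth_near_differentiable (hF i).1).
  by apply: (differentiable_continuous dF); rewrite Fx; exact: open_nbhs_nbhs.
have nJ : \forall y \near x, forall i j, halfspace y -> jac phi c d (cinv c y) i j = 'D_(e_ j) (fun y => F y ord0 i : R^o) y.
  apply: near_forall => i; apply: near_forall => j.
  by have [] := jac_hext Xc cp i j hF.
have [V3 [oV3 V3x hV3]] := near_open (filterI (filterI nF nsF) (filterI nO' nJ)).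
have [V4 [oV4 V4x hV4]] := near_open (filterI (inter_near Xc cp ip0) (chart_near Xc cp nd)).
(* A neighbourhood where all local identities hold at once, as [push_curv] works on open sets. *)
pose O := V2 `&` V3 `&` V4.
have oO : open O by do 2 apply: openI => //.
have Ox : O x by [].
have dF y : O y -> forall i, differentiable (fun y => F y ord0 i : R^o) y.
  by move=> [[_ /hV3[[_ h] _]] _] i; exact: (h i [::]).
have DrE u y : O y -> Dr u F y = u *m (jac phi c d (cinv c y))^T.
  move=> Oy; have [[_ /hV3[_ [_ hJ]]] /hV4[[hy _ _ _] _]] := Oy.
  apply/rowP => i; rewrite [LHS]mxE (derive_sum_partial _ (dF y Oy i)) [RHS]mxE.
  by apply: eq_bigr => j _; rewrite [_^T _ _]mxE hJ.
have Fy y : O y -> F y = cmap d (phi (cinv c y)).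
  move=> [[_ /hV3[[hF1 _] _]] /hV4[[hy _ _ _] _]].
  by apply/rowP => i; rewrite hF1.
have dom y : O y -> [/\ inter X (cinv c y), cdom c (cinv c y) & cdom d (phi (cinv c y))].
  move=> [_ /hV4[[hy iy cy _] h]]; split=> //; by have [] := h hy.
have AB y : O y -> A y = (jac phi c d (cinv c y))^T *m B (F y) *m jac phi c d (cinv c y).
  move=> Oy; have [iy cy dy] := dom y Oy.
  by rewrite /A (rel c d _ Xc Xd iy cy dy) /B (Fy y Oy) (cinvK Xd dy).
have isom y u u' : O y -> ip (A y) u u' = ip (B (F y)) (Dr u F y) (Dr u' F y).
  by move=> Oy; rewrite !DrE// AB// /ip trmx_mul trmxK !mulmxA.
have push := @push_curv R m O O' oO oO' F A B.
have E : Dr (curv_vec (chr A) v w x) F x = curv_vec (chr B) (Dr v F x) (Dr w F x) (F x).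
  apply: push => //.
  - by move=> y [[_ /hV3[_ []]]].
  - by move=> i s y [[_ /hV3[[_ h] _]] _]; exact: h.
  - by move=> i j; apply: smooth_open_sub (sV2 i j) => y [[]].
  - by move=> i j; apply: smooth_open_sub (sV1 i j) => y /hO'[].
  - by move=> y /dom[iy cy _]; exact: (metric_unit mg' Xc cy iy).
  - by move=> y /hO'[[_ iy cy _] _]; exact: (metric_unit mg Xd cy iy).
  - by move=> y /dom[iy cy _]; case: mg' => _ h; have [] := h c _ Xc iy cy.
  - by move=> y /hO'[[_ iy cy _] _]; case: mg => _ h; have [] := h d _ Xd iy cy.
  - move=> y u Oy; have [iy cy dy] := dom y Oy.
    have uJ := jac_unit bphi Xc Xd cy dy.
    exists (u *m invmx (jac phi c d (cinv c y))^T); rewrite DrE//.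
    by rewrite mulmxKV// unitmx_tr.
have uJ := jac_unit bphi Xc Xd cp dp.
have xp : cinv c x = p by rewrite /x (cinvK Xc cp).
have VE u : Dr u F x = u *m (jac phi c d p)^T by rewrite DrE// xp.
have BE : B (F x) = g d (phi p) by rewrite Fx /B (cinvK Xd dp).
have AE : A x = g' c p by rewrite /A xp.
have sec : sectional g d (phi p) (Dr v F x) (Dr w F x) = -1.
  apply: hyp => //; rewrite !VE; apply: row_free_push => //.
  by rewrite unitmx_tr.
have den := sectional_denominator sec.
apply: (hyp_sectional mg' Xc cp ip0); last by rewrite -AE !isom// BE.
have := sectional_hyp mg Xd dp iq sec; rewrite /hyp_eq -Fx => h.
by rewrite isom// E h !isom.
Qed.

End BoundaryMaps.

(** * Local defining functions and Jacobians at the boundary *)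

Section DefiningFunctions.
Context {R : realType} {T : topologicalType} {m : nat} (X : oriented_mfd R T m).
Local Notation rV := 'rV[R]_m.+1.
Local Notation e_ i := (delta_mx ord0 i : rV).
Local Notation o0 := (@ord0 m).
Implicit Types (c d e : chart R T m) (p q : T) (W U V : set T) (phi psi : T -> T)
  (x y v w : rV) (F : rV -> R) (g h s : @tensor2 R T m) (A B : rV -> 'M[R]_m.+1)
  (rho : T -> R).

(** The reference defining function: its value is the coordinate t of the computation for metrics
    with a double pole. *)
Definition crho c : T -> R := fun q => cmap c q ord0 o0.

Lemma row_neq0_of_det (J : 'M[R]_m.+1) i : \det J != 0 -> row i J != 0.
Proof.
apply: contraNN => /eqP r0; rewrite (expand_det_row _ i); apply/eqP; apply: big1 => j _.
by have := congr1 (fun z : rV => z ord0 j) r0; rewrite !mxE => ->; rewrite mul0r.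
Qed.

Lemma drho_crho_row c d p : drho (crho c) d p = row o0 (jac id d c p).
Proof. by apply/rowP => i; rewrite !mxE. Qed.

Lemma crho_local c : atlas X c -> local_def X (cdom c) (crho c).
Proof.
move=> Xc; split.
- exact: open_cdom Xc.
- move=> d Xd; have := atlas_smooth Xd Xc o0.
  by rewrite setTI setIC.
- by move=> p cp; exact: (chart_halfspace Xc cp).
- by move=> p cp; exact: (bdry_cmap Xc cp).
- move=> d p Xd cp _ dp; rewrite drho_crho_row; apply: row_neq0_of_det.
  by rewrite gt_eqF//; exact: (atlas_oriented Xd Xc).
Qed.

Lemma drho_crho c p : atlas X c -> cdom c p -> drho (crho c) c p = e_ o0.
Proof. by move=> Xc cp; rewrite drho_crho_row (jac_id Xc cp) rowE mulmx1. Qed.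

Lemma open_near_set V p : open V -> V p -> \forall q \near p, V q.
Proof. by move=> oV Vp; exact: open_nbhs_nbhs. Qed.

Lemma local_def_hext U rho c p : local_def X U rho -> atlas X c -> U p -> cdom c p ->
  exists F, hext (cmap c p) (fun y => rho (cinv c y)) F.
Proof.
by move=> [oU sr _ _ _] Xc Up cp; exact: (smooth_on_hext Xc cp (open_near_set oU Up) (sr c Xc)).
Qed.

(** Tangential derivatives vanish since [rho] is zero along the boundary; the normal one is
    nonnegative because [rho] is, and nonzero because d rho is. The same number [u] is the limit of
    rho / t on the normal path. *)
Lemma drho_bdry U rho c p : local_def X U rho -> atlas X c -> U p -> bdry X p -> cdom c p ->
  exists u, [/\ 0 < u, drho rho c p = u *: e_ o0 &
    t^-1 * rho (bpath c p t) @[t --> (0 : R)^'+] --> u].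
Proof.
move=> ld Xc Up bp cp; have [F hF] := local_def_hext ld Xc Up cp.
have [oU _ r0 rb dr] := ld.
have nU := open_near_set oU Up.
exists (partial o0 (fun y => rho (cinv c y)) (cmap c p)).
have rp : rho p = 0 by exact/(rb p Up).
have nb : \forall q \near p, bdry X q -> rho q = 0.
  by apply: filterS nU => q Uq /(rb q Uq).
have n0 : \forall q \near p, 0 <= rho q by apply: filterS nU => q Uq; exact: r0.
have E : drho rho c p = partial o0 (fun y => rho (cinv c y)) (cmap c p) *: e_ o0.
  apply/rowP => i; rewrite [LHS]mxE [RHS]mxE [in RHS]mxE eqxx /=.
  case: (unliftP o0 i) => [j ->|->]; last by rewrite eqxx mulr1.
  by rewrite (partial_tangential Xc cp bp j hF nb) mulr0.
split=> //; last exact: (partial_normal Xc cp hF rp).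
rewrite lt_neqAle (partial_normal_ge0 Xc cp bp hF rp n0) andbT eq_sym.
apply/negP => /eqP h; move: (dr c p Xc Up bp cp).
by rewrite E h scale0r eqxx.
Qed.

Lemma hext_smooth_on c W (f : rV -> R) : (forall p, W p -> cdom c p -> exists F, hext (cmap c p) f F) ->
  atlas X c -> smooth_on (cmap c @` (W `&` cdom c)) f.
Proof.
move=> h Xc _ [p [Wp cp] <-]; have [F [sF fF]] := h p Wp cp.
have [D [oD Dx hO]] := near_open (filterI sF fF).
exists D, F; split=> //.
  by move=> s y /hO[hs _]; exact: hs.
move=> y /hO[_ h1] [q [_ cq] qy]; rewrite h1// -qy.
exact: chart_halfspace Xc cq.
Qed.

Lemma local_def_pull phi U rho : bmap X phi -> local_def X U rho ->
  local_def X (phi @^-1` U) (rho \o phi).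
Proof.
move=> bphi ld; have [oU sr r0 rb dr] := ld; have [sphi bp dj] := bphi.
have hx c p : atlas X c -> U (phi p) -> cdom c p ->
    exists F, hext (cmap (chart_at X (phi p)) (phi p)) (fun y => rho (cinv (chart_at X (phi p)) y)) F.
  move=> Xc Up cp; have [Xd dp] := chart_at_atlas X (phi p).
  exact: local_def_hext ld Xd Up dp.
split.
- by apply: open_comp => // p _; exact: sphi.1.
- move=> c Xc; apply: hext_smooth_on => // p Up cp.
  have [Xd dp] := chart_at_atlas X (phi p).
  have [F hF] := hx c p Xc Up cp.
  exact: (hext_comp_ex sphi Xc Xd cp dp hF).
- by move=> p; exact: r0.
- by move=> p Up; rewrite -(rb (phi p) Up); split=> /bp.
- move=> c p Xc Up bp0 cp; have [Xd dp] := chart_at_atlas X (phi p).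
  have [F hF] := hx c p Xc Up cp.
  rewrite (drho_comp sphi Xc Xd cp dp hF).
  have dn0 : drho rho (chart_at X (phi p)) (phi p) != 0 by apply: dr => //; exact/bp.
  apply: contraNN dn0 => /eqP h; have uJ := jac_unit bphi Xc Xd cp dp.
  by rewrite -[drho rho _ _](mulmxK uJ) h mul0mx.
Qed.

(** The normal coordinate of [phi] is nonnegative and vanishes on the boundary, so the first row of
    the Jacobian is (a, 0, ..., 0) with a >= 0. Its determinant, a times that of [bjac], is
    positive, which forces both factors to be positive. *)
Lemma jac_bdry phi c d p : bmap X phi -> atlas X c -> atlas X d -> bdry X p -> cdom c p ->
  cdom d (phi p) -> (forall j, jac phi c d p o0 (lift o0 j) = 0) /\ 0 < \det (bjac phi c d p).
Proof.
move=> bphi Xc Xd bp cp dp; have [sphi bb dj] := bphi.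
have [F hF] := map_ext sphi Xc Xd cp dp.
have nd : \forall q \near p, cdom d (phi q).
  by apply: (bmap_near bphi); exact: open_near_set (open_cdom Xd) dp.
have f0 : \forall q \near p, bdry X q -> cmap d (phi q) ord0 o0 = 0.
  by apply: filterS nd => q dq bq; apply/(bdry_cmap Xd dq)/bb.
have fge : \forall q \near p, 0 <= cmap d (phi q) ord0 o0.
  by apply: filterS nd => q dq; exact: (chart_halfspace Xd dq).
have J0 j : jac phi c d p o0 (lift o0 j) = 0.
  by rewrite mxE; exact: (partial_tangential (f := fun q => cmap d (phi q) ord0 o0) Xc cp bp j (hF o0) f0).
split=> //; have := dj c d p Xc Xd cp dp; rewrite (det_tangential J0).
have J00 : 0 <= jac phi c d p o0 o0.
  rewrite mxE; apply: (partial_normal_ge0 (f := fun q => cmap d (phi q) ord0 o0) Xc cp bp (hF o0) _ fge).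
  exact: (nbhs_singleton f0 bp).
move: J00; rewrite le_eqVlt => /orP[/eqP <-|J00]; first by rewrite mul0r ltxx.
by rewrite pmulr_rgt0.
Qed.

Lemma bjac_comp phi psi c d e p : bmap X phi -> bmap X psi ->
  atlas X c -> atlas X d -> atlas X e -> bdry X p -> cdom c p -> cdom d (phi p) -> cdom e (psi (phi p)) ->
  bjac (psi \o phi) c e p = bjac psi d e (phi p) *m bjac phi c d p.
Proof.
move=> bphi bpsi Xc Xd Xe bp cp dp ep.
have [sphi _ _] := bphi; have [spsi _ _] := bpsi.
rewrite /bjac (jac_comp sphi spsi Xc Xd Xe cp dp ep) tangential_mul//.
by have [] := jac_bdry bphi Xc Xd bp cp dp.
Qed.

End DefiningFunctions.

(** * The cocycle in terms of boundary values *)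

Section BoundaryData.
Context {R : realType} {T : topologicalType} {m : nat} (X : oriented_mfd R T m).
Local Notation rV := 'rV[R]_m.+1.
Local Notation e_ i := (delta_mx ord0 i : rV).
Local Notation o0 := (@ord0 m).
Implicit Types (c d e : chart R T m) (p q : T) (W U V : set T) (phi psi : T -> T)
  (x y v w : rV) (F : rV -> R) (g h s t : @tensor2 R T m) (A B : rV -> 'M[R]_m.+1)
  (rho : T -> R).

Lemma smooth_mx_near_inv x (n : nat) (A : rV -> 'M[R]_n) :
  (forall i j, smooth_near x (fun y => A y i j)) -> A x \in unitmx ->
  (\forall y \near x, A y \in unitmx) /\ forall i j, smooth_near x (fun y => invmx (A y) i j).
Proof.
move=> sA uA.
have [V [oV Vx sAV]] := smooth_mx_near_open sA.
have sdet := smooth_open_det oV sAV.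
have cdet := smooth_open_continuous sdet Vx.
have du : \det (A x) != 0 by rewrite -unitfE -unitmxE.
have nu : \forall y \near x, A y \in unitmx.
  by apply: filterS (cvgr_neq0 _ cdet du) => y; rewrite unitmxE unitfE.
split=> // i j.
have [U [oU Ux hU]] := near_open (filterI nu (open_nbhs_nbhs (conj oV Vx))).
apply: (smooth_open_near oU Ux); apply: (smooth_open_inv oU) => [i' j'|y /hU[]//].
by apply: smooth_open_sub (sAV i' j') => y /hU[].
Qed.

Lemma mx_hext_eq x (a b : nat) (A FA : rV -> 'M[R]_(a, b)) :
  (forall i j, hext x (fun y => A y i j) (fun y => FA y i j)) ->
  \forall y \near x, halfspace y -> A y = FA y.
Proof.
move=> hA.
have h : \forall y \near x, forall i j, halfspace y -> A y i j = FA y i j.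
  by apply: near_forall => i; apply: near_forall => j; have [] := hA i j.
by apply: filterS h => y {}h hy; apply/matrixP => i j; exact: h.
Qed.

Lemma hext_invmx x (n : nat) (A FA : rV -> 'M[R]_n) : FA x \in unitmx ->
  (forall i j, hext x (fun y => A y i j) (fun y => FA y i j)) ->
  forall i j, hext x (fun y => invmx (A y) i j) (fun y => invmx (FA y) i j).
Proof.
move=> uF hA i j.
have [_ si] := smooth_mx_near_inv (fun i j => (hA i j).1) uF.
split; first exact: si.
by apply: filterS (mx_hext_eq hA) => y h hy; rewrite h.
Qed.

Lemma hext_trmx x (a b : nat) (A FA : rV -> 'M[R]_(a, b)) :
  (forall i j, hext x (fun y => A y i j) (fun y => FA y i j)) ->
  forall i j, hext x (fun y => (A y)^T i j) (fun y => (FA y)^T i j).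
Proof.
move=> hA i j.
have E (B : rV -> 'M[R]_(a, b)) : (fun y => (B y)^T i j) = (fun y => B y j i).
  by apply/funext => y; rewrite mxE.
by rewrite !E.
Qed.

Lemma smooth_tensor2_hext V t c p : open V -> smooth_tensor2 X V t -> atlas X c -> V p -> cdom c p ->
  exists FT : rV -> 'M[R]_m.+1, forall i j,
    hext (cmap c p) (fun y => t c (cinv c y) i j) (fun y => FT y i j).
Proof.
move=> oV [_ st] Xc Vp cp.
have h i j := smooth_on_hext Xc cp (open_near_set oV Vp) (st c i j Xc).
have /choice[f hf] : forall ij : 'I_m.+1 * 'I_m.+1, exists F, hext (cmap c p) (fun y => t c (cinv c y) ij.1 ij.2) F.
  by move=> [i j]; exact: h.
exists (fun y => \matrix_(i, j) f (i, j) y) => i j.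
have -> : (fun y => (\matrix_(i, j) f (i, j) y) i j) = f (i, j) by apply/funext => y; rewrite mxE.
exact: (hf (i, j)).
Qed.

Lemma smooth_tensor2_sub V V' t : V' `<=` V -> smooth_tensor2 X V t -> smooth_tensor2 X V' t.
Proof.
move=> sub [lt st]; split.
  by move=> c d p Xc Xd Vp; apply: lt => //; exact: sub.
move=> c i j Xc x [p [Vp cp] <-].
have [|D [F [oD Dx sF DF]]] := st c i j Xc (cmap c p).
  by exists p => //; split=> //; exact: sub.
exists D, F; split=> // y Dy [q [Vq cq] qy]; apply: DF => //.
by exists q => //; split=> //; exact: sub.
Qed.

Lemma smooth_tensor2B V t t' : open V -> smooth_tensor2 X V t -> smooth_tensor2 X V t' ->
  smooth_tensor2 X V (fun c p => t c p - t' c p).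
Proof.
move=> oV st st'; split.
  move=> c d p Xc Xd Vp cp dp; rewrite (st.1 c d p)// (st'.1 c d p)//.
  by rewrite mulmxBr mulmxBl.
move=> c i j Xc; apply: (hext_smooth_on (X := X)) => // p Vp cp.
have [FT hT] := smooth_tensor2_hext oV st Xc Vp cp.
have [FT' hT'] := smooth_tensor2_hext oV st' Xc Vp cp.
exists (fun y => FT y i j + -1 * FT' y i j).
have -> : (fun y => (t c (cinv c y) - t' c (cinv c y)) i j) =
  (fun y => t c (cinv c y) i j + cst (-1) y * t' c (cinv c y) i j).
  by apply/funext => y; rewrite !mxE mulN1r.
by apply: hextD => //; apply: hextM => //; exact: hext_cst.
Qed.

(* [gb] extends rho^2 g, and [s] extends rho^-(n-2) (h - g), up to the boundary. *)
Definition is_bdata rho g h V (gb s : @tensor2 R T m) : Prop :=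
  [/\ open V, smooth_tensor2 X V gb, smooth_tensor2 X V s,
   (forall c q, atlas X c -> V q -> inter X q -> cdom c q ->
      [/\ rho q != 0, rho q ^+ 2 *: g c q = gb c q & h c q = g c q + rho q ^+ m.-1 *: s c q]) &
   (forall c q, atlas X c -> V q -> bdry X q -> cdom c q ->
      [/\ (gb c q)^T = gb c q, posdef (gb c q),
          ip (invmx (gb c q)) (drho rho c q) (drho rho c q) = 1 & (s c q)^T = s c q])].

Lemma boundary_ge0 c p (f : T -> R) F : atlas X c -> cdom c p -> bdry X p ->
  hext (cmap c p) (fun y => f (cinv c y)) F -> (\forall q \near p, inter X q -> 0 <= f q) -> 0 <= f p.
Proof.
move=> Xc cp bp hF f0.
have c1 := bpath_hext Xc cp hF.
have pG : \forall t \near (0 : R)^'+, 0 <= f (bpath c p t).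
  by apply: filterS (bpath_near Xc cp bp f0) => t [h1 h2 _ _]; exact: h1.
by have := limr_ge (cvgP _ c1) pG; rewrite (cvg_lim (@Rhausdorff R) c1); exact.
Qed.

(** Both metrics are compared with the base metric g0 of the class: rho^2 (g0 - g) = rho^n s1 and
    rho^2 (g0 - h) = rho^n s2 give h - g = rho^(n-2) (s1 - s2). Symmetry and semidefiniteness on the
    boundary pass to the limit from the interior. *)
Lemma bdata_ex (G : set (@tensor2 R T m)) g h U rho p : asymp_class X G -> (2 <= m)%N -> G g -> G h ->
  local_def X U rho -> U p -> bdry X p ->
  exists V gb s, [/\ V p, V `<=` U & is_bdata rho g h V gb s].
Proof.
move=> [g0 _ hG] m2 /hG[Ag ag] /hG[Ah ah] ld Up bp.
have [oU _ _ rb _] := ld.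
have [[mg ALHg] [mh _]] := (Ag, Ah).
have [gb [sgb egb ugb ngb]] := ALHg U rho ld.
have [V1 [s1 [oV1 V1p V1U ss1 es1]]] := ag U rho ld p Up bp.
have [V2 [s2 [oV2 V2p V2U ss2 es2]]] := ah U rho ld p Up bp.
pose V := V1 `&` V2.
have oV : open V by exact: openI.
have VU : V `<=` U by move=> q [/V1U].
pose s : @tensor2 R T m := fun c q => s1 c q - s2 c q.
have sgb' : smooth_tensor2 X V gb by exact: smooth_tensor2_sub sgb.
have ss : smooth_tensor2 X V s.
  by apply: smooth_tensor2B => //; [apply: smooth_tensor2_sub ss1 => q []|apply: smooth_tensor2_sub ss2 => q []].
have Eint c q : atlas X c -> V q -> inter X q -> cdom c q ->
      [/\ rho q != 0, rho q ^+ 2 *: g c q = gb c q & h c q = g c q + rho q ^+ m.-1 *: s c q].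
  move=> Xc [V1q V2q] iq cq.
  have Uq : U q by exact: V1U.
  have r0 : rho q != 0 by apply/negP => /eqP r0; apply: iq; exact/(rb q Uq).
  split=> //; first by rewrite egb.
  have h1 := es1 c q Xc (conj V1q iq) cq; have h2 := es2 c q Xc (conj V2q iq) cq.
  have r20 : rho q ^+ 2 != 0 by rewrite expf_neq0.
  have e : rho q ^+ 2 *: (h c q - g c q) = rho q ^+ 2 *: (rho q ^+ m.-1 *: s c q).
    rewrite scalerA -exprD (_ : (2 + m.-1)%N = m.+1); last by case: (m) m2.
    rewrite scalerBr /s scalerBr -h1 -h2 /rescale.
    by rewrite opprB [RHS]addrC addrA subrK.
  have := scalerI r20 e => <-; by rewrite addrC subrK.
exists V, gb, s; split=> //; split=> // c q Xc Vq bq cq.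
have nV := open_near_set oV Vq.
have nc : \forall z \near q, cdom c z by exact: open_near_set (open_cdom Xc) cq.
have Uq := VU q Vq.
have [FT hT] := smooth_tensor2_hext oV sgb' Xc Vq cq.
have [FS hS] := smooth_tensor2_hext oV ss Xc Vq cq.
have symg : (gb c q)^T = gb c q.
  apply/matrixP => i j; rewrite mxE.
  apply: (boundary_eq Xc cq bq (f := fun z => gb c z j i) (g := fun z => gb c z i j) (hT j i) (hT i j)).
  apply: filterS2 nV nc => z Vz cz iz; have [_ <- _] := Eint c z Xc Vz iz cz.
  have [sg _] := mg.2 c z Xc iz cz.
  by rewrite -[in LHS]sg !mxE.
split=> //.
- apply: posdef_of_semidef => //; first exact: ugb.
  move=> v; pose f z := (v *m gb c z *m v^T) ord0 ord0.
  have hf : hext (cmap c q) (fun y => f (cinv c y)) (fun y => (v *m FT y *m v^T) ord0 ord0).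
    apply: hext_mulmx => i j; last exact: hext_cst.
    by move: i j; apply: hext_mulmx => // i j; exact: hext_cst.
  apply: (boundary_ge0 Xc cq bq hf).
  apply: filterS2 nV nc => z Vz cz iz; rewrite /f; have [_ <- _] := Eint c z Xc Vz iz cz.
  have [_ pg] := mg.2 c z Xc iz cz.
  have [->|v0] := eqVneq v 0; first by rewrite !mul0mx mxE.
  rewrite -scalemxAr -scalemxAl mxE mulr_ge0 ?sqr_ge0//.
  exact/ltW/pg.
- exact: ngb.
- apply/matrixP => i j; rewrite mxE.
  apply: (boundary_eq Xc cq bq (f := fun z => s c z j i) (g := fun z => s c z i j) (hS j i) (hS i j)).
  apply: filterS2 nV nc => z Vz cz iz; have [r0 _ e] := Eint c z Xc Vz iz cz.
  have [sg _] := mg.2 c z Xc iz cz; have [sh _] := mh.2 c z Xc iz cz.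
  have rm : rho z ^+ m.-1 != 0 by rewrite expf_neq0.
  have e' : rho z ^+ m.-1 *: s c z = h c z - g c z by rewrite e addrC addKr.
  have E : rho z ^+ m.-1 *: s c z = rho z ^+ m.-1 *: (s c z)^T.
    by rewrite -linearZ /= e' linearB /= sg sh.
  by rewrite [in LHS](scalerI rm E) mxE.
Qed.

Section Formula.
Variables (rho : T -> R) (g h : @tensor2 R T m) (V : set T) (gb s : @tensor2 R T m).
Hypothesis D : is_bdata rho g h V gb s.
Hypothesis mg : is_metric X g.
Hypothesis m2 : (2 <= m)%N.
Variables (c : chart R T m) (q : T).
Hypotheses (Xc : atlas X c) (Vq : V q) (bq : bdry X q) (cq : cdom c q).

Let oV : open V. Proof. by case: D. Qed.
Let nVc : \forall z \near q, V z /\ cdom c z.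
Proof.
by apply: filterI; [exact: open_near_set oV Vq|exact: open_near_set (open_cdom Xc) cq].
Qed.
Let Eint z : V z -> inter X z -> cdom c z ->
  [/\ rho z != 0, rho z ^+ 2 *: g c z = gb c z & h c z = g c z + rho z ^+ m.-1 *: s c z].
Proof. by case: D => _ _ _ H _ Vz iz cz; exact: H. Qed.

Lemma bdata_pos : [/\ (gb c q)^T = gb c q, posdef (gb c q), gb c q \in unitmx,
  ip (invmx (gb c q)) (drho rho c q) (drho rho c q) = 1 & (s c q)^T = s c q].
Proof.
case: D => _ _ _ _ /(_ c q Xc Vq bq cq)[h1 h2 h3 h4]; split=> //.
by rewrite unitmxE unitfE gt_eqF//; exact: posdef_det_gt0.
Qed.

Lemma gbar_bdryE : gbar_bdry rho g c q = gb c q.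
Proof.
case: D => _ sgb _ _ _; have [FT hT] := smooth_tensor2_hext oV sgb Xc Vq cq.
apply/matrixP => i j; rewrite mxE.
apply: (bval_hext Xc cq bq (g := fun z => gb c z i j) (hT i j)).
by apply: filterS nVc => z [Vz cz] iz; have [_ <- _] := Eint Vz iz cz.
Qed.

Let mu_tensorE z : V z -> inter X z -> cdom c z -> mu_tensor rho g h c z = s c z.
Proof.
move=> Vz iz cz; have [r0 _ e] := Eint Vz iz cz.
rewrite /mu_tensor e addrC addKr scalerA subSS subn1 mulVf ?scale1r//.
by rewrite expf_neq0.
Qed.

Let mu_traceE z : V z -> inter X z -> cdom c z ->
  mu_trace rho g h c z = \tr (invmx (gb c z) *m s c z).
Proof.
move=> Vz iz cz; have [r0 e1 _] := Eint Vz iz cz.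
have r20 : rho z ^+ 2 != 0 by rewrite expf_neq0.
have ug := metric_unit mg Xc cz iz.
rewrite /mu_trace mu_tensorE// -e1 invmxZ; last by rewrite unitmxZ ?unitfE.
by rewrite -scalemxAl mxtraceZ.
Qed.

Let trace_hext : exists F, hext (cmap c q) (fun y => \tr (invmx (gb c (cinv c y)) *m s c (cinv c y))) F.
Proof.
case: D => _ sgb ss _ _; have [FT hT] := smooth_tensor2_hext oV sgb Xc Vq cq.
have [FS hS] := smooth_tensor2_hext oV ss Xc Vq cq.
have hx := chart_halfspace Xc cq.
have FTx : FT (cmap c q) = gb c q.
  by apply/matrixP => i j; rewrite -(hextE hx (hT i j)) (cinvK Xc cq).
have [_ _ ug _ _] := bdata_pos.
have hi := hext_invmx (A := fun y => gb c (cinv c y)) (FA := FT) _ hT.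
exists (fun y => \sum_i (invmx (FT y) *m FS y) i i).
apply: hext_sum => i.
apply: (hext_mulmx (A := fun y => invmx (gb c (cinv c y))) (B := fun y => s c (cinv c y))).
  by apply: hi; rewrite FTx.
exact: hS.
Qed.

Lemma mu_trace_bval : bval c (mu_trace rho g h c) q = \tr (invmx (gb c q) *m s c q).
Proof.
have [F hF] := trace_hext.
apply: (bval_hext Xc cq bq (g := fun z => \tr (invmx (gb c z) *m s c z)) hF).
by apply: filterS nVc => z [Vz cz] iz; rewrite mu_traceE.
Qed.

Lemma mu_tracefree_bval : bval_mx c (mu_tracefree rho g h c) q =
  s c q - (m.+1%:R^-1 * \tr (invmx (gb c q) *m s c q)) *: gb c q.
Proof.
case: D => _ sgb ss _ _; have [FT hT] := smooth_tensor2_hext oV sgb Xc Vq cq.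
have [FS hS] := smooth_tensor2_hext oV ss Xc Vq cq.
have [F hF] := trace_hext.
apply/matrixP => i j; rewrite mxE.
pose f z : R := s c z i j + (- m.+1%:R^-1) * \tr (invmx (gb c z) *m s c z) * gb c z i j.
have hf : hext (cmap c q) (fun y => f (cinv c y)) (fun y => FS y i j + (- m.+1%:R^-1) * F y * FT y i j).
  apply: hextD => //; apply: hextM => //; apply: hextM => //; exact: hext_cst.
have -> : (s c q - (m.+1%:R^-1 * \tr (invmx (gb c q) *m s c q)) *: gb c q) i j = f q.
  by rewrite !mxE /f !mulNr.
apply: (bval_hext Xc cq bq hf).
apply: filterS nVc => z [Vz cz] iz; have [r0 e1 _] := Eint Vz iz cz.
rewrite /mu_tracefree mu_tensorE// mu_traceE// /f -e1 !mxE; ring.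
Qed.

(** This is where the weights 1/n and 1/2 fit together. Removing the trace adds tr / n to the second
    term, since the normal has length 1, and (n^2 - 1)/(2n) + 1/(2n) = n/2. *)
Lemma cocycleE gam : cocycle rho g h gam c q =
  kval (gb c q) (s c q) (drho rho c q) *: (tractor_X : @triple R m).
Proof.
have [sg pg ug ng sS] := bdata_pos.
have n0 : m.+1%:R != 0 :> R by rewrite pnatr_eq0.
rewrite /cocycle /c1 /c2 mu_trace_bval mu_tracefree_bval gbar_bdryE.
rewrite /vol_infty /sigma_infty /gbar_infty gbar_bdryE.
set A := gb c q in sg pg ug ng *; set M := s c q; set r := drho rho c q.
rewrite !scalerA -scalerDl; congr (_ *: _).
set t := \tr (invmx A *m M).
set M0 := M - _ *: A.
have sumE : \sum_i \sum_j \sum_k \sum_l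
        invmx A i j * invmx A k l * r ord0 i * r ord0 k * M0 j l = ip M0 (r *m invmx A) (r *m invmx A).
  rewrite ipE exchange_big; apply: eq_bigr => j _ /=.
  transitivity (\sum_i \sum_l \sum_k invmx A i j * invmx A k l * r ord0 i * r ord0 k * M0 j l).
    by apply: eq_bigr => i _; rewrite exchange_big.
  rewrite exchange_big; apply: eq_bigr => l _ /=.
  have rE j' : (r *m invmx A) ord0 j' = \sum_i r ord0 i * invmx A i j' by rewrite mxE.
  rewrite !rE -mulrA mulr_suml mulr_sumr; apply: eq_bigr => i _.
  by rewrite !mulr_sumr; apply: eq_bigr => k _; ring.
have nA : ip A (r *m invmx A) (r *m invmx A) = 1.
  rewrite /ip trmx_mul trmx_inv sg -(mulmxA _ _ A) mulVmx// mulmx1.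
  by rewrite mulmxA.
have M0E w : ip M0 w w = ip M w w - m.+1%:R^-1 * t * ip A w w.
  by rewrite /M0 ip_mxD -scaleNr ip_mxZ mulNr.
rewrite sumE M0E nA /kval -/t /vol_density.
have -> : ((m.+1 ^ 2 - 1)%:R : R) = m.+1%:R ^+ 2 - 1.
  by rewrite natrB ?expn_gt0// natrX.
have alg (a b k z t' : R) : k != 0 ->
  k^-1 * ((k ^+ 2 - 1) / 2 * a * t' * b) + 2^-1 * (- (z - k^-1 * t' * 1) * a * b) =
  a * b * (2^-1 * (k * t' - z)).
  by move=> k0; field.
exact: alg.
Qed.

End Formula.
End BoundaryData.

(** * Independence of the defining function and of the hyperbolic metric *)

Section Invariance.
Context {R : realType} {T : topologicalType} {m : nat} (X : oriented_mfd R T m).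
Variables (G : set (@tensor2 R T m)) (hG : asymp_class X G) (m2 : (2 <= m)%N).
Local Notation rV := 'rV[R]_m.+1.
Local Notation e_ i := (delta_mx ord0 i : rV).
Local Notation o0 := (@ord0 m).
Implicit Types (c d e : chart R T m) (p q : T) (W U V : set T) (phi psi : T -> T)
  (x y v w : rV) (F : rV -> R) (g h s t : @tensor2 R T m) (A B : rV -> 'M[R]_m.+1)
  (rho : T -> R).

Let m0 : (0 < m)%N. Proof. exact: leq_trans m2. Qed.

Lemma G_metric g : G g -> is_metric X g.
Proof. by case: hG => g0 _ h /h[[]]. Qed.

Lemma cvg_expr (F : set_system R) (r : R -> R) (k : R) n :
  r u @[u --> F] --> k -> r u ^+ n @[u --> F] --> k ^+ n.
Proof.
move=> rk; have c := @exprn_continuous R n k.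
exact: (@cvg_comp _ _ _ r (fun a => a ^+ n) _ _ _ rk c).
Qed.

Lemma bdata_near rho g h V gb s c p : is_bdata X rho g h V gb s -> atlas X c -> V p -> cdom c p ->
  \forall z \near p, inter X z ->
   [/\ cdom c z, rho z != 0, rho z ^+ 2 *: g c z = gb c z & h c z = g c z + rho z ^+ m.-1 *: s c z].
Proof.
move=> [oV _ _ E _] Xc Vp cp.
apply: filterS2 (open_near_set oV Vp) (open_near_set (open_cdom Xc) cp) => z Vz cz iz.
by have [h1 h2 h3] := E c z Xc Vz iz cz.
Qed.

(* Both sides are compared along the paths [bpath], where [rho] = [r] [rho']. *)
Lemma bdata_compare rho rho' g h V V' gb gb' s s' c p (r : R -> R) (k : R) :
  is_bdata X rho g h V gb s -> is_bdata X rho' g h V' gb' s' ->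
  atlas X c -> V p -> V' p -> cdom c p -> bdry X p ->
  (\forall t \near (0 : R)^'+, rho (bpath c p t) = r t * rho' (bpath c p t)) ->
  r t @[t --> (0 : R)^'+] --> k -> k != 0 ->
  gb c p = k ^+ 2 *: gb' c p /\ s c p = (k ^+ m.-1)^-1 *: s' c p.
Proof.
move=> D D' Xc Vp V'p cp bp hr rk k0.
have [oV sgb ss _ _] := D; have [oV' sgb' ss' _ _] := D'.
have [F1 h1] := smooth_tensor2_hext oV sgb Xc Vp cp.
have [F2 h2] := smooth_tensor2_hext oV ss Xc Vp cp.
have [F1' h1'] := smooth_tensor2_hext oV' sgb' Xc V'p cp.
have [F2' h2'] := smooth_tensor2_hext oV' ss' Xc V'p cp.
have nb := bpath_near Xc cp bp (@filterI _ _ (nbhs_filter p) _ _ (bdata_near D Xc Vp cp) (bdata_near D' Xc V'p cp)).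
split; apply/matrixP => i j; rewrite mxE.
- have U1 := boundary_unique Xc cp (k := k ^+ 2) (r := fun t : R => r t ^+ 2) (f := fun z => gb c z i j) (g := fun z => gb' c z i j) (h1 i j) (h1' i j).
  apply: U1.
    apply: filterS2 hr nb => t rt [[e1 e2] it _ _].
    have [_ _ <- _] := e1 it; have [_ _ <- _] := e2 it.
    by rewrite rt !mxE; ring.
  exact: cvg_expr.
- have U2 := boundary_unique Xc cp (k := (k ^+ m.-1)^-1) (r := fun t : R => (r t ^+ m.-1)^-1) (f := fun z => s c z i j) (g := fun z => s' c z i j) (h2 i j) (h2' i j).
  apply: U2.
    apply: filterS2 hr nb => t rt [[e1 e2] it _ _].
    have [_ r0 _ E1] := e1 it; have [_ r0' _ E2] := e2 it.
    have rn : rho (bpath c p t) ^+ m.-1 != 0 by rewrite expf_neq0.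
    have rtn : r t != 0 by apply: contraNneq r0 => rt0; rewrite rt rt0 mul0r.
    have e : rho (bpath c p t) ^+ m.-1 *: s c (bpath c p t) = rho' (bpath c p t) ^+ m.-1 *: s' c (bpath c p t).
      by apply: (addrI (g c (bpath c p t))); rewrite -E1 -E2.
    have := congr1 (fun B : 'M[R]_m.+1 => B i j) e; rewrite !mxE rt exprMn => e'.
    have rn' : rho' (bpath c p t) ^+ m.-1 != 0 by rewrite expf_neq0.
    have rtm : r t ^+ m.-1 != 0 by rewrite expf_neq0.
    apply: (mulfI rn'); apply: (mulfI rtm); rewrite [LHS]mulrA e'.
    by field.
  apply: cvgV; first by rewrite expf_neq0.
  exact: cvg_expr.
Qed.

Lemma crho_bpath c p : atlas X c -> cdom c p -> bdry X p ->
  \forall t \near (0 : R)^'+, crho c (bpath c p t) = t.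
Proof.
move=> Xc cp bp; have nT : \forall q \near p, setT q by near=> q.
apply: filterS (bpath_near Xc cp bp nT) => t [_ _ _ h].
have /(bdry_cmap Xc cp) x0 := bp.
by rewrite /crho h !mxE x0 add0r eqxx mulr1.
Unshelve. all: by end_near. Qed.

Lemma bdata_crho rho g h U V V' gb gb' s s' c p : local_def X U rho -> V `<=` U ->
  is_bdata X rho g h V gb s -> is_bdata X (crho c) g h V' gb' s' ->
  atlas X c -> V p -> V' p -> cdom c p -> bdry X p ->
  exists2 u : R, 0 < u & [/\ gb c p = u ^+ 2 *: gb' c p, s c p = (u ^+ m.-1)^-1 *: s' c p &
    drho rho c p = u *: drho (crho c) c p].
Proof.
move=> ld VU D D' Xc Vp V'p cp bp.
have [u [u0 du ru]] := drho_bdry ld Xc (VU p Vp) bp cp.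
exists u => //.
(* The ratio along the path is rho / t, because [crho c] equals t there; its limit is the
   coefficient of d rho. *)
have hr : \forall t \near (0 : R)^'+, rho (bpath c p t) = t^-1 * rho (bpath c p t) * crho c (bpath c p t).
  have p0 : \forall t \near (0 : R)^'+, 0 < t by exact: nbhs_right_gt.
  apply: filterS2 p0 (crho_bpath Xc cp bp) => t t0 ->.
  by rewrite mulrAC mulVf ?mul1r// gt_eqF.
have [|h1 h2] := bdata_compare D D' Xc Vp V'p cp bp hr ru; first by rewrite gt_eqF.
by rewrite (drho_crho Xc cp).
Qed.

Lemma cocycle_crho rho g h U c p gam : G g -> G h -> local_def X U rho -> U p -> bdry X p ->
  atlas X c -> cdom c p -> cocycle rho g h gam c p = cocycle (crho c) g h gam c p.
Proof.
move=> Gg Gh ld Up bp Xc cp.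
have [V [gb [s [Vp VU D]]]] := bdata_ex hG m2 Gg Gh ld Up bp.
have [V' [gb' [s' [V'p V'U D']]]] := bdata_ex hG m2 Gg Gh (crho_local Xc) cp bp.
rewrite (cocycleE D (G_metric Gg) Xc Vp bp cp) (cocycleE D' (G_metric Gg) Xc V'p bp cp).
have [u u0 [-> -> ->]] := bdata_crho ld VU D D' Xc Vp V'p cp bp.
have [_ pg ug _ _] := bdata_pos D' Xc V'p bp cp.
rewrite kval_scale//; exact: posdef_det_gt0 (tangential_posdef pg).
Qed.

(** The difference rho^2 h - rho^2 g = rho^n s vanishes together with rho. *)
Lemma bdata_gbar rho g h V V' gb gb' s s' h' c p : is_bdata X rho g h V gb s ->
  is_bdata X rho h h' V' gb' s' -> atlas X c -> V p -> V' p -> cdom c p -> bdry X p ->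
  (exists F, hext (cmap c p) (fun y => rho (cinv c y)) F) -> rho p = 0 -> gb c p = gb' c p.
Proof.
move=> D D' Xc Vp V'p cp bp [Fr hr] rp.
have [oV sgb ss _ _] := D; have [oV' sgb' _ _ _] := D'.
have [F1 h1] := smooth_tensor2_hext oV sgb Xc Vp cp.
have [F2 h2] := smooth_tensor2_hext oV ss Xc Vp cp.
have [F1' h1'] := smooth_tensor2_hext oV' sgb' Xc V'p cp.
apply/matrixP => i j; apply/esym.
pose f z : R := gb c z i j + rho z * rho z * (rho z ^+ m.-1 * s c z i j).
have rX n : exists F, hext (cmap c p) (fun y => rho (cinv c y) ^+ n) F.
  elim: n => [|n [F hF]].
    by exists (cst 1); have := hext_cst (cmap c p) 1; congr hext; apply/funext => y; rewrite expr0.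
  exists (fun y => Fr y * F y); have := hextM hr hF; congr hext.
  by apply/funext => y; rewrite exprS.
have [Fm hm] := rX m.-1.
have hf := hextD (h1 i j) (hextM (hextM hr hr) (hextM hm (h2 i j))).
have -> : gb c p i j = f p by rewrite /f rp !mul0r addr0.
apply: (boundary_eq Xc cp bp (f := fun z => gb' c z i j) (g := f) (h1' i j) hf).
apply: filterS2 (bdata_near D Xc Vp cp) (bdata_near D' Xc V'p cp) => z e1 e2 iz.
have [_ _ E1 E2] := e1 iz; have [_ _ E1' _] := e2 iz.
by rewrite -E1' E2 /f -E1 !mxE; ring.
Qed.

(** For [crho c] the two metrics are, at t > 0, exactly [sing FG] and [sing G2'], and [core_trace]
    makes the bracket in [kval] vanish. The condition |d rho| = 1 becomes the condition of
    [core_trace] on the (0, 0) entry of the inverse matrix. *)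
Lemma hyperbolic_kval g1 g2 U V gb s c p : open U -> G g1 -> G g2 ->
  hyperbolic_on X U g1 -> hyperbolic_on X U g2 ->
  is_bdata X (crho c) g1 g2 V gb s -> atlas X c -> U p -> V p -> bdry X p -> cdom c p ->
  kval (gb c p) (s c p) (drho (crho c) c p) = 0.
Proof.
move=> oU G1 G2 H1 H2 D Xc Up Vp bp cp.
have mg1 := G_metric G1; have mg2 := G_metric G2.
have [sg pg ug ng sS] := bdata_pos D Xc Vp bp cp.
have [oV sgb ss _ _] := D.
have [FG hF] := smooth_tensor2_hext oV sgb Xc Vp cp.
have [FS hS] := smooth_tensor2_hext oV ss Xc Vp cp.
set x := cmap c p in hF hS *.
have hx : halfspace x := chart_halfspace Xc cp.
have x0 : x ord0 o0 = 0 by exact/(bdry_cmap Xc cp).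
have FGx : FG x = gb c p by apply/matrixP => i j; rewrite -(hextE hx (hF i j)) /x (cinvK Xc cp).
have FSx : FS x = s c p by apply/matrixP => i j; rewrite -(hextE hx (hS i j)) /x (cinvK Xc cp).
pose G2' y := FG y + y ord0 o0 ^+ m.+1 *: FS y.
have sG i j : smooth_near x (fun y => FG y i j) by case: (hF i j).
have sM i j : smooth_near x (fun y => FS y i j) by case: (hS i j).
have sG2 i j : smooth_near x (fun y => G2' y i j).
  have -> : (fun y => G2' y i j) = (fun y => FG y i j + y ord0 o0 ^+ m.+1 * FS y i j).
    by apply/funext => y; rewrite !mxE.
  apply: smooth_nearD => //; apply: smooth_nearM => //.
  by apply: (smooth_open_near openT) => //; apply: (smooth_openX openT); exact: (smooth_open_coord openT).
have G2x : G2' x = gb c p by rewrite /G2' x0 expr0n /= scale0r addr0.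
have uF : FG x \in unitmx by rewrite FGx.
have uF2 : G2' x \in unitmx by rewrite G2x.
have [nu1 _] := smooth_mx_near_inv sG uF.
have [nu2 _] := smooth_mx_near_inv sG2 uF2.
have [V1 [oV1 V1x sV1]] := smooth_mx_near_open sG.
have [V2 [oV2 V2x sV2]] := smooth_mx_near_open sM.
have nUV : \forall z \near p, U z /\ V z.
  by apply: filterI; exact: open_near_set.
have nE := @filterI _ _ (nbhs_filter x) _ _ (mx_hext_eq (A := fun y => gb c (cinv c y)) hF)
  (mx_hext_eq (A := fun y => s c (cinv c y)) hS).
have nV := open_nbhs_nbhs (conj (openI oV1 oV2) (conj V1x V2x)).
have nu := @filterI _ _ (nbhs_filter x) _ _ nu1 nu2.
have [ O [oO Ox hO]] := near_open (@filterI _ _ (nbhs_filter x) _ _ (@filterI _ _ (nbhs_filter x) _ _ nu nV)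
  (@filterI _ _ (nbhs_filter x) _ _ nE (chart_near Xc cp nUV))).
have pt y : pos_part O y -> [/\ U (cinv c y), inter X (cinv c y), cdom c (cinv c y), cmap c (cinv c y) = y &
   g1 c (cinv c y) = sing FG y /\ g2 c (cinv c y) = sing G2' y].
  move=> [/hO[_ [[e1 e2] h]] /= y0].
  have hy : halfspace y by rewrite /halfspace /= ltW.
  have [[Uy Vy] cy yE] := h hy.
  have iy : inter X (cinv c y) by apply/(inter_cmap Xc cy); rewrite yE.
  have [_ _ _ EE _] := D; have [r0 E1 E2] := EE c _ Xc Vy iy cy.
  have rE : crho c (cinv c y) = y ord0 o0 by rewrite /crho yE.
  rewrite rE in r0 E1 E2.
  have E3 : g1 c (cinv c y) = sing FG y.
    by rewrite /sing -e1// -E1 scalerA mulVf ?scale1r// expf_neq0.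
  split=> //; split=> //.
  rewrite E2 E3 /sing /G2' scalerDr scalerA e2//; congr (_ + _ *: _).
  (* The difference t^(n-2) s of the metrics is put under the double pole as t^-2 (t^n s). *)
  have pw a : a != 0 -> a ^+ m.-1 = a ^- 2 * a ^+ m.+1 :> R.
    move=> a0; have -> : m.+1 = (2 + m.-1)%N by case: (m) m0.
    by rewrite exprD mulrA mulVf ?mul1r// expf_neq0.
  exact: pw.
have loc (gg : @tensor2 R T m) (A : rV -> 'M[R]_m.+1) : is_metric X gg -> hyperbolic_on X U gg ->
    (forall y, pos_part O y -> gg c (cinv c y) = sing A y) ->
    forall y v w, pos_part O y -> row_free (col_mx v w) -> hyp_eq (sing A) v w y.
  move=> mgg Hgg E y v w Py rf; have [Uy iy cy yE _] := pt y Py.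
  have := sectional_hyp mgg Xc cy iy (Hgg c _ v w Xc Uy iy cy rf).
  rewrite yE; apply: hyp_eq_local.
  have : \forall z \near y, pos_part O z.
    by apply: open_nbhs_nbhs; split=> //; exact: open_pos_part.
  by apply: filterS => z; exact: E.
have := @core_trace R m O FG FS x oO Ox x0.
rewrite FGx FSx => core.
rewrite /kval (drho_crho Xc cp) core ?subrr ?mulr0//.
- by rewrite gtn_eqF.
- by move=> i j; apply: smooth_open_sub (sV1 i j) => y /hO[[_ []]].
- by move=> i j; apply: smooth_open_sub (sV2 i j) => y /hO[[_ []]].
- by move=> y /hO[[[]]].
- by move=> y /hO[[[]]].
- by apply: (loc g1 FG) => // y Py; have [_ _ _ _ []] := pt y Py.
- by apply: (loc g2 G2') => // y Py; have [_ _ _ _ []] := pt y Py.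
- by have := ng; rewrite (drho_crho Xc cp) /ip -rowE trmx_delta -colE !mxE.
Qed.

(** Gluing requires different open sets and different defining functions; both sides are moved to
    [crho c] and to the intersection of the open sets. *)
Lemma cocycle_hyperbolic U1 U2 V1 V2 rho1 rho2 g1 g2 h c p gam : open U1 -> open U2 -> G g1 -> G g2 -> G h ->
  hyperbolic_on X U1 g1 -> hyperbolic_on X U2 g2 -> local_def X V1 rho1 -> local_def X V2 rho2 ->
  atlas X c -> U1 p -> U2 p -> V1 p -> V2 p -> bdry X p -> cdom c p ->
  cocycle rho1 g1 h gam c p = cocycle rho2 g2 h gam c p.
Proof.
move=> oU1 oU2 G1 G2 Gh H1' H2' ld1 ld2 Xc U1p U2p W1p W2p bp cp.
pose U := U1 `&` U2.
have oU : open U by exact: openI.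
have Up : U p by [].
have H1 : hyperbolic_on X U g1 by move=> c' q v w Xc' [Uq _]; exact: H1'.
have H2 : hyperbolic_on X U g2 by move=> c' q v w Xc' [_ Uq]; exact: H2'.
rewrite (cocycle_crho _ G1 Gh ld1 W1p bp Xc cp) (cocycle_crho _ G2 Gh ld2 W2p bp Xc cp).
have lc := crho_local Xc.
have [W1 [gb1 [s1 [V1p V1U D1]]]] := bdata_ex hG m2 G1 Gh lc cp bp.
have [W2 [gb2 [s2 [V2p V2U D2]]]] := bdata_ex hG m2 G2 Gh lc cp bp.
have [V3 [gb3 [s3 [V3p V3U D3]]]] := bdata_ex hG m2 G1 G2 lc cp bp.
rewrite (cocycleE D1 (G_metric G1) Xc V1p bp cp) (cocycleE D2 (G_metric G2) Xc V2p bp cp).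
have e31 : gb3 c p = gb1 c p.
  by rewrite -(gbar_bdryE D3 Xc V3p bp cp) -(gbar_bdryE D1 Xc V1p bp cp).
have rp : crho c p = 0 by exact/(bdry_cmap Xc cp).
have e32 : gb3 c p = gb2 c p.
  by apply: (bdata_gbar D3 D2 Xc V3p V2p cp bp _ rp); exact: (local_def_hext lc Xc cp cp).
(* The decomposition h - g1 = (g2 - g1) + (h - g2), divided by rho^(n-2): the cocycle property at
   the level of boundary values. *)
have es : s3 c p = s1 c p - s2 c p.
  have [oV1 _ ss1 _ _] := D1; have [oV2 _ ss2 _ _] := D2; have [oV3 _ ss3 _ _] := D3.
  have [F1 h1] := smooth_tensor2_hext oV1 ss1 Xc V1p cp.
  have [F2 h2] := smooth_tensor2_hext oV2 ss2 Xc V2p cp.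
  have [F3 h3] := smooth_tensor2_hext oV3 ss3 Xc V3p cp.
  suff -> : s1 c p = s3 c p + s2 c p by rewrite addrK.
  apply/matrixP => i j; rewrite [RHS]mxE.
  apply: (boundary_eq Xc cp bp (f := fun z => s1 c z i j) (g := fun z => s3 c z i j + s2 c z i j)
    (h1 i j) (hextD (h3 i j) (h2 i j))).
  apply: filterS3 (bdata_near D1 Xc V1p cp) (bdata_near D2 Xc V2p cp) (bdata_near D3 Xc V3p cp) => z f1 f2 f3 iz.
  have [_ r0 _ e1] := f1 iz; have [_ _ _ e2] := f2 iz; have [_ _ _ e3] := f3 iz.
  have rn : crho c z ^+ m.-1 != 0 by rewrite expf_neq0.
  have E : crho c z ^+ m.-1 *: s1 c z = crho c z ^+ m.-1 *: (s3 c z + s2 c z).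
    by apply: (addrI (g1 c z)); rewrite -e1 e2 e3 scalerDr addrA.
  by rewrite (scalerI rn E) mxE.
have := hyperbolic_kval oU G1 G2 H1 H2 D3 Xc Up V3p bp cp.
rewrite es kvalB e31 => /eqP; rewrite subr_eq0 => /eqP ->; by rewrite -e31 e32.
Qed.

End Invariance.

(** * Transformation of the cocycle *)

Section Pull.
Context {R : realType} {T : topologicalType} {m : nat} (X : oriented_mfd R T m).
Variables (G : set (@tensor2 R T m)) (hG : asymp_class X G) (m2 : (2 <= m)%N).
Local Notation rV := 'rV[R]_m.+1.
Local Notation e_ i := (delta_mx ord0 i : rV).
Local Notation o0 := (@ord0 m).
Implicit Types (c d e : chart R T m) (p q : T) (W U V : set T) (phi psi : T -> T)
  (x y v w : rV) (g h : @tensor2 R T m) (A B : rV -> 'M[R]_m.+1)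
  (rho : T -> R).

Let m0 : (0 < m)%N. Proof. exact: leq_trans m2. Qed.

Lemma scale_tractor_X (k : R) : k *: (tractor_X : @triple R m) = (0, 0, k).
Proof.
have E (a : R^o) (b : 'rV[R]_m) (e : R^o) : k *: ((a, b, e) : @triple R m) = (k * a, k *: b, k * e) by [].
by rewrite E mulr0 scaler0 mulr1.
Qed.

Lemma jac_mx_hext phi c d p : atlas X c -> atlas X d -> cdom c p -> cdom d (phi p) ->
  smooth_self X phi -> exists FJ : rV -> 'M[R]_m.+1,
  forall i j, hext (cmap c p) (fun y => jac phi c d (cinv c y) i j) (fun y => FJ y i j).
Proof.
move=> Xc Xd cp dp sphi; have [F hF] := map_ext sphi Xc Xd cp dp.
exists (fun y => \matrix_(i, j) 'D_(e_ j) (fun y => F y ord0 i : R^o) y) => i j.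
have := jac_hext Xc cp i j hF; congr hext.
by apply/funext => y; rewrite mxE.
Qed.

Lemma pull_bdry phi V V' (t t' : @tensor2 R T m) c d p : bmap X phi ->
  open V -> smooth_tensor2 X V t -> open V' -> smooth_tensor2 X V' t' ->
  atlas X c -> atlas X d -> V (phi p) -> V' p -> bdry X p -> cdom c p -> cdom d (phi p) ->
  (\forall z \near p, inter X z ->
    t' c z = (jac phi c d z)^T *m t d (phi z) *m jac phi c d z) ->
  t' c p = (jac phi c d p)^T *m t d (phi p) *m jac phi c d p.
Proof.
move=> bphi oV st oV' st' Xc Xd Vp V'p bp cp dp E.
have sphi : smooth_self X phi by case: bphi.
have [F hF] := map_ext sphi Xc Xd cp dp.
have [F1 h1] := smooth_tensor2_hext oV st Xd Vp dp.
have [F2 h2] := smooth_tensor2_hext oV' st' Xc V'p cp.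
have [FJ hJ] := jac_mx_hext Xc Xd cp dp sphi.
have ht i j : hext (cmap c p) (fun y => t d (phi (cinv c y)) i j) (fun y => F1 (F y) i j).
  by have [_] := hext_comp sphi Xc Xd cp dp (f := fun q => t d q i j) hF (h1 i j).
have hP := hext_mulmx (hext_mulmx (hext_trmx hJ) ht) hJ.
apply/matrixP => i j.
have U1 := boundary_eq Xc cp bp (f := fun z => t' c z i j)
  (g := fun z => ((jac phi c d z)^T *m t d (phi z) *m jac phi c d z) i j) (h2 i j) (hP i j).
by apply: U1; apply: filterS E => z E iz; rewrite E.
Qed.

Lemma related_id g : is_metric X g -> related X id g g.
Proof. by move=> [[tl _] _] c d q Xc Xd iq cq dq; exact: tl. Qed.

Section Transform.
Variables (phi : T -> T) (g h g' h' : @tensor2 R T m) (U : set T) (rho : T -> R) (c d : chart R T m) (p : T).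
Hypotheses (bphi : bmap X phi) (Gg : G g) (Gh : G h) (Gg' : G g') (Gh' : G h')
  (rg : related X phi g g') (rh : related X phi h h') (ld : local_def X U rho) (Up : U (phi p))
  (bp : bdry X p) (Xc : atlas X c) (Xd : atlas X d) (cp : cdom c p) (dp : cdom d (phi p)).

Lemma bdata_pull V V' gb gb' (s s' : @tensor2 R T m) : V (phi p) -> V' p ->
  is_bdata X rho g h V gb s -> is_bdata X (rho \o phi) g' h' V' gb' s' ->
  gb' c p = (jac phi c d p)^T *m gb d (phi p) *m jac phi c d p /\
  s' c p = (jac phi c d p)^T *m s d (phi p) *m jac phi c d p.
Proof.
move=> Vp V'p D D'.
have [oV sgb ss _ _] := D; have [oV' sgb' ss' _ _] := D'.
have nd : \forall z \near p, cdom d (phi z).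
  by apply: (bmap_near bphi); exact: open_near_set (open_cdom Xd) dp.
have n1 := bmap_near bphi (bdata_near D Xd Vp dp).
have n2 := bdata_near D' Xc V'p cp.
have nc := open_near_set (open_cdom Xc) cp.
split.
- apply: (pull_bdry bphi oV sgb oV' sgb') => //.
  apply: filterS2 (@filterI _ _ (nbhs_filter p) _ _ n1 n2) (@filterI _ _ (nbhs_filter p) _ _ nd nc) => z [a1 a2] [dz cz] iz.
  have ipz : inter X (phi z) by exact/(bmap_inter _ bphi).
  have [_ _ <- _] := a1 ipz; have [_ _ <- _] := a2 iz.
  by rewrite (rg Xc Xd iz cz dz) /= -scalemxAr -scalemxAl.
- apply: (pull_bdry bphi oV ss oV' ss') => //.
  apply: filterS2 (@filterI _ _ (nbhs_filter p) _ _ n1 n2) (@filterI _ _ (nbhs_filter p) _ _ nd nc) => z [a1 a2] [dz cz] iz.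
  have ipz : inter X (phi z) by exact/(bmap_inter _ bphi).
  have [_ _ _ E1] := a1 ipz; have [_ r0 _ E2] := a2 iz.
  have rn : (rho \o phi) z ^+ m.-1 != 0 by rewrite expf_neq0.
  apply: (scalerI rn); apply: (addrI (g' c z)); rewrite -E2 (rh Xc Xd iz cz dz) E1.
  by rewrite mulmxDr mulmxDl -(rg Xc Xd iz cz dz) -scalemxAr -scalemxAl.
Qed.

(** For [phi] the identity this is the change of charts, for a diffeomorphism the equivariance. Only
    the third slot is nonzero, and it is the same in all splittings, so [gam] and [gam'] may be
    unrelated. *)
Lemma cocycle_pull gam gam' : cocycle (rho \o phi) g' h' gam c p =
  pull_triple (bjac phi c d p) (cocycle rho g h gam' d (phi p)).
Proof.
have ld' := local_def_pull bphi ld.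
have bpp : bdry X (phi p) by case: bphi => _ b _; exact/b.
have [V [gb [s [Vp VU D]]]] := bdata_ex hG m2 Gg Gh ld Up bpp.
have [V' [gb' [s' [V'p V'U D']]]] := bdata_ex hG m2 Gg' Gh' ld' Up bp.
have [E1 E2] := bdata_pull Vp V'p D D'.
have [J0 dJ] := jac_bdry bphi Xc Xd bp cp dp.
have uJ := jac_unit bphi Xc Xd cp dp.
have [_ pg ug _ _] := bdata_pos D Xd Vp bpp dp.
rewrite (cocycleE D (G_metric hG Gg) Xd Vp bpp dp) (cocycleE D' (G_metric hG Gg') Xc V'p bp cp).
have [F hF] := local_def_hext ld Xd Up dp.
rewrite E1 E2 (drho_comp _ Xc Xd cp dp hF); last by case: bphi.
rewrite kval_congr//; last exact: posdef_det_gt0 (tangential_posdef pg).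
by rewrite !scale_tractor_X /pull_triple /= !mulr0 mul0mx scaler0 /bjac.
Qed.

End Transform.
End Pull.

(** * The conformal class on the boundary *)

Section Conformal.
Context {R : realType} {T : topologicalType} {m : nat} (X : oriented_mfd R T m).
Local Notation rV := 'rV[R]_m.+1.
Local Notation e_ i := (delta_mx ord0 i : rV).
Local Notation o0 := (@ord0 m).
Implicit Types (c d e : chart R T m) (p q : T) (W U V : set T) (phi psi : T -> T)
  (x y v w : rV) (g h : @tensor2 R T m) (A B : rV -> 'M[R]_m.+1)
  (rho : T -> R) (gam : @btensor2 R T m).

Lemma hext_bdry_smooth_on c (k : T -> R) : atlas X c ->
  (forall p, bdry X p -> cdom c p -> exists f F, hext (cmap c p) (fun y => f (cinv c y)) F /\
     \forall z \near p, bdry X z -> k z = f z) ->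
  smooth_on (cmap c @` (bdry X `&` cdom c)) (fun y => k (cinv c y)).
Proof.
move=> Xc H _ [p [bp cp] <-]; have [f [F [[sF fF] kf]]] := H p bp cp.
have n1 := @filterI _ _ (nbhs_filter (cmap c p)) _ _ sF fF.
have [ O [oO Ox hO]] := near_open (@filterI _ _ (nbhs_filter (cmap c p)) _ _ n1 (chart_near Xc cp kf)).
exists O, F; split=> //.
  by move=> s y /hO[[hs _] _]; exact: hs.
move=> y Oy [q [bq cq] qy]; rewrite -qy in Oy *; have [[_ h1] h2] := hO _ Oy.
have hq := chart_halfspace Xc cq.
rewrite -h1//; have [h3 _ _] := h2 hq; rewrite h3//.
by rewrite (cinvK Xc cq).
Qed.

(** Data smooth along the boundary only are extended off it, so that the chain rule for [hext]
    applies to them. *)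
Lemma bdry_smooth_on_hext c (k : T -> R) p : atlas X c -> bdry X p -> cdom c p ->
  smooth_on (cmap c @` (bdry X `&` cdom c)) (fun y => k (cinv c y)) ->
  exists f F, hext (cmap c p) (fun y => f (cinv c y)) F /\
     \forall z \near p, bdry X z -> k z = f z.
Proof.
move=> Xc bp cp /(_ (cmap c p))[|V [F [oV Vx sF VF]]]; first by exists p.
have sFx : smooth_near (cmap c p) F := smooth_open_near oV Vx sF.
exists (fun z => F (cmap c z)), F; split.
  split=> //; have nT : \forall q \near p, setT q by near=> q.
  by apply: filterS (chart_near Xc cp nT) => y h hy; have [_ _ ->] := h hy.
apply: filterS (cmap_near Xc cp (open_nbhs_nbhs (conj oV Vx))) => z [cz Vz] bz.
by rewrite VF//; [rewrite (cinvK Xc cz)|exists z].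
Unshelve. all: by end_near. Qed.

Section Class.
Variables (G : set (@tensor2 R T m)) (hG : asymp_class X G) (m2 : (2 <= m)%N).

Lemma gbar_conformal g1 g2 U1 U2 rho1 rho2 c p : G g1 -> G g2 ->
  local_def X U1 rho1 -> local_def X U2 rho2 -> atlas X c -> U1 p -> U2 p -> bdry X p -> cdom c p ->
  exists2 lam : R, 0 < lam & gbar_infty rho1 g1 c p = lam *: gbar_infty rho2 g2 c p.
Proof.
move=> G1 G2 l1 l2 Xc U1p U2p bp cp; have lc := crho_local Xc.
have [V1 [gb1 [s1 [V1p V1U D1]]]] := bdata_ex hG m2 G1 G2 l1 U1p bp.
have [V2 [gb2 [s2 [V2p V2U D2]]]] := bdata_ex hG m2 G2 G1 l2 U2p bp.
have [V3 [gb3 [s3 [V3p V3U D3]]]] := bdata_ex hG m2 G1 G2 lc cp bp.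
have [V4 [gb4 [s4 [V4p V4U D4]]]] := bdata_ex hG m2 G2 G1 lc cp bp.
have [u u0 [E1 _ _]] := bdata_crho l1 V1U D1 D3 Xc V1p V3p cp bp.
have [v v0 [E2 _ _]] := bdata_crho l2 V2U D2 D4 Xc V2p V4p cp bp.
have rp : crho c p = 0 by exact/(bdry_cmap Xc cp).
have E3 : gb3 c p = gb4 c p.
  by apply: (bdata_gbar D3 D4 Xc V3p V4p cp bp _ rp); exact: (local_def_hext lc Xc cp cp).
(* [u] and [v] are the limits of rho1 / t and rho2 / t; with respect to [crho c] the two metrics
   have the same boundary value. *)
exists (u ^+ 2 / v ^+ 2); first by rewrite divr_gt0// exprn_gt0.
rewrite /gbar_infty (gbar_bdryE D1 Xc V1p bp cp) (gbar_bdryE D2 Xc V2p bp cp) E1 E2 E3 !tangentialZ.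
by rewrite scalerA -mulrA mulVf ?mulr1// gt_eqF// exprn_gt0.
Qed.

Lemma gbar_pull phi g g' U rho c d p : bmap X phi -> G g -> G g' -> related X phi g g' ->
  local_def X U rho -> U (phi p) -> bdry X p -> atlas X c -> atlas X d -> cdom c p -> cdom d (phi p) ->
  gbar_infty (rho \o phi) g' c p =
  (bjac phi c d p)^T *m gbar_infty rho g d (phi p) *m bjac phi c d p.
Proof.
move=> bphi Gg Gg' rg ld Up bp Xc Xd cp dp.
have ld' := local_def_pull bphi ld.
have bpp : bdry X (phi p) by case: bphi => _ b _; exact/b.
have [V [gb [s [Vp VU D]]]] := bdata_ex hG m2 Gg Gg ld Up bpp.
have [V' [gb' [s' [V'p V'U D']]]] := bdata_ex hG m2 Gg' Gg' ld' Up bp.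
have [E1 _] := bdata_pull bphi rg rg bp Xc Xd cp dp Vp V'p D D'.
have [J0 _] := jac_bdry bphi Xc Xd bp cp dp.
rewrite /gbar_infty (gbar_bdryE D Xd Vp bpp dp) (gbar_bdryE D' Xc V'p bp cp) E1.
exact: tangential_congr.
Qed.

(** At each boundary point one related pair of metrics in [G] suffices for conformality: the
    pull-back of the boundary metric of the first is that of the second, and all members of [G] are
    conformal to each other by [gbar_conformal]. *)
Lemma conf_pull phi gam : bmap X phi ->
  (forall p, bdry X p -> exists g g', [/\ G g, G g' & related X phi g g']) ->
  conf_class X G gam -> conf_class X G (pull_btensor2 X phi gam).
Proof.
move=> bphi rel [[law sm pos] cf].
have [sphi bb dj] := bphi.
have law' c d p : atlas X c -> atlas X d -> bdry X p -> cdom c p -> cdom d (phi p) ->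
    pull_btensor2 X phi gam c p = (bjac phi c d p)^T *m gam d (phi p) *m bjac phi c d p.
  move=> Xc Xd bp cp dp; have [Xd' dp'] := chart_at_atlas X (phi p).
  have bpp : bdry X (phi p) by exact/bb.
  rewrite (law d _ _ Xd Xd' bpp dp dp') /pull_btensor2.
  rewrite -[bjac phi c (chart_at X (phi p)) p]/(bjac (id \o phi) c (chart_at X (phi p)) p).
  rewrite (bjac_comp bphi (bmap_id X) Xc Xd Xd' bp cp dp dp').
  by rewrite trmx_mul !mulmxA.
split; first split.
- move=> c d p Xc Xd bp cp dp; have [Xe ep] := chart_at_atlas X (phi p).
  rewrite (law' c _ p Xc Xe bp cp ep) (law' d _ p Xd Xe bp dp ep).
  rewrite -[bjac phi c (chart_at X (phi p)) p]/(bjac (phi \o id) c (chart_at X (phi p)) p).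
  rewrite (bjac_comp (bmap_id X) bphi Xc Xd Xe bp cp dp ep).
  by rewrite trmx_mul !mulmxA.
- move=> c i j Xc; apply: (hext_bdry_smooth_on (k := fun z => pull_btensor2 X phi gam c z i j)) => // p bp cp.
  have [Xd dp] := chart_at_atlas X (phi p); set d := chart_at X (phi p) in Xd dp.
  have bpp : bdry X (phi p) by exact/bb.
  have H a b := bdry_smooth_on_hext (k := fun z => gam d z a b) Xd bpp dp (sm d a b Xd).
  have [f Hf] := choice (fun ab : 'I_m * 'I_m => H ab.1 ab.2).
  have [FF Hf'] := choice Hf.
  have [F hF] := map_ext sphi Xc Xd cp dp.
  have [FJ hJ] := jac_mx_hext Xc Xd cp dp sphi.
  have ht a b : hext (cmap c p) (fun y => (\matrix_(a, b) f (a, b) (phi (cinv c y)) : 'M[R]_m) a b)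
      (fun y => (\matrix_(a, b) FF (a, b) (F y) : 'M[R]_m) a b).
    have [hab _] := Hf' (a, b).
    have [_] := hext_comp sphi Xc Xd cp dp hF hab; congr hext; apply/funext => y; by rewrite !mxE.
  have hbJ a b : hext (cmap c p) (fun y => bjac phi c d (cinv c y) a b)
      (fun y => (tangential (FJ y)) a b).
    have := hJ (lift ord0 a) (lift ord0 b); congr hext; apply/funext => y; by rewrite /bjac [RHS]mxE.
  have hP := hext_mulmx (hext_mulmx (hext_trmx hbJ) ht) hbJ i j.
  exists (fun z => ((bjac phi c d z)^T *m (\matrix_(a, b) f (a, b) (phi z)) *m bjac phi c d z) i j).
  eexists; split; first exact: hP.
  have nd : \forall z \near p, cdom d (phi z).
    by apply: (bmap_near bphi); exact: open_near_set (open_cdom Xd) dp.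
  have nc := open_near_set (open_cdom Xc) cp.
  have nk : \forall z \near p, forall a b, bdry X (phi z) -> gam d (phi z) a b = f (a, b) (phi z).
    apply: (bmap_near bphi (W := fun z => forall a b, bdry X z -> gam d z a b = f (a, b) z)).
    by apply: near_forall => a; apply: near_forall => b; have [] := Hf' (a, b).
  apply: filterS3 nd nc nk => z dz cz kz bz.
  rewrite (law' c d z Xc Xd bz cz dz).
  suff -> : gam d (phi z) = \matrix_(a, b) f (a, b) (phi z) by [].
  by apply/matrixP => a b; rewrite mxE kz//; exact/bb.
- move=> c p Xc bp cp; have [Xd dp] := chart_at_atlas X (phi p).
  have bpp : bdry X (phi p) by exact/bb.
  have [sy pd] := pos _ _ Xd bpp dp.
  split; first by rewrite /pull_btensor2 !trmx_mul trmxK sy mulmxA.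
  apply: posdef_congr => //; rewrite unitmxE unitfE gt_eqF//.
  by have [] := jac_bdry bphi Xc Xd bp cp dp.
move=> g U rho c p Gg ld Xc Up bp cp.
have [Xd dp] := chart_at_atlas X (phi p); set d := chart_at X (phi p) in Xd dp.
have bpp : bdry X (phi p) by exact/bb.
have [g1 [g1' [G1 G1' r1]]] := rel p bp.
have lc := crho_local Xd.
have [l1 l10 E1] := cf g1 _ _ d (phi p) G1 lc Xd dp bpp dp.
have [l2 l20 E2] := gbar_conformal G1' Gg (local_def_pull bphi lc) ld Xc dp Up bp cp.
exists (l1 * l2); first exact: mulr_gt0.
rewrite (law' c d p Xc Xd bp cp dp) E1 -scalemxAr -scalemxAl.
by rewrite -(gbar_pull bphi G1 G1' r1 lc dp bp Xc Xd cp dp) E2 scalerA.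
Qed.

End Class.
End Conformal.

(** * Diffeomorphisms preserving the class of metrics *)

Section Diffeo.
Context {R : realType} {T : topologicalType} {m : nat} (X : oriented_mfd R T m).
Local Notation rV := 'rV[R]_m.+1.
Local Notation e_ i := (delta_mx ord0 i : rV).
Local Notation o0 := (@ord0 m).
Variables (G : set (@tensor2 R T m)) (hG : asymp_class X G) (m2 : (2 <= m)%N).
Variables (Phi Psi : T -> T) (hD : diff_class X G Phi Psi).
Implicit Types (c d e : chart R T m) (p q : T) (W U V : set T)
  (g h k : @tensor2 R T m) (gam : @btensor2 R T m).

Let PK p : Psi (Phi p) = p. Proof. by case: hD => -[]. Qed.
Let KP p : Phi (Psi p) = p. Proof. by case: hD => -[]. Qed.

Lemma diff_smooth_self : smooth_self X Phi /\ smooth_self X Psi.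
Proof.
have [[_ _ c1 c2 sm] _ _ _] := hD.
by split; split=> // c d Xc Xd; have [] := sm c d Xc Xd.
Qed.

Lemma diff_jac c d p : atlas X c -> atlas X d -> cdom c p -> cdom d (Phi p) ->
  jac Psi d c (Phi p) *m jac Phi c d p = 1%:M.
Proof.
move=> Xc Xd cp dp; have [s1 s2] := diff_smooth_self.
rewrite -(jac_comp s1 s2 Xc Xd Xc cp dp) ?PK//.
have -> : Psi \o Phi = id by apply/funext => q /=; rewrite PK.
exact: (jac_id Xc cp).
Qed.

Lemma diff_jac_gt0 c d p : atlas X c -> atlas X d -> cdom c p -> cdom d (Phi p) ->
  0 < \det (jac Phi c d p) /\ 0 < \det (jac Psi d c (Phi p)).
Proof.
move=> Xc Xd cp dp; have [_ op _ _] := hD.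
have j0 := op c d p Xc Xd cp dp; split=> //.
have := congr1 (fun A => \det A) (diff_jac Xc Xd cp dp); rewrite det_mulmx det1 => E.
by rewrite -(pmulr_lgt0 _ j0) E.
Qed.

(** An invertible differential excludes an interior minimum of the normal coordinate, for [Phi] as
    well as for its inverse, so neither moves an interior point to the boundary. *)
Lemma diff_bdry p : bdry X (Phi p) <-> bdry X p.
Proof.
have [s1 s2] := diff_smooth_self.
have [Xc cp] := chart_at_atlas X p; have [Xd dp] := chart_at_atlas X (Phi p).
have [j1 j2] := diff_jac_gt0 Xc Xd cp dp.
rewrite (propext (bdry_cmap Xc cp)) (propext (bdry_cmap Xd dp)); split.
  by apply: (det_jac_min s1 Xc Xd cp dp); rewrite gt_eqF.
have cp' : cdom (chart_at X p) (Psi (Phi p)) by rewrite PK.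
move=> x0; apply: (det_jac_min s2 Xd Xc dp cp'); first by rewrite gt_eqF.
by rewrite PK.
Qed.

Lemma diff_bmap : bmap X Phi /\ bmap X Psi.
Proof.
have [s1 s2] := diff_smooth_self.
split; split=> //.
- exact: diff_bdry.
- by move=> c d p Xc Xd cp dp; have [] := diff_jac_gt0 Xc Xd cp dp.
- by move=> p; rewrite -[X in _ <-> bdry _ X]KP; apply: iff_sym; exact: diff_bdry.
- move=> c d p Xc Xd cp dp.
  have dp' : cdom c (Phi (Psi p)) by rewrite KP.
  by have [_] := diff_jac_gt0 Xd Xc dp dp'; rewrite KP.
Qed.

Lemma diff_related h : G h -> related X Phi h (pull_tensor2 X Phi h).
Proof.
move=> Gh c d q Xc Xd iq cq dq; have [Xe eq] := chart_at_atlas X (Phi q).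
have [b1 _] := diff_bmap; have [s1 _ _] := b1.
have iq' : inter X (Phi q) by exact/(bmap_inter _ b1).
have [[law _] _] := G_metric hG Gh.
rewrite (law d _ _ Xd Xe iq' dq eq) /pull_tensor2.
rewrite -[jac Phi c (chart_at X (Phi q)) q]/(jac (id \o Phi) c (chart_at X (Phi q)) q).
rewrite (jac_comp s1 (smooth_self_id X) Xc Xd Xe cq dq eq).
by rewrite trmx_mul !mulmxA.
Qed.

(** A metric [k] of the class is some Phi^* h on the interior; inverting the Jacobians turns this
    into h = Psi^* k. *)
Lemma diff_related_inv k : G k -> exists2 h, G h & related X Psi k h.
Proof.
move=> Gk; have [_ _ _ /(_ k Gk)[h Gh E]] := hD; exists h => //.
move=> d c q Xd Xc iq dq cq.
have [b1 b2] := diff_bmap.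
have iq' : inter X (Psi q) by exact/(bmap_inter _ b2).
have dq' : cdom d (Phi (Psi q)) by rewrite KP.
rewrite -(E c _ Xc iq' cq) (diff_related Gh Xc Xd iq' cq dq').
have := diff_jac Xc Xd cq dq'; rewrite KP => JJ.
have JJ' := mulmx1C JJ.
rewrite !mulmxA -trmx_mul JJ' trmx1 mul1mx -mulmxA JJ' mulmx1.
by [].
Qed.

Lemma smooth_map_on_subset A B c d (phi : T -> T) : A `<=` B ->
  smooth_map_on B c d phi -> smooth_map_on A c d phi.
Proof.
move=> AB s i x Ax; have sub : cmap c @` (A `&` cdom c `&` phi @^-1` cdom d) `<=` cmap c @` (B `&` cdom c `&` phi @^-1` cdom d).
  by apply: image_subset; apply: setSI; apply: setSI.
have [V [F [h1 h2 h3 h4]]] := s i x (sub _ Ax).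
by exists V, F; split=> // y Vy Ay; apply: h4 => //; exact: sub.
Qed.

Hypothesis G_bdry : forall p, bdry X p -> exists g, G g.

Lemma diff_conf_pull gam : conf_class X G gam -> conf_class X G (pull_btensor2 X Phi gam).
Proof.
apply: (conf_pull hG m2 diff_bmap.1) => p /G_bdry[g Gg]; exists g, (pull_tensor2 X Phi g).
by split=> //; [case: hD => _ _ h _; exact: h|exact: diff_related].
Qed.

Lemma diff_conf_pull_inv gam : conf_class X G gam -> conf_class X G (pull_btensor2 X Psi gam).
Proof.
apply: (conf_pull hG m2 diff_bmap.2) => p /G_bdry[g Gg].
by have [h Gh r] := diff_related_inv Gg; exists g, h.
Qed.

Lemma diff_conf_isometry : conf_isometry X G Phi Psi.
Proof.
have [[_ bb1 _] [_ bb2 _]] := diff_bmap.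
have [[_ _ c1 c2 sm] _ _ _] := hD.
split.
- by move=> p bp; split; [exact/bb1|exact: PK].
- by move=> p bp; split; [exact/bb2|exact: KP].
- by split; exact: continuous_subspaceT.
- by move=> c d Xc Xd; have [h1 h2] := sm c d Xc Xd; split;
    apply: (smooth_map_on_subset (@subsetT _ _)).
- exact: diff_conf_pull.
Qed.

End Diffeo.

(** * Smoothness of the third slot *)

Section SmoothKval.
Context {R : realType} {m : nat}.
Local Notation rV := 'rV[R]_m.+1.
Local Notation o0 := (@ord0 m).
Implicit Types (x y : rV) (F : rV -> R).

Lemma smooth_near_det x n (A : rV -> 'M[R]_n) : smooth_mx_near x A ->
  smooth_near x (fun y => \det (A y)).
Proof.
move=> /smooth_mx_near_open[V [oV Vx sA]].
exact: smooth_open_near Vx (smooth_open_det oV sA).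
Qed.

Lemma smooth_near_gt0 x F : smooth_near x F -> 0 < F x -> \forall y \near x, 0 < F y.
Proof. by move=> sF F0; exact: (cvgr_gt _ (smooth_near_continuous sF) _ F0). Qed.

Lemma smooth_near_powR x F a : smooth_near x F -> 0 < F x -> smooth_near x (fun y => F y `^ a).
Proof.
move=> sF F0; have [V [oV Vx hV]] := near_open (@filterI _ _ (nbhs_filter x) _ _ sF (smooth_near_gt0 sF F0)).
apply: (smooth_open_near oV Vx); apply: (smooth_open_powR oV).
  by move=> s y /hV[h _]; exact: h.
by move=> y /hV[].
Qed.

Lemma smooth_near_kval x (A M : rV -> 'M[R]_m.+1) (r : rV) :
  (forall i j, smooth_near x (fun y => A y i j)) -> (forall i j, smooth_near x (fun y => M y i j)) ->
  A x \in unitmx -> 0 < \det (tangential (A x)) -> smooth_near x (fun y => kval (A y) (M y) r).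
Proof.
move=> sA sM uA dA.
have st i j : smooth_near x (fun y => tangential (A y) i j).
  have := sA (lift ord0 i) (lift ord0 j); congr smooth_near.
  by apply/funext => y; rewrite mxE.
have sd := smooth_near_det st.
have [_ sI] := smooth_mx_near_inv sA uA.
have hI i j := smooth_near_hext (sI i j).
have hM i j := smooth_near_hext (sM i j).
have hr i j : hext x (fun y => (fun _ : rV => r) y i j) (fun y => (fun _ : rV => r) y i j) := hext_cst x (r i j).
have h1 := hext_mulmx hI hM.
have h2 := hext_mulmx hr hI.
have h3 := hext_mulmx (hext_mulmx h2 hM) (hext_trmx h2).
(* The square root and the density are merged into one real power of the determinant, which is
   smooth where the determinant is positive. *)
pose K y := \det (tangential (A y)) `^ (2^-1 + (2 * m)%:R^-1) *
  (2^-1 * (m.+1%:R * (\sum_i (invmx (A y) *m M y) i i) + -1 * (r *m invmx (A y) *m M y *m (r *m invmx (A y))^T) ord0 ord0)).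
apply: (@smooth_near_eq _ _ x K).
  apply: filterS (smooth_near_gt0 sd dA) => y dy.
  by rewrite /kval (vol_densityE dy) /K mulN1r.
apply: smooth_nearM; first exact: smooth_near_powR.
apply: smooth_nearM; first exact: smooth_near_cst.
apply: smooth_nearD; apply: smooth_nearM; try exact: smooth_near_cst.
  by have [] := hext_sum (fun i => h1 i i).
by have [] := h3 ord0 ord0.
Qed.

End SmoothKval.

(** * The section c(h): existence, uniqueness and equivariance *)

Section Cocycle.
Context {R : realType} {T : topologicalType} {m : nat} (X : oriented_mfd R T m).
Variables (G : set (@tensor2 R T m)) (hG : asymp_class X G) (m2 : (2 <= m)%N).
Hypothesis hyp : forall p, bdry X p -> exists U g, [/\ open U, U p, G g & hyperbolic_on X U g].
Local Notation rV := 'rV[R]_m.+1.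
Local Notation e_ i := (delta_mx ord0 i : rV).
Local Notation o0 := (@ord0 m).
Implicit Types (c d e : chart R T m) (p q : T) (W U V : set T)
  (g h k : @tensor2 R T m) (gam : @btensor2 R T m) (rho : T -> R).

Lemma cocycle_X rho g h c p : exists a, forall gam, cocycle rho g h gam c p = (0, 0, a).
Proof. by eexists => gam; rewrite /cocycle /c1 /c2 !scalerA -scalerDl; exact: scale_tractor_X. Qed.

Lemma cocycle_sel : exists sel : T -> set T * @tensor2 R T m, forall p, bdry X p ->
  [/\ open (sel p).1, (sel p).1 p, G (sel p).2 & hyperbolic_on X (sel p).1 (sel p).2].
Proof.
have [p|sel hs] := @choice T (set T * @tensor2 R T m) (fun p Ug => bdry X p ->
  [/\ open Ug.1, Ug.1 p, G Ug.2 & hyperbolic_on X Ug.1 Ug.2]); last by exists sel.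
(* Off the boundary the selected value is a dummy. *)
have [bp|nbp] := pselect (bdry X p); last by exists (setT, fun _ _ => 0).
by have [U [g h]] := hyp bp; exists (U, g).
Qed.

(** The section is defined by an arbitrary choice of a hyperbolic metric and a defining function at
    each point. By [sE] the choice does not affect the value, so near a given point it may be
    replaced by a fixed one. *)
Lemma section_ex h : G h -> exists s : tractor_form, is_cocycle_section X G h s.
Proof.
move=> Gh; have [sel hs] := cocycle_sel.
pose s : @tractor_form R T m := fun gam c p => cocycle (crho (chart_at X p)) (sel p).2 h gam c p.
have sE U g V rho gam c p : open U -> G g -> hyperbolic_on X U g -> local_def X V rho ->
    U p -> V p -> bdry X p -> atlas X c -> cdom c p -> s gam c p = cocycle rho g h gam c p.
  move=> oU Gg Hg ld Up Vp bp Xc cp; have [u1 p1 g1 h1] := hs p bp.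
  have [Xd dp] := chart_at_atlas X p.
  exact: (cocycle_hyperbolic hG m2 gam u1 oU g1 Gg Gh h1 Hg (crho_local Xd) ld Xc p1 Up dp Vp bp cp).
have s0 c p : exists a, forall gam, s gam c p = (0, 0, a) by exact: cocycle_X.
exists s; split; last first.
  by move=> U g V rho oU Gg Hg ld gam c p _ Xc [Up Vp] bp cp; exact: (sE U g V rho).
split.
- move=> gam c d p _ Xc Xd bp cp dp; have [u1 p1 g1 h1] := hs p bp.
  rewrite !(sE _ _ _ _ _ _ p u1 g1 h1 (crho_local Xd) p1 dp bp)//.
  exact: (cocycle_pull hG m2 (bmap_id X) g1 Gh g1 Gh (related_id (G_metric hG g1))
    (related_id (G_metric hG Gh)) (crho_local Xd) dp bp Xc Xd cp dp).
(* A triple (0, 0, a) is fixed by every change of splitting. *)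
- move=> gam gam' f _ _ _ _ c p _ _ _; have [a E] := s0 c p.
  by rewrite !E /change_splitting /= !scale0r !addr0 !mulr0 trmx0 mulmx0 mxE !addr0 subr0.
- move=> gam c _ Xc; split.
  + have -> : (fun x => (s gam c (cinv c x)).1.1) = cst 0.
      by apply/funext => x; have [a ->] := s0 c (cinv c x).
    by move=> x _; exists setT, (cst 0); split=> //; [exact: openT|exact: smooth_open_cst].
  + move=> j; have -> : (fun x => (s gam c (cinv c x)).1.2 ord0 j) = cst 0.
      by apply/funext => x; have [a ->] := s0 c (cinv c x); rewrite mxE.
    by move=> x _; exists setT, (cst 0); split=> //; [exact: openT|exact: smooth_open_cst].
  (* Near [p] the metric selected at [p] and the normal coordinate of [c] are kept fixed, which
     exhibits the slot as [kval] of smooth data. *)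
  + apply: (hext_bdry_smooth_on (k := fun z => (s gam c z).2) Xc) => p bp cp.
    have [u1 p1 g1 h1] := hs p bp.
    have lc := crho_local Xc.
    have [V [gb [s' [Vp VU D]]]] := bdata_ex hG m2 g1 Gh lc cp bp.
    have [oV sgb ss _ _] := D.
    have [FA hA] := smooth_tensor2_hext oV sgb Xc Vp cp.
    have [FM hM] := smooth_tensor2_hext oV ss Xc Vp cp.
    have hx := chart_halfspace Xc cp.
    have FAx : FA (cmap c p) = gb c p by apply/matrixP => i j; rewrite -(hextE hx (hA i j)) (cinvK Xc cp).
    have [_ pg ug _ _] := bdata_pos D Xc Vp bp cp.
    exists (fun z => kval (gb c z) (s' c z) (e_ o0)), (fun y => kval (FA y) (FM y) (e_ o0)); split.
      split.
        apply: smooth_near_kval; rewrite ?FAx//.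
        * by move=> i j; have [] := hA i j.
        * by move=> i j; have [] := hM i j.
        * exact: posdef_det_gt0 (tangential_posdef pg).
      have nA := mx_hext_eq (A := fun y => gb c (cinv c y)) hA.
      have nM := mx_hext_eq (A := fun y => s' c (cinv c y)) hM.
      by apply: filterS2 nA nM => y e1 e2 hy; rewrite e1// e2.
    apply: filterS3 (open_near_set u1 p1) (open_near_set oV Vp) (open_near_set (open_cdom Xc) cp) => z Uz Vz cz bz.
    rewrite (sE _ _ _ _ _ _ z u1 g1 h1 lc Uz cz bz Xc cz).
    by rewrite (cocycleE D (G_metric hG g1) Xc Vz bz cz) (drho_crho Xc cz) scale_tractor_X.
Qed.

Lemma section_unique h s s' : is_cocycle_section X G h s -> is_cocycle_section X G h s' ->
  eq_tractor_form X G setT s s'.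
Proof.
move=> [_ h1] [_ h2] gam c p cg Xc _ bp cp; have [U [g [oU Up Gg Hg]]] := hyp bp.
have lc := crho_local Xc.
by rewrite (h1 U g _ _ oU Gg Hg lc gam c p)// (h2 U g _ _ oU Gg Hg lc gam c p).
Qed.

(** Near the image of p the form [s] is computed with a hyperbolic metric g and a defining function
    rho, and near p the form [s'] with Phi^* g and the pulled-back rho; [cocycle_pull] relates the
    two. *)
Lemma section_pull Phi Psi h s s' : diff_class X G Phi Psi -> G h ->
  is_cocycle_section X G h s -> is_cocycle_section X G (pull_tensor2 X Phi h) s' ->
  eq_tractor_form X G setT s' (pull_tractor_form X Phi Psi s).
Proof.
move=> hD Gh [_ hs] [_ hs'] gam c p cg Xc _ bp cp.
have [b1 b2] := diff_bmap hD; have [[s1 _] bb _] := b1.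
have bpp : bdry X (Phi p) by exact/bb.
have [Xd dp] := chart_at_atlas X (Phi p).
have [U [g [oU Up Gg Hg]]] := hyp bpp.
have Gpull k : G k -> G (pull_tensor2 X Phi k) by case: hD => _ _ hk _; exact: hk.
have rel k : G k -> related X Phi k (pull_tensor2 X Phi k) := @diff_related _ _ _ _ _ hG _ _ hD k.
have Hg' := hyperbolic_pull b1 (G_metric hG Gg) (G_metric hG (Gpull g Gg)) (rel g Gg) Hg.
have oU' : open (Phi @^-1` U) by apply: open_comp => // x _; exact: s1.
have lc := crho_local Xd.
have G_bdry q : bdry X q -> exists k, G k by move=> /hyp[_ [k [_ _ Gk _]]]; exists k.
rewrite (hs' _ _ _ _ oU' (Gpull g Gg) Hg' (local_def_pull b1 lc) gam c p)//.
(* The triple of [s] is read in the splitting of Psi^* gam, so this metric must be known to lie in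
   the conformal class. *)
rewrite /pull_tractor_form (hs _ _ _ _ oU Gg Hg lc _ _ (Phi p))//; last exact: (diff_conf_pull_inv hG m2 hD).
exact: (cocycle_pull hG m2 b1 Gg Gh (Gpull g Gg) (Gpull h Gh) (rel g Gg) (rel h Gh) lc dp bp Xc Xd cp dp).
Qed.

End Cocycle.

Local Close Scope ring_scope.

Theorem theorem3p17 (R : realType) (T : topologicalType) (m : nat)
    (hm : (2 <= m)%N) (X : oriented_mfd R T m)
    (G : set (@tensor2 R T m)) (hG : asymp_class X G)
    (hyp : forall x : T, bdry X x ->
       exists U g, [/\ open U, U x, G g & hyperbolic_on X U g]) :
  [/\ (forall (U : set T) (g1 g2 h : @tensor2 R T m),
         open U -> G g1 -> G g2 ->
         hyperbolic_on X U g1 -> hyperbolic_on X U g2 -> G h ->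
         forall (V : set T) (rho : T -> R), local_def X V rho ->
         eq_tractor_form X G (U `&` V) (cocycle rho g1 h) (cocycle rho g2 h)),
      (forall h, G h ->
         exists s, is_cocycle_section X G h s /\
           forall s', is_cocycle_section X G h s' ->
             eq_tractor_form X G setT s s'),
      (forall (Phi Psi : T -> T), diff_class X G Phi Psi ->
         conf_isometry X G Phi Psi) &
      (forall (Phi Psi : T -> T), diff_class X G Phi Psi ->
         forall (h : @tensor2 R T m) (s s' : @tractor_form R T m), G h ->
         is_cocycle_section X G h s ->
         is_cocycle_section X G (pull_tensor2 X Phi h) s' ->
         eq_tractor_form X G setT s' (pull_tractor_form X Phi Psi s))].
Proof.
have G_bdry p : bdry X p -> exists g, G g by move=> /hyp[_ [g [_ _ Gg _]]]; exists g.
split.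
- move=> U g1 g2 h oU G1 G2 H1 H2 Gh V rho ld gam c p _ Xc [Up Vp] bp cp.
  exact: (cocycle_hyperbolic hG hm gam oU oU G1 G2 Gh H1 H2 ld ld Xc Up Up Vp Vp bp cp).
- move=> h Gh; have [s hs] := section_ex hG hm hyp Gh; exists s; split=> // s'.
  exact: (section_unique hyp hs).
- by move=> Phi Psi hD; exact: (diff_conf_isometry hG hm hD G_bdry).
- move=> Phi Psi hD h s s' Gh hs hs'; exact: (section_pull hG hm hyp hD Gh hs hs').
Qed.
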